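(* Let $\beta>1$, $\mathbf{L}\in Q^2(\mathbb{D}^2)$, and let $F\colon\mathbb{D}^2\to\mathbb{C}$ be analytic. Suppose there exists $p\in\mathbb{Z}_+$ such that for every $d\in(0,\beta]$ there exists $\eta(d)\in(0,d)$ such that for each $z^0\in\mathbb{D}^2$ there are $R=(r_1,r_2)$ with $r_j=r_j(d,z^0)\in(\eta(d),d)$, $j=1,2$, and $k^0=k^0(d,z^0)\le p$ such that the polynomial $p_{k^0}$ is a main polynomial in the diagonal power expansion of $F$ at $z^0$ on $\mathbb{T}^2\big(z^0,\frac{R}{\mathbf{L}(z^0)}\big)$. Then $F$ has bounded $\mathbf{L}$-index in joint variables.
   Context: $\mathbb{D}^2=\{(z_1,z_2)\in\mathbb{C}^2:|z_1|<1,|z_2|<1\}$, $\mathbb{Z}_+=\{0,1,2,\dots\}$, $\mathbb{R}_+=[0,\infty)$. $\mathbf{L}(z)=(l_1(z),l_2(z))$, where each $l_j\colon\mathbb{D}^2\to\mathbb{R}_+$ is continuous and satisfies $l_j(z_1,z_2)>\beta/(1-|z_j|)$ for all $(z_1,z_2)\in\mathbb{D}^2$, $j=1,2$. For $z^0\in\mathbb{C}^2$ and $R=(r_1,r_2)\in\mathbb{R}_+^2$: $\mathbb{D}^2[z^0,R]=\{z:|z_j-z_j^0|\le r_j,\ j=1,2\}$, $\mathbb{T}^2(z^0,R)=\{z:|z_j-z_j^0|=r_j,\ j=1,2\}$, $\frac{R}{\mathbf{L}(z^0)}=\big(\frac{r_1}{l_1(z^0)},\frac{r_2}{l_2(z^0)}\big)$.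 $F^{(p,q)}=\frac{\partial^{p+q}F}{\partial z_1^p\partial z_2^q}$. An analytic $F\colon\mathbb{D}^2\to\mathbb{C}$ has bounded $\mathbf{L}$-index in joint variables if there is $n_0\in\mathbb{Z}_+$ such that for all $z\in\mathbb{D}^2$ and all $(p_1,p_2)\in\mathbb{Z}_+^2$: $\frac{|F^{(p_1,p_2)}(z)|}{p_1!p_2!\,l_1^{p_1}(z)l_2^{p_2}(z)}\le\max\{\frac{|F^{(k_1,k_2)}(z)|}{k_1!k_2!\,l_1^{k_1}(z)l_2^{k_2}(z)}:0\le k_1+k_2\le n_0\}$. $Q^2(\mathbb{D}^2)$ is the class of such $\mathbf{L}$ for which, for all $R=(r_1,r_2)\in[0,\beta]^2$ and $j=1,2$, $0<\lambda_{1,j}(R)\le\lambda_{2,j}(R)<\infty$, where $\lambda_{1,j}(R)=\inf_{z^0\in\mathbb{D}^2}\inf\{l_j(z)/l_j(z^0): z\in\mathbb{D}^2[z^0,R/\mathbf{L}(z^0)]\}$ and $\lambda_{2,j}(R)=\sup_{z^0\in\mathbb{D}^2}\sup\{l_j(z)/l_j(z^0): z\in\mathbb{D}^2[z^0,R/\mathbf{L}(z^0)]\}$. Diagonal power expansion: for $z^0\in\mathbb{D}^2$ write $F(z)=\sum_{k=0}^\infty p_k(z_1-z_1^0,z_2-z_2^0)$, where $p_k(w_1,w_2)=\sum_{j_1+j_2=k}b_{j_1,j_2}w_1^{j_1}w_2^{j_2}$ and $b_{j_1,j_2}=\frac{F^{(j_1,j_2)}(z^0)}{j_1!j_2!}$.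 For $R=(r_1,r_2)$, the polynomial $p_{k^0}$ ($k^0\in\mathbb{Z}_+$) is a main polynomial of this expansion on $\mathbb{T}^2(z^0,R)$ if for every $z\in\mathbb{T}^2(z^0,R)$: $\big|\sum_{k\ne k^0}p_k(z_1-z_1^0,z_2-z_2^0)\big|\le\frac12\max\{|b_{j_1,j_2}|r_1^{j_1}r_2^{j_2}: j_1+j_2=k^0\}$. *)

(* Defs.v *)
From Stdlib Require Import Reals List Arith ClassicalEpsilon.
From Coquelicot Require Import Coquelicot.
Open Scope R_scope.

Definition D2 (z : C * C) : Prop := Cmod (fst z) < 1 /\ Cmod (snd z) < 1.

Definition polydisc (z0 : C * C) (s1 s2 : R) (z : C * C) : Prop :=
  Cmod (Cminus (fst z) (fst z0)) <= s1 /\ Cmod (Cminus (snd z) (snd z0)) <= s2.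
Definition torus (z0 : C * C) (s1 s2 : R) (z : C * C) : Prop :=
  Cmod (Cminus (fst z) (fst z0)) = s1 /\ Cmod (Cminus (snd z) (snd z0)) = s2.

Definition L_standing (beta : R) (l1 l2 : C * C -> R) : Prop :=
  forall z, D2 z ->
    continuous l1 z /\ continuous l2 z /\ 0 <= l1 z /\ 0 <= l2 z /\
    l1 z > beta / (1 - Cmod (fst z)) /\ l2 z > beta / (1 - Cmod (snd z)).

(* lambda_{1,j}(R) > 0 and lambda_{2,j}(R) < +oo, for all R in [0,beta]^2, j=1,2.
   (lambda_{1,j} <= lambda_{2,j} is automatic since z = z0 lies in the polydisc.) *)
Definition lambda_bounds (beta : R) (l1 l2 : C * C -> R) (lj : C * C -> R) : Prop :=
  forall r1 r2 : R, 0 <= r1 <= beta -> 0 <= r2 <= beta ->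
    (exists c : R, 0 < c /\
       forall z0 z, D2 z0 -> D2 z -> polydisc z0 (r1 / l1 z0) (r2 / l2 z0) z ->
         c <= lj z / lj z0) /\
    (exists M : R,
       forall z0 z, D2 z0 -> D2 z -> polydisc z0 (r1 / l1 z0) (r2 / l2 z0) z ->
         lj z / lj z0 <= M).

Definition Q2 (beta : R) (l1 l2 : C * C -> R) : Prop :=
  L_standing beta l1 l2 /\ lambda_bounds beta l1 l2 l1 /\ lambda_bounds beta l1 l2 l2.

(* complex derivative of f : C -> C at z (meaningful when it exists) *)
Definition Cderive (f : C -> C) (z : C) : C :=
  epsilon (inhabits (RtoC 0)) (fun l => is_derive (K := C_AbsRing) (V := C_NormedModule) f z l).

Definition d1 (G : C * C -> C) : C * C -> C :=
  fun z => Cderive (fun w => G (w, snd z)) (fst z).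
Definition d2 (G : C * C -> C) : C * C -> C :=
  fun z => Cderive (fun w => G (fst z, w)) (snd z).

Definition pderiv (F : C * C -> C) (p q : nat) : C * C -> C :=
  Nat.iter p d1 (Nat.iter q d2 F).

Definition analytic_D2 (F : C * C -> C) : Prop :=
  forall z, D2 z ->
    continuous F z /\
    ex_derive (K := C_AbsRing) (V := C_NormedModule) (fun w => F (w, snd z)) (fst z) /\
    ex_derive (K := C_AbsRing) (V := C_NormedModule) (fun w => F (fst z, w)) (snd z).

Definition L_term (l1 l2 : C * C -> R) (F : C * C -> C) (z : C * C) (p1 p2 : nat) : R :=
  Cmod (pderiv F p1 p2 z) / (INR (fact p1) * INR (fact p2) * l1 z ^ p1 * l2 z ^ p2).

(* bounded L-index in joint variables; "<= max over k1+k2 <= n0" written as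
   "<= some term with k1+k2 <= n0" (the max over a finite nonempty set). *)
Definition bounded_L_index (l1 l2 : C * C -> R) (F : C * C -> C) : Prop :=
  exists n0 : nat, forall z, D2 z -> forall p1 p2 : nat,
    exists k1 k2 : nat, (k1 + k2 <= n0)%nat /\
      L_term l1 l2 F z p1 p2 <= L_term l1 l2 F z k1 k2.

Definition bcoef (F : C * C -> C) (z0 : C * C) (j1 j2 : nat) : C :=
  Cdiv (pderiv F j1 j2 z0) (RtoC (INR (fact j1) * INR (fact j2))).

Definition Csum (l : list C) : C := fold_right Cplus (RtoC 0) l.

Definition pk (F : C * C -> C) (z0 : C * C) (k : nat) (w1 w2 : C) : C :=
  Csum (map (fun j => Cmult (bcoef F z0 j (k - j))
                       (Cmult (pow_n (K := C_Ring) w1 j) (pow_n (K := C_Ring) w2 (k - j))))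
            (seq 0 (S k))).

Definition main_max (F : C * C -> C) (z0 : C * C) (k : nat) (s1 s2 : R) : R :=
  fold_right Rmax 0
    (map (fun j => Cmod (bcoef F z0 j (k - j)) * s1 ^ j * s2 ^ (k - j)) (seq 0 (S k))).

Definition main_polynomial (F : C * C -> C) (z0 : C * C) (k0 : nat) (s1 s2 : R) : Prop :=
  forall z, torus z0 s1 s2 z ->
    exists S : C,
      is_series (K := C_AbsRing) (V := C_NormedModule)
        (fun k => if Nat.eqb k k0 then RtoC 0
                  else pk F z0 k (Cminus (fst z) (fst z0)) (Cminus (snd z) (snd z0))) S /\
      Cmod S <= / 2 * main_max F z0 k0 s1 s2.

(* Main.v *)
(** A Fourier coefficient of the remainder on the
    torus is at most a constant times its supremum, so every coefficient of total degree other
    than [k0] is dominated by the largest one of degree [k0]; with [d = beta] this bounds the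
    normalised derivatives of order [p + 1] at each point by those of order at most [p]
    (Hayman's criterion; no smaller [d] is needed).  Since [L] varies by bounded factors on
    the polydisc of radii [beta / L(z0)], Gronwall's inequality bounds [F] there by a constant
    times the normalised derivatives of order at most [p] at [z0], and Cauchy's estimates on
    that polydisc give the factor [beta^-(m + n)], which beats the constant for [m + n] large.

    Holomorphy is only pointwise complex differentiability, so Cauchy's theorem is proved by
    Goursat's bisection, in the coordinates [a + exp(x + i t)] where a circle becomes a
    vertical segment: this yields the mean value property at the centre directly. *)

From Stdlib Require Import Reals Lra Lia List Arith ClassicalEpsilon.
From Coquelicot Require Import Coquelicot.
Require Import Defs.
Open Scope R_scope.

(** * Complex derivatives *)

(** No integral formula for derivatives is set up. The mean value property, applied to the
    difference quotient of f at a with its limit filled in, already bounds f'(a); from this bound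
    follow a quadratic Taylor estimate and Weierstrass' theorem on uniform limits. That route is
    forced by [pderiv]: its values are chosen by [epsilon] and mean something only once [d1 F] and
    [d2 F] are known to be holomorphic again. This, and the symmetry of mixed derivatives, come from
    seeing [d1 F] as a locally uniform limit of difference quotients of [F].

    The diagonal expansion yields to Fourier analysis because p_k is homogeneous: rotating both
    variables by one angle u multiplies p_k by exp(iku), so u separates the degrees; rotating the
    first variable alone then separates the monomials of one degree. Each extraction costs a factor
    2, which turns the 1/2 in the definition of a main polynomial into 2.

    Most factors 2 and 4 arise from bounding real and imaginary parts separately and carry no
    meaning. *)

Definition cderiv (f : C -> C) (z l : C) : Prop :=
  is_derive (K := C_AbsRing) (V := C_NormedModule) f z l.

(** [is_derive] demands the estimate at every limit of the neighbourhood filter of [z]; uniqueness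
    of limits leaves only [z] itself. *)
Lemma cderiv_iff (f : C -> C) (z l : C) :
  cderiv f z l <->
  forall eps, 0 < eps -> exists del, 0 < del /\ forall w, Cmod (w - z) < del ->
    Cmod (f w - f z - (w - z) * l) <= eps * Cmod (w - z).
Proof.
  split.
  - intros [_ H] eps He.
    destruct (H z (fun P HP => HP) (mkposreal eps He)) as [d Hd].
    exists d; split; [apply cond_pos|]. intros w Hw. exact (Hd w Hw).
  - intros H. split.
    + apply (is_linear_scal_l (K := C_AbsRing) (V := C_NormedModule)).
    + intros x Hx eps.
      assert (Ez : z = x).
      { apply (is_filter_lim_locally_unique (K := C_AbsRing) (V := AbsRing_NormedModule C_AbsRing)). exact Hx. }
      subst x. destruct (H eps (cond_pos eps)) as [d [Hd Hd']].
      exists (mkposreal d Hd). intros w Hw. exact (Hd' w Hw).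
Qed.

(* [C_NormedModule] and [AbsRing_NormedModule C_AbsRing] carry different uniform structures on the codomain. *)
Lemma cderiv_AbsRing (f : C -> C) (z l : C) :
  cderiv f z l <-> is_derive (K := C_AbsRing) (V := AbsRing_NormedModule C_AbsRing) f z l.
Proof.
  split; intros [_ H]; (split; [|exact H]).
  - apply (is_linear_scal_l (K := C_AbsRing) (V := AbsRing_NormedModule C_AbsRing)).
  - apply (is_linear_scal_l (K := C_AbsRing) (V := C_NormedModule)).
Qed.

(** Phrased with [Cmod], so that neither of the two uniform structures on [C] has to be singled
    out. *)
Definition ccontinuous (f : C -> C) (z : C) : Prop :=
  forall eps, 0 < eps -> exists del, 0 < del /\ forall w, Cmod (w - z) < del ->
    Cmod (f w - f z) < eps.

Lemma cderiv_ext_loc (f g : C -> C) (z l : C) (d : R) :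
  0 < d -> (forall w, Cmod (w - z) < d -> f w = g w) -> cderiv f z l -> cderiv g z l.
Proof.
  intros Hd He H. rewrite cderiv_iff in *. intros eps Heps.
  destruct (H eps Heps) as [del [Hdel H']].
  exists (Rmin d del). split; [apply Rmin_pos; assumption|].
  intros w Hw. rewrite <- !He.
  - apply H'. eapply Rlt_le_trans; [exact Hw|apply Rmin_r].
  - replace (z - z)%C with (RtoC 0) by ring. rewrite Cmod_0; exact Hd.
  - eapply Rlt_le_trans; [exact Hw|apply Rmin_l].
Qed.

Lemma cderiv_const (c z : C) : cderiv (fun _ => c) z 0.
Proof. exact (is_derive_const (K := C_AbsRing) (V := C_NormedModule) c z). Qed.

Lemma cderiv_id (z : C) : cderiv (fun w => w) z 1.
Proof. apply cderiv_AbsRing. exact (is_derive_id (K := C_AbsRing) z). Qed.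

Lemma cderiv_plus (f g : C -> C) (z l m : C) :
  cderiv f z l -> cderiv g z m -> cderiv (fun w => f w + g w)%C z (l + m)%C.
Proof. exact (is_derive_plus (K := C_AbsRing) (V := C_NormedModule) f g z l m). Qed.

Lemma cderiv_mult (f g : C -> C) (z l m : C) :
  cderiv f z l -> cderiv g z m -> cderiv (fun w => f w * g w)%C z (l * g z + f z * m)%C.
Proof.
  intros H1 H2. rewrite cderiv_AbsRing in *.
  exact (is_derive_mult (K := C_AbsRing) f g z l m H1 H2 Cmult_comm).
Qed.

Lemma cderiv_unique (f : C -> C) (z l m : C) : cderiv f z l -> cderiv f z m -> l = m.
Proof.
  intros H1 H2. rewrite <- (is_C_derive_unique f z l H1). exact (is_C_derive_unique f z m H2).
Qed.

Lemma cderiv_comp (f g : C -> C) (z l m : C) :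
  cderiv g z m -> cderiv f (g z) l -> cderiv (fun w => f (g w)) z (m * l)%C.
Proof.
  intros H1 H2. rewrite cderiv_AbsRing in H1.
  exact (is_derive_comp (K := C_AbsRing) (V := C_NormedModule) f g z l m H2 H1).
Qed.

Lemma Cmod_minus_sym (a b : C) : Cmod (a - b) = Cmod (b - a).
Proof. rewrite <- Cmod_opp. f_equal. ring. Qed.

Lemma cderiv_continuous (f : C -> C) (z l : C) : cderiv f z l -> ccontinuous f z.
Proof.
  intros H eps He. rewrite cderiv_iff in H.
  destruct (H 1 Rlt_0_1) as [d [Hd H']].
  pose proof (Cmod_ge_0 l) as Hl.
  set (k := eps / (2 + Cmod l)).
  assert (Hk : 0 < k) by (apply Rdiv_lt_0_compat; lra).
  exists (Rmin d k). split; [apply Rmin_pos; assumption|].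
  intros w Hw.
  assert (Hw1 : Cmod (w - z) < d) by (eapply Rlt_le_trans; [exact Hw|apply Rmin_l]).
  assert (Hw2 : Cmod (w - z) < k) by (eapply Rlt_le_trans; [exact Hw|apply Rmin_r]).
  specialize (H' w Hw1).
  replace (f w - f z)%C with ((f w - f z - (w - z) * l) + (w - z) * l)%C by ring.
  eapply Rle_lt_trans; [apply Cmod_triangle|]. rewrite Cmod_mult.
  assert (E : k * (2 + Cmod l) = eps) by (unfold k; field; lra).
  nra.
Qed.

Lemma cderiv_inv (z : C) : z <> 0 -> cderiv Cinv z (- / (z * z))%C.
Proof.
  intros Hz. rewrite cderiv_iff. intros eps He.
  assert (Hm : 0 < Cmod z) by (apply Cmod_gt_0; exact Hz).
  (* The remainder is (w - z)^2 / (w z^2), and |w| > |z| / 2 near z; it is therefore at most eps |w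
     - z| as soon as |w - z| < [k]. *)
  set (k := eps * (Cmod z * Cmod z * Cmod z) / 2).
  assert (Hk : 0 < k) by (unfold k; apply Rdiv_lt_0_compat; [|lra]; repeat apply Rmult_lt_0_compat; assumption).
  exists (Rmin (Cmod z / 2) k). split; [apply Rmin_pos; lra|].
  intros w Hw.
  assert (Hw1 : Cmod (w - z) < Cmod z / 2) by (eapply Rlt_le_trans; [exact Hw|apply Rmin_l]).
  assert (Hw2 : Cmod (w - z) < k) by (eapply Rlt_le_trans; [exact Hw|apply Rmin_r]).
  assert (Hwm : Cmod z / 2 < Cmod w).
  { assert (Cmod z <= Cmod w + Cmod (w - z)).
    { replace z with (w - (w - z))%C at 1 by ring. unfold Cminus at 1.
      eapply Rle_trans; [apply Cmod_triangle|]. rewrite Cmod_opp. lra. }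
    lra. }
  assert (Hw0 : w <> 0) by (apply Cmod_gt_0; lra).
  replace (/ w - / z - (w - z) * - / (z * z))%C with ((w - z) * ((w - z) / (w * (z * z))))%C
    by (field; auto).
  rewrite !Cmod_mult, Rmult_comm. apply Rmult_le_compat_r; [apply Cmod_ge_0|].
  rewrite Cmod_div by (repeat apply Cmult_neq_0; assumption). rewrite !Cmod_mult.
  apply Rle_div_l; [clear - Hm Hwm; apply Rmult_lt_0_compat; [lra|apply Rmult_lt_0_compat; lra]|].
  assert (k = eps * (Cmod z / 2 * (Cmod z * Cmod z))) by (unfold k; field).
  assert (Cmod z / 2 * (Cmod z * Cmod z) <= Cmod w * (Cmod z * Cmod z))
    by (apply Rmult_le_compat_r; nra).
  nra.
Qed.

(** * Curves in the plane and their integrals *)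

Lemma Cmod_le_abs (z : C) : Cmod z <= Rabs (Re z) + Rabs (Im z).
Proof.
  replace z with (RtoC (Re z) + Ci * RtoC (Im z))%C at 1.
  - eapply Rle_trans; [apply Cmod_triangle|]. rewrite Cmod_mult, Cmod_Ci, !Cmod_R. lra.
  - apply injective_projections; unfold Re, Im; simpl; ring.
Qed.

Lemma im_le_Cmod (z : C) : Rabs (Im z) <= Cmod z.
Proof. eapply Rle_trans; [|apply Rmax_Cmod]. apply Rmax_r. Qed.

Lemma Cmod_minus_triangle (a b : C) : Cmod (a - b) <= Cmod a + Cmod b.
Proof. eapply Rle_trans; [apply Cmod_triangle|]. rewrite Cmod_opp. lra. Qed.

(** Curves are treated by components, so that integrals and the mean value theorem are the real
    ones. *)
Definition curve_continuous (f : R -> C) (t : R) : Prop :=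
  continuous (fun s => Re (f s)) t /\ continuous (fun s => Im (f s)) t.

Definition curve_derive (f : R -> C) (t : R) (l : C) : Prop :=
  is_derive (fun s => Re (f s)) t (Re l) /\ is_derive (fun s => Im (f s)) t (Im l).

Lemma curve_continuous_iff (f : R -> C) (t : R) :
  curve_continuous f t <->
  forall eps, 0 < eps -> exists del, 0 < del /\ forall s, Rabs (s - t) < del ->
    Cmod (f s - f t) < eps.
Proof.
  split.
  - intros [H1 H2] eps He. assert (He2 : 0 < eps / 2) by lra.
    destruct (H1 _ (locally_ball (Re (f t)) (mkposreal _ He2))) as [d1 Hd1].
    destruct (H2 _ (locally_ball (Im (f t)) (mkposreal _ He2))) as [d2 Hd2].
    exists (Rmin d1 d2). split; [apply Rmin_pos; apply cond_pos|]. intros s Hs.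
    assert (A1 : Rabs (Re (f s) - Re (f t)) < eps / 2).
    { apply Hd1. change (Rabs (s - t) < d1). eapply Rlt_le_trans; [exact Hs|apply Rmin_l]. }
    assert (A2 : Rabs (Im (f s) - Im (f t)) < eps / 2).
    { apply Hd2. change (Rabs (s - t) < d2). eapply Rlt_le_trans; [exact Hs|apply Rmin_r]. }
    eapply Rle_lt_trans; [apply Cmod_le_abs|].
    change (Rabs (Re (f s) - Re (f t)) + Rabs (Im (f s) - Im (f t)) < eps). lra.
  - intros H. split; intros P [e HP]; destruct (H e (cond_pos e)) as [d [Hd Hd']];
      exists (mkposreal d Hd); intros s Hs; apply HP; specialize (Hd' s Hs).
    + eapply Rle_lt_trans; [apply (re_le_Cmod (f s - f t))|exact Hd'].
    + eapply Rle_lt_trans; [apply (im_le_Cmod (f s - f t))|exact Hd'].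
Qed.

Lemma is_derive_eps (f : R -> R) (t l : R) :
  is_derive f t l <->
  forall eps, 0 < eps -> exists del, 0 < del /\ forall s, Rabs (s - t) < del ->
    Rabs (f s - f t - (s - t) * l) <= eps * Rabs (s - t).
Proof.
  split.
  - intros [_ H] eps He.
    destruct (H t (fun P HP => HP) (mkposreal eps He)) as [d Hd].
    exists d; split; [apply cond_pos|]. intros w Hw. exact (Hd w Hw).
  - intros H. split.
    + apply (is_linear_scal_l (K := R_AbsRing) (V := R_NormedModule)).
    + intros x Hx eps.
      assert (Ez : t = x).
      { apply (is_filter_lim_locally_unique (K := R_AbsRing) (V := AbsRing_NormedModule R_AbsRing)). exact Hx. }
      subst x. destruct (H eps (cond_pos eps)) as [d [Hd Hd']].
      exists (mkposreal d Hd). intros w Hw. exact (Hd' w Hw).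
Qed.

Lemma curve_derive_iff (f : R -> C) (t : R) (l : C) :
  curve_derive f t l <->
  forall eps, 0 < eps -> exists del, 0 < del /\ forall s, Rabs (s - t) < del ->
    Cmod (f s - f t - RtoC (s - t) * l) <= eps * Rabs (s - t).
Proof.
  unfold curve_derive. rewrite !is_derive_eps.
  assert (ER : forall s, Re (f s - f t - RtoC (s - t) * l)%C = Re (f s) - Re (f t) - (s - t) * Re l)
    by (intros; unfold Re; simpl; ring).
  assert (EI : forall s, Im (f s - f t - RtoC (s - t) * l)%C = Im (f s) - Im (f t) - (s - t) * Im l)
    by (intros; unfold Im; simpl; ring).
  split.
  - intros [H1 H2] eps He. assert (He2 : 0 < eps / 2) by lra.
    destruct (H1 _ He2) as [d1 [P1 Q1]]. destruct (H2 _ He2) as [d2 [P2 Q2]].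
    exists (Rmin d1 d2). split; [apply Rmin_pos; assumption|]. intros s Hs.
    eapply Rle_trans; [apply Cmod_le_abs|]. rewrite ER, EI.
    specialize (Q1 s (Rlt_le_trans _ _ _ Hs (Rmin_l _ _))).
    specialize (Q2 s (Rlt_le_trans _ _ _ Hs (Rmin_r _ _))). lra.
  - intros H. split; intros eps He; destruct (H eps He) as [d [Hd Hd']]; exists d;
      (split; [exact Hd|]); intros s Hs; eapply Rle_trans; [|apply Hd', Hs| |apply Hd', Hs].
    + rewrite <- ER. apply re_le_Cmod.
    + rewrite <- EI. apply im_le_Cmod.
Qed.

Lemma curve_derive_continuous (f : R -> C) (t : R) (l : C) :
  curve_derive f t l -> curve_continuous f t.
Proof.
  intros [H1 H2]. split.
  - exact (ex_derive_continuous (K := R_AbsRing) (V := R_NormedModule) _ t (ex_intro _ _ H1)).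
  - exact (ex_derive_continuous (K := R_AbsRing) (V := R_NormedModule) _ t (ex_intro _ _ H2)).
Qed.

Lemma curve_continuous_comp (g : C -> C) (f : R -> C) (t : R) :
  curve_continuous f t -> ccontinuous g (f t) -> curve_continuous (fun s => g (f s)) t.
Proof.
  rewrite !curve_continuous_iff. intros Hf Hg eps He.
  destruct (Hg eps He) as [d [Hd Hd']]. destruct (Hf d Hd) as [e [He' H]].
  exists e. split; [exact He'|]. intros s Hs. apply Hd', H, Hs.
Qed.

Lemma curve_derive_comp (g : C -> C) (f : R -> C) (t : R) (l m : C) :
  curve_derive f t m -> cderiv g (f t) l -> curve_derive (fun s => g (f s)) t (m * l)%C.
Proof.
  intros Hf Hg. pose proof (curve_derive_continuous _ _ _ Hf) as Hc.
  rewrite curve_derive_iff in *. rewrite curve_continuous_iff in Hc. rewrite cderiv_iff in Hg.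
  intros eps He.
  pose proof (Cmod_ge_0 l) as Hl. pose proof (Cmod_ge_0 m) as Hm.
  (* The remainder of [g] is at most e1 |u|, where |u| <= (1 + |m|) |s - t| because e2 <= 1; the
     remainder of [f] is multiplied by |l|. Each of the two receives half of eps. *)
  set (e1 := eps / (2 * (1 + Cmod m))).
  set (e2 := Rmin 1 (eps / (2 * (1 + Cmod l)))).
  assert (He1 : 0 < e1) by (apply Rdiv_lt_0_compat; lra).
  assert (He2' : 0 < eps / (2 * (1 + Cmod l))) by (apply Rdiv_lt_0_compat; lra).
  assert (He2 : 0 < e2) by (apply Rmin_pos; lra).
  destruct (Hg e1 He1) as [d1 [P1 Q1]]. destruct (Hc d1 P1) as [d2 [P2 Q2]].
  destruct (Hf e2 He2) as [d3 [P3 Q3]].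
  exists (Rmin d2 d3). split; [apply Rmin_pos; assumption|]. intros s Hs.
  specialize (Q2 s (Rlt_le_trans _ _ _ Hs (Rmin_l _ _))).
  specialize (Q3 s (Rlt_le_trans _ _ _ Hs (Rmin_r _ _))).
  specialize (Q1 _ Q2).
  set (u := (f s - f t)%C) in *.
  replace (g (f s) - g (f t) - RtoC (s - t) * (m * l))%C
    with ((g (f s) - g (f t) - u * l) + (u - RtoC (s - t) * m) * l)%C by ring.
  eapply Rle_trans; [apply Cmod_triangle|]. rewrite Cmod_mult.
  assert (Hu : Cmod u <= (1 + Cmod m) * Rabs (s - t)).
  { replace u with ((u - RtoC (s - t) * m) + RtoC (s - t) * m)%C by ring.
    eapply Rle_trans; [apply Cmod_triangle|]. rewrite Cmod_mult, Cmod_R.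
    assert (e2 * Rabs (s - t) <= 1 * Rabs (s - t))
      by (apply Rmult_le_compat_r; [apply Rabs_pos|apply Rmin_l]). lra. }
  assert (A1 : e1 * Cmod u <= eps / 2 * Rabs (s - t)).
  { replace (eps / 2 * Rabs (s - t)) with (e1 * ((1 + Cmod m) * Rabs (s - t)))
      by (unfold e1; field; lra).
    apply Rmult_le_compat_l; lra. }
  assert (A2 : Cmod (u - RtoC (s - t) * m) * Cmod l <= eps / 2 * Rabs (s - t)).
  { apply Rle_trans with (eps / (2 * (1 + Cmod l)) * Rabs (s - t) * (1 + Cmod l)).
    - apply Rmult_le_compat; [apply Cmod_ge_0|lra| |lra].
      eapply Rle_trans; [exact Q3|]. apply Rmult_le_compat_r; [apply Rabs_pos|apply Rmin_r].
    - right. field. lra. }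
  lra.
Qed.

Lemma curve_continuous_const (c : C) (t : R) : curve_continuous (fun _ => c) t.
Proof. split; apply continuous_const. Qed.

Lemma curve_continuous_plus (f g : R -> C) (t : R) :
  curve_continuous f t -> curve_continuous g t -> curve_continuous (fun s => f s + g s)%C t.
Proof.
  intros [H1 H2] [H3 H4]. split.
  - exact (continuous_plus (fun s => Re (f s)) (fun s => Re (g s)) t H1 H3).
  - exact (continuous_plus (fun s => Im (f s)) (fun s => Im (g s)) t H2 H4).
Qed.

Lemma curve_continuous_mult (f g : R -> C) (t : R) :
  curve_continuous f t -> curve_continuous g t -> curve_continuous (fun s => f s * g s)%C t.
Proof.
  intros [H1 H2] [H3 H4]. split.
  - exact (continuous_minus (fun s => Re (f s) * Re (g s)) (fun s => Im (f s) * Im (g s)) t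
      (continuous_mult (K := R_AbsRing) _ _ t H1 H3) (continuous_mult (K := R_AbsRing) _ _ t H2 H4)).
  - exact (continuous_plus (fun s => Re (f s) * Im (g s)) (fun s => Im (f s) * Re (g s)) t
      (continuous_mult (K := R_AbsRing) _ _ t H1 H4) (continuous_mult (K := R_AbsRing) _ _ t H2 H3)).
Qed.

Lemma curve_derive_const (c : C) (t : R) : curve_derive (fun _ => c) t 0%C.
Proof. split; exact (is_derive_const _ t). Qed.

Lemma curve_derive_mult (f g : R -> C) (t : R) (l m : C) :
  curve_derive f t l -> curve_derive g t m ->
  curve_derive (fun s => f s * g s)%C t (l * g t + f t * m)%C.
Proof.
  intros [H1 H2] [H3 H4]. split.
  - eapply (is_derive_ext (fun s => Re (f s) * Re (g s) - Im (f s) * Im (g s)));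
      [intros s; reflexivity|].
    replace (Re (l * g t + f t * m)%C)
      with ((Re l * Re (g t) + Re (f t) * Re m) - (Im l * Im (g t) + Im (f t) * Im m))
      by (unfold Re, Im; simpl; ring).
    exact (is_derive_minus _ _ t _ _ (is_derive_mult _ _ t _ _ H1 H3 Rmult_comm) (is_derive_mult _ _ t _ _ H2 H4 Rmult_comm)).
  - eapply (is_derive_ext (fun s => Re (f s) * Im (g s) + Im (f s) * Re (g s)));
      [intros s; reflexivity|].
    replace (Im (l * g t + f t * m)%C)
      with ((Re l * Im (g t) + Re (f t) * Im m) + (Im l * Re (g t) + Im (f t) * Re m))
      by (unfold Re, Im; simpl; ring).
    exact (is_derive_plus _ _ t _ _ (is_derive_mult _ _ t _ _ H1 H4 Rmult_comm) (is_derive_mult _ _ t _ _ H2 H3 Rmult_comm)).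
Qed.

Definition is_CInt (f : R -> C) (a b : R) (l : C) : Prop :=
  is_RInt (fun t => Re (f t)) a b (Re l) /\ is_RInt (fun t => Im (f t)) a b (Im l).

Definition CInt (f : R -> C) (a b : R) : C :=
  (RInt (fun t => Re (f t)) a b, RInt (fun t => Im (f t)) a b).

Lemma CInt_correct (f : R -> C) (a b : R) :
  a <= b -> (forall t, a <= t <= b -> curve_continuous f t) -> is_CInt f a b (CInt f a b).
Proof.
  intros Hab H. split; apply (RInt_correct (V := R_CompleteNormedModule));
    apply ex_RInt_continuous; rewrite Rmin_left, Rmax_right by lra; intros t Ht; apply H, Ht.
Qed.

Lemma is_CInt_unique (f : R -> C) (a b : R) (l : C) : is_CInt f a b l -> CInt f a b = l.
Proof.
  intros [H1 H2]. unfold CInt. rewrite (is_RInt_unique _ _ _ _ H1), (is_RInt_unique _ _ _ _ H2).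
  symmetry; apply surjective_pairing.
Qed.

Lemma is_CInt_Chasles (f : R -> C) (a b c : R) (l m : C) :
  is_CInt f a b l -> is_CInt f b c m -> is_CInt f a c (l + m)%C.
Proof.
  intros [H1 H2] [H3 H4]. split.
  - exact (is_RInt_Chasles _ _ _ _ _ _ H1 H3).
  - exact (is_RInt_Chasles _ _ _ _ _ _ H2 H4).
Qed.

Lemma is_CInt_plus (f g : R -> C) (a b : R) (l m : C) :
  is_CInt f a b l -> is_CInt g a b m -> is_CInt (fun t => f t + g t)%C a b (l + m)%C.
Proof.
  intros [H1 H2] [H3 H4]. split.
  - exact (is_RInt_plus _ _ _ _ _ _ H1 H3).
  - exact (is_RInt_plus _ _ _ _ _ _ H2 H4).
Qed.

Lemma is_CInt_scal (f : R -> C) (c : C) (a b : R) (l : C) :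
  is_CInt f a b l -> is_CInt (fun t => c * f t)%C a b (c * l)%C.
Proof.
  intros [H1 H2]. split.
  - exact (is_RInt_minus _ _ _ _ _ _ (is_RInt_scal _ _ _ (Re c) _ H1) (is_RInt_scal _ _ _ (Im c) _ H2)).
  - exact (is_RInt_plus _ _ _ _ _ _ (is_RInt_scal _ _ _ (Re c) _ H2) (is_RInt_scal _ _ _ (Im c) _ H1)).
Qed.

Lemma is_CInt_minus (f g : R -> C) (a b : R) (l m : C) :
  is_CInt f a b l -> is_CInt g a b m -> is_CInt (fun t => f t - g t)%C a b (l - m)%C.
Proof.
  intros [H1 H2] [H3 H4]. split.
  - exact (is_RInt_minus _ _ _ _ _ _ H1 H3).
  - exact (is_RInt_minus _ _ _ _ _ _ H2 H4).
Qed.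

Lemma is_CInt_const (c : C) (a b : R) : is_CInt (fun _ => c) a b (RtoC (b - a) * c)%C.
Proof.
  split.
  - replace (Re (RtoC (b - a) * c)%C) with (scal (b - a) (Re c)).
    + apply (is_RInt_const a b (Re c)).
    + unfold scal, Re; simpl; unfold mult; simpl; ring.
  - replace (Im (RtoC (b - a) * c)%C) with (scal (b - a) (Im c)).
    + apply (is_RInt_const a b (Im c)).
    + unfold scal, Im; simpl; unfold mult; simpl; ring.
Qed.

Lemma is_CInt_ext (f g : R -> C) (a b : R) (l : C) :
  a <= b -> (forall t, a <= t <= b -> f t = g t) -> is_CInt f a b l -> is_CInt g a b l.
Proof.
  intros Hab He [H1 H2]. split.
  - eapply is_RInt_ext; [|exact H1]. rewrite Rmin_left, Rmax_right by lra.
    intros t Ht; simpl; rewrite He by lra; reflexivity.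
  - eapply is_RInt_ext; [|exact H2]. rewrite Rmin_left, Rmax_right by lra.
    intros t Ht; simpl; rewrite He by lra; reflexivity.
Qed.

Lemma is_CInt_bound (f : R -> C) (a b M : R) (l : C) :
  a <= b -> (forall t, a <= t <= b -> Cmod (f t) <= M) -> is_CInt f a b l ->
  Cmod l <= 2 * ((b - a) * M).
Proof.
  intros Hab HM [H1 H2]. eapply Rle_trans; [apply Cmod_le_abs|].
  assert (A1 : Rabs (Re l) <= (b - a) * M).
  { apply (norm_RInt_le_const (V := R_NormedModule) (fun t => Re (f t)) a b (Re l) M Hab); [|exact H1].
    intros t Ht. eapply Rle_trans; [apply re_le_Cmod|apply HM, Ht]. }
  assert (A2 : Rabs (Im l) <= (b - a) * M).
  { apply (norm_RInt_le_const (V := R_NormedModule) (fun t => Im (f t)) a b (Im l) M Hab); [|exact H2].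
    intros t Ht. eapply Rle_trans; [apply im_le_Cmod|apply HM, Ht]. }
  lra.
Qed.

Lemma is_CInt_derive (f df : R -> C) (a b : R) :
  a <= b ->
  (forall t, a <= t <= b -> curve_derive f t (df t)) ->
  (forall t, a <= t <= b -> curve_continuous df t) ->
  is_CInt df a b (f b - f a)%C.
Proof.
  intros Hab H1 H2. split.
  - apply (is_RInt_derive (fun t => Re (f t)) (fun t => Re (df t)));
      rewrite Rmin_left, Rmax_right by lra; intros t Ht; [apply H1, Ht|apply H2, Ht].
  - apply (is_RInt_derive (fun t => Im (f t)) (fun t => Im (df t)));
      rewrite Rmin_left, Rmax_right by lra; intros t Ht; [apply H1, Ht|apply H2, Ht].
Qed.

(** * Bisection of rectangles and polar coordinates *)

Lemma pow_half_pos (n : nat) : 0 < (/ 2) ^ n.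
Proof. apply pow_lt; lra. Qed.

Lemma pow_half_small (e : R) : 0 < e -> exists n : nat, (/ 2) ^ n < e.
Proof.
  intros He. destruct (pow_lt_1_zero (/ 2)) with (y := e) as [N HN].
  - rewrite Rabs_right; lra.
  - exact He.
  - exists N. specialize (HN N (le_n N)). rewrite Rabs_right in HN; [exact HN|].
    apply Rle_ge, Rlt_le, pow_half_pos.
Qed.

(** Every left end lies below every right end, so the supremum of the left ends belongs to all the
    intervals. *)
Lemma nested_intervals (x : nat -> R) (w : R) :
  0 <= w ->
  (forall n, x n <= x (S n) /\ x (S n) + (/ 2) ^ S n * w <= x n + (/ 2) ^ n * w) ->
  exists c, forall n, x n <= c <= x n + (/ 2) ^ n * w.
Proof.
  intros Hw H.
  assert (Hmono : forall k n, x n <= x (n + k)%nat /\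
            x (n + k)%nat + (/ 2) ^ (n + k) * w <= x n + (/ 2) ^ n * w).
  { induction k; intros n; [rewrite Nat.add_0_r; lra|].
    replace (n + S k)%nat with (S (n + k)) by lia.
    specialize (IHk n). specialize (H (n + k)%nat). lra. }
  assert (Hle : forall n m, x n <= x m + (/ 2) ^ m * w).
  { intros n m. destruct (Nat.le_ge_cases n m) as [L|L].
    - destruct (Hmono (m - n)%nat n) as [A _]. replace (n + (m - n))%nat with m in A by lia.
      pose proof (Rmult_le_pos _ _ (Rlt_le _ _ (pow_half_pos m)) Hw). lra.
    - destruct (Hmono (n - m)%nat m) as [_ A]. replace (m + (n - m))%nat with n in A by lia.
      pose proof (Rmult_le_pos _ _ (Rlt_le _ _ (pow_half_pos n)) Hw). lra. }
  destruct (completeness (fun y => exists n, y = x n)) as [c [U L]].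
  - exists (x 0%nat + (/ 2) ^ 0 * w). intros y [n ->]. apply Hle.
  - exists (x 0%nat), 0%nat. reflexivity.
  - exists c. intros n. split; [apply U; exists n; reflexivity|].
    apply L. intros y [m ->]. apply Hle.
Qed.

(* [P x y s] speaks about the rectangle [x, x + s w] * [y, y + s h]: bisection keeps the shape. *)
Lemma rectangle_bisection (P : R -> R -> R -> Prop) (x0 y0 w h : R) :
  0 < w -> 0 < h ->
  (forall x y s, 0 < s ->
     x0 <= x -> x + s * w <= x0 + w -> y0 <= y -> y + s * h <= y0 + h ->
     P x y (s / 2) -> P (x + s / 2 * w) y (s / 2) ->
     P x (y + s / 2 * h) (s / 2) -> P (x + s / 2 * w) (y + s / 2 * h) (s / 2) -> P x y s) ->
  (forall u v, x0 <= u <= x0 + w -> y0 <= v <= y0 + h ->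
     exists del, 0 < del /\ forall x y s, 0 < s < del ->
       x0 <= x -> x + s * w <= x0 + w -> y0 <= y -> y + s * h <= y0 + h ->
       x <= u <= x + s * w -> y <= v <= y + s * h -> P x y s) ->
  P x0 y0 1.
Proof.
  intros Hw Hh Hsplit Hloc. apply NNPP. intros Hn.
  set (inside := fun (q : R * R) (s : R) =>
    x0 <= fst q /\ fst q + s * w <= x0 + w /\ y0 <= snd q /\ snd q + s * h <= y0 + h).
  set (step := fun (s : R) (q q' : R * R) =>
    inside q' (s / 2) /\ ~ P (fst q') (snd q') (s / 2) /\
    fst q <= fst q' /\ fst q' + s / 2 * w <= fst q + s * w /\
    snd q <= snd q' /\ snd q' + s / 2 * h <= snd q + s * h).
  assert (Hstep : forall s q, 0 < s -> inside q s -> ~ P (fst q) (snd q) s ->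
            exists q', step s q q').
  { intros s [x y] Hs [I1 [I2 [I3 I4]]] HP. simpl in *. apply NNPP. intros Hno. apply HP.
    assert (0 < s * w) by (apply Rmult_lt_0_compat; assumption).
    assert (0 < s * h) by (apply Rmult_lt_0_compat; assumption).
    apply Hsplit; try assumption; apply NNPP; intros HP'; apply Hno.
    - exists (x, y). unfold step, inside; simpl; repeat split; try assumption; lra.
    - exists (x + s / 2 * w, y). unfold step, inside; simpl; repeat split; try assumption; lra.
    - exists (x, y + s / 2 * h). unfold step, inside; simpl; repeat split; try assumption; lra.
    - exists (x + s / 2 * w, y + s / 2 * h).
      unfold step, inside; simpl; repeat split; try assumption; lra. }
  (* A descending sequence of rectangles on which [P] fails. By [Hstep] a failing quarter always
     exists, so the default (0, 0) of [epsilon] is never what is returned by accident. The common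
     point of the sequence will contradict [Hloc]. *)
  set (q := fix q (n : nat) : R * R :=
    match n with
    | O => (x0, y0)
    | S m => epsilon (inhabits (0, 0)) (step ((/ 2) ^ m) (q m))
    end).
  assert (Hpow : forall n, (/ 2) ^ S n = (/ 2) ^ n / 2) by (intros; simpl; field).
  assert (Hq : forall n, inside (q n) ((/ 2) ^ n) /\ ~ P (fst (q n)) (snd (q n)) ((/ 2) ^ n)).
  { induction n as [|n [I1 I2]].
    - simpl. split; [unfold inside; simpl; lra|exact Hn].
    - destruct (epsilon_spec (inhabits (0, 0)) (step ((/ 2) ^ n) (q n))
                  (Hstep _ _ (pow_half_pos n) I1 I2)) as [A [B _]].
      rewrite Hpow. split; [exact A|exact B]. }
  assert (Hq' : forall n, step ((/ 2) ^ n) (q n) (q (S n))).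
  { intros n. destruct (Hq n) as [I1 I2].
    exact (epsilon_spec (inhabits (0, 0)) _ (Hstep _ _ (pow_half_pos n) I1 I2)). }
  destruct (nested_intervals (fun n => fst (q n)) w) as [u Hu]; [lra| |].
  { intros n. destruct (Hq' n) as [_ [_ [A [B _]]]]. rewrite Hpow. split; assumption. }
  destruct (nested_intervals (fun n => snd (q n)) h) as [v Hv]; [lra| |].
  { intros n. destruct (Hq' n) as [_ [_ [_ [_ [A B]]]]]. rewrite Hpow. split; assumption. }
  destruct (Hloc u v) as [del [Hdel Hd]].
  - specialize (Hu 0%nat). simpl in Hu. lra.
  - specialize (Hv 0%nat). simpl in Hv. lra.
  - destruct (pow_half_small del Hdel) as [n Hn'].
    destruct (Hq n) as [[I1 [I2 [I3 I4]]] HP]. apply HP, Hd; try assumption.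
    + split; [apply pow_half_pos|exact Hn'].
    + apply Hu.
    + apply Hv.
Qed.

Definition cis (t : R) : C := (cos t, sin t).

Lemma cis_plus (s t : R) : cis (s + t) = (cis s * cis t)%C.
Proof.
  apply injective_projections; simpl; [rewrite cos_plus|rewrite sin_plus]; ring.
Qed.

Lemma Cmod_cis (t : R) : Cmod (cis t) = 1.
Proof.
  unfold Cmod, cis; simpl. replace (cos t * (cos t * 1) + sin t * (sin t * 1)) with 1.
  - apply sqrt_1.
  - pose proof (sin2_cos2 t) as H. unfold Rsqr in H. lra.
Qed.

Lemma cis_0 : cis 0 = 1.
Proof. unfold cis. rewrite cos_0, sin_0. reflexivity. Qed.

Lemma cis_2PI (t : R) : cis (t + 2 * PI) = cis t.
Proof.
  unfold cis.
  rewrite cos_plus, sin_plus, cos_2PI, sin_2PI. f_equal; ring.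
Qed.

Lemma cis_derive (a t : R) :
  curve_derive (fun s => cis (a * s)) t (RtoC a * Ci * cis (a * t))%C.
Proof.
  split; unfold cis, Re, Im; simpl; auto_derive; auto; ring.
Qed.

Lemma cis_continuous (a t : R) : curve_continuous (fun s => cis (a * s)) t.
Proof. eapply curve_derive_continuous, cis_derive. Qed.

Definition polar (x t : R) : C := (RtoC (exp x) * cis t)%C.

Lemma polar_derive_l (x t : R) : curve_derive (fun s => polar s t) x (polar x t).
Proof. split; unfold polar, cis, Re, Im; simpl; auto_derive; auto; ring. Qed.

Lemma polar_derive_r (x t : R) : curve_derive (fun s => polar x s) t (Ci * polar x t)%C.
Proof. split; unfold polar, cis, Re, Im; simpl; auto_derive; auto; ring. Qed.

Lemma Cmod_polar (x t : R) : Cmod (polar x t) = exp x.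
Proof.
  unfold polar. rewrite Cmod_mult, Cmod_cis, Cmod_R, Rabs_right, Rmult_1_r; [reflexivity|].
  apply Rle_ge, Rlt_le, exp_pos.
Qed.

(* The factor 2 comes from estimating real and imaginary parts separately. *)
Lemma curve_mean_value (f df : R -> C) (a b K : R) :
  (forall t, Rmin a b <= t <= Rmax a b -> curve_derive f t (df t)) ->
  (forall t, Rmin a b <= t <= Rmax a b -> Cmod (df t) <= K) ->
  Cmod (f b - f a) <= 2 * (K * Rabs (b - a)).
Proof.
  intros H HK.
  assert (Hc : forall t, Rmin a b <= t <= Rmax a b -> curve_continuous f t)
    by (intros t Ht; eapply curve_derive_continuous, H, Ht).
  destruct (MVT_gen (fun t => Re (f t)) a b (fun t => Re (df t))) as [c1 [B1 E1]].
  { intros t Ht. apply H. lra. }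
  { intros t Ht. apply continuity_pt_filterlim. apply Hc, Ht. }
  destruct (MVT_gen (fun t => Im (f t)) a b (fun t => Im (df t))) as [c2 [B2 E2]].
  { intros t Ht. apply H. lra. }
  { intros t Ht. apply continuity_pt_filterlim. apply Hc, Ht. }
  eapply Rle_trans; [apply Cmod_le_abs|].
  change (Rabs (Re (f b) - Re (f a)) + Rabs (Im (f b) - Im (f a)) <= 2 * (K * Rabs (b - a))).
  rewrite E1, E2, !Rabs_mult.
  assert (Rabs (Re (df c1)) <= K) by (eapply Rle_trans; [apply re_le_Cmod|apply HK, B1]).
  assert (Rabs (Im (df c2)) <= K) by (eapply Rle_trans; [apply im_le_Cmod|apply HK, B2]).
  pose proof (Rabs_pos (b - a)). nra.
Qed.

(** The path runs radially at angle t', then along the circle of radius exp x; its speed never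
    exceeds exp X. *)
Lemma polar_lipschitz (x t x' t' X : R) :
  x <= X -> x' <= X ->
  Cmod (polar x' t' - polar x t) <= 2 * exp X * (Rabs (x' - x) + Rabs (t' - t)).
Proof.
  intros Hx Hx'.
  replace (polar x' t' - polar x t)%C
    with ((polar x' t' - polar x t') + (polar x t' - polar x t))%C by ring.
  eapply Rle_trans; [apply Cmod_triangle|].
  assert (Hexp : forall y, y <= X -> exp y <= exp X).
  { intros y [Hy|Hy]; [left; apply exp_increasing, Hy|right; rewrite Hy; reflexivity]. }
  assert (A1 : Cmod (polar x' t' - polar x t') <= 2 * (exp X * Rabs (x' - x))).
  { apply (curve_mean_value (fun s => polar s t') (fun s => polar s t')).
    - intros s _. apply polar_derive_l.
    - intros s Hs. rewrite Cmod_polar. apply Hexp.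
      apply Rle_trans with (Rmax x x'); [apply Hs|apply Rmax_lub; assumption]. }
  assert (A2 : Cmod (polar x t' - polar x t) <= 2 * (exp X * Rabs (t' - t))).
  { apply (curve_mean_value (fun s => polar x s) (fun s => Ci * polar x s)%C).
    - intros s _. apply polar_derive_r.
    - intros s Hs. rewrite Cmod_mult, Cmod_Ci, Cmod_polar, Rmult_1_l. apply Hexp, Hx. }
  lra.
Qed.

(** * Goursat's lemma and the mean value property *)

(** The counterclockwise contour integral of [h] against d(x + iy). *)
Definition boundary_int (h : R -> R -> C) (x1 y1 x2 y2 : R) : C :=
  ((CInt (fun s => h s y1) x1 x2 - CInt (fun s => h s y2) x1 x2)
   + Ci * (CInt (fun s => h x2 s) y1 y2 - CInt (fun s => h x1 s) y1 y2))%C.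

(** Continuity along lines parallel to the axes, the only paths that are integrated over. *)
Definition rect_continuous (h : R -> R -> C) (x1 y1 x2 y2 : R) : Prop :=
  forall x y, x1 <= x <= x2 -> y1 <= y <= y2 ->
    curve_continuous (fun s => h s y) x /\ curve_continuous (fun s => h x s) y.

Lemma CInt_Chasles (f : R -> C) (a b c : R) :
  a <= b <= c -> (forall t, a <= t <= c -> curve_continuous f t) ->
  CInt f a c = (CInt f a b + CInt f b c)%C.
Proof.
  intros Hb Hf. apply is_CInt_unique. apply is_CInt_Chasles with b;
    (apply CInt_correct; [lra|]; intros t Ht; apply Hf; lra).
Qed.

(** Interior edges are traversed twice, in opposite directions. *)
Lemma boundary_int_split (h : R -> R -> C) (x1 y1 x y x2 y2 : R) :
  x1 <= x <= x2 -> y1 <= y <= y2 -> rect_continuous h x1 y1 x2 y2 ->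
  boundary_int h x1 y1 x2 y2 =
  ((boundary_int h x1 y1 x y + boundary_int h x y1 x2 y)
   + (boundary_int h x1 y x y2 + boundary_int h x y x2 y2))%C.
Proof.
  intros Hx Hy Hh.
  assert (EX : forall v, y1 <= v <= y2 -> CInt (fun s => h s v) x1 x2 =
            (CInt (fun s => h s v) x1 x + CInt (fun s => h s v) x x2)%C)
    by (intros v Hv; apply CInt_Chasles; [lra|intros t Ht; apply Hh; lra]).
  assert (EY : forall u, x1 <= u <= x2 -> CInt (fun s => h u s) y1 y2 =
            (CInt (fun s => h u s) y1 y + CInt (fun s => h u s) y y2)%C)
    by (intros v Hv; apply CInt_Chasles; [lra|intros t Ht; apply Hh; lra]).
  unfold boundary_int. rewrite !EX, !EY by lra. ring.
Qed.

Lemma polar_CInt_l (A B : C) (y a b : R) : a <= b ->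
  is_CInt (fun s => A + B * polar s y)%C a b
    (RtoC (b - a) * A + B * (polar b y - polar a y))%C.
Proof.
  intros Hab. apply is_CInt_plus; [apply is_CInt_const|]. apply is_CInt_scal.
  apply (is_CInt_derive (fun s => polar s y)); [exact Hab| |]; intros t _.
  - apply polar_derive_l.
  - eapply curve_derive_continuous, polar_derive_l.
Qed.

(** A derivative in the angle brings out a factor [Ci], so the antiderivative of [polar x] is
    [- Ci * polar x]. *)
Lemma polar_CInt_r (A B : C) (x a b : R) : a <= b ->
  is_CInt (fun s => A + B * polar x s)%C a b
    (RtoC (b - a) * A - B * Ci * (polar x b - polar x a))%C.
Proof.
  intros Hab.
  replace (RtoC (b - a) * A - B * Ci * (polar x b - polar x a))%C
    with (RtoC (b - a) * A + - B * Ci * (polar x b - polar x a))%C by ring.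
  apply is_CInt_plus; [apply is_CInt_const|].
  apply is_CInt_ext with (fun s => (- B * Ci) * (Ci * polar x s))%C; [exact Hab| |].
  { intros t _. replace (- B * Ci * (Ci * polar x t))%C with (- (Ci * Ci) * (B * polar x t))%C by ring.
    replace (- (Ci * Ci))%C with (RtoC 1); [ring|].
    apply injective_projections; simpl; ring. }
  apply is_CInt_scal.
  apply (is_CInt_derive (fun s => polar x s)); [exact Hab| |]; intros t _.
  - apply polar_derive_r.
  - apply curve_continuous_mult; [apply curve_continuous_const|].
    eapply curve_derive_continuous, polar_derive_r.
Qed.

(* [A + B * polar] has an antiderivative, so only the remainder contributes. *)
Lemma boundary_int_bound (h : R -> R -> C) (A B : C) (x1 y1 x2 y2 M : R) :
  x1 <= x2 -> y1 <= y2 -> rect_continuous h x1 y1 x2 y2 ->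
  (forall x y, x1 <= x <= x2 -> y1 <= y <= y2 -> Cmod (h x y - (A + B * polar x y)) <= M) ->
  Cmod (boundary_int h x1 y1 x2 y2) <= 4 * ((x2 - x1) + (y2 - y1)) * M.
Proof.
  intros Hx Hy Hh HM.
  assert (EX : forall y, y1 <= y <= y2 ->
    Cmod (CInt (fun s => h s y) x1 x2 - (RtoC (x2 - x1) * A + B * (polar x2 y - polar x1 y)))
      <= 2 * ((x2 - x1) * M)).
  { intros y Hy'. apply (is_CInt_bound (fun s => h s y - (A + B * polar s y))%C x1 x2); [exact Hx| |].
    - intros t Ht. apply HM; assumption.
    - apply is_CInt_minus; [|apply polar_CInt_l, Hx].
      apply CInt_correct; [exact Hx|]. intros t Ht. apply Hh; assumption. }
  assert (EY : forall x, x1 <= x <= x2 ->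
    Cmod (CInt (fun s => h x s) y1 y2 - (RtoC (y2 - y1) * A - B * Ci * (polar x y2 - polar x y1)))
      <= 2 * ((y2 - y1) * M)).
  { intros x Hx'. apply (is_CInt_bound (fun s => h x s - (A + B * polar x s))%C y1 y2); [exact Hy| |].
    - intros t Ht. apply HM; assumption.
    - apply is_CInt_minus; [|apply polar_CInt_r, Hy].
      apply CInt_correct; [exact Hy|]. intros t Ht. apply Hh; assumption. }
  pose proof (EX y1 ltac:(lra)) as X1. pose proof (EX y2 ltac:(lra)) as X2.
  pose proof (EY x1 ltac:(lra)) as Y1. pose proof (EY x2 ltac:(lra)) as Y2.
  unfold boundary_int.
  set (a1 := (CInt (fun s => h s y1) x1 x2 - _)%C) in X1.
  set (a2 := (CInt (fun s => h s y2) x1 x2 - _)%C) in X2.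
  set (b1 := (CInt (fun s => h x1 s) y1 y2 - _)%C) in Y1.
  set (b2 := (CInt (fun s => h x2 s) y1 y2 - _)%C) in Y2.
  replace (CInt (fun s => h s y1) x1 x2 - CInt (fun s => h s y2) x1 x2
   + Ci * (CInt (fun s => h x2 s) y1 y2 - CInt (fun s => h x1 s) y1 y2))%C
   with ((a1 - a2) + Ci * (b2 - b1))%C.
  - eapply Rle_trans; [apply Cmod_triangle|]. rewrite Cmod_mult, Cmod_Ci.
    pose proof (Cmod_minus_triangle a1 a2). pose proof (Cmod_minus_triangle b2 b1). lra.
  - unfold a1, a2, b1, b2.
    (* The exact parts at the four corners add up to a multiple of 1 + i^2. Inserting that vanishing
       term leaves an identity that [ring] can check without knowing what [Ci] is. *)
    match goal with |- ?l = ?r => transitivity (r + (1 + Ci * Ci) * (B * (polar x2 y2 - polar x2 y1 - polar x1 y2 + polar x1 y1)))%C end.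
    + ring.
    + replace (1 + Ci * Ci)%C with (RtoC 0) by (apply injective_projections; simpl; ring). ring.
Qed.

(** The local hypothesis is complex differentiability seen through the exponential: the
    approximation is affine in [polar x y], not in x + iy, so it can be read off from the derivative
    of q at a + [polar u v] without differentiating the composition. *)
Lemma boundary_int_goursat (h : R -> R -> C) (x0 y0 w k : R) :
  0 < w -> 0 < k ->
  rect_continuous h x0 y0 (x0 + w) (y0 + k) ->
  (forall u v, x0 <= u <= x0 + w -> y0 <= v <= y0 + k -> forall eps, 0 < eps ->
     exists (A B : C) (del : R), 0 < del /\
       forall x y, x0 <= x <= x0 + w -> y0 <= y <= y0 + k ->
         Rabs (x - u) < del -> Rabs (y - v) < del ->
         Cmod (h x y - (A + B * polar x y)) <= eps * (Rabs (x - u) + Rabs (y - v))) ->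
  boundary_int h x0 y0 (x0 + w) (y0 + k) = 0.
Proof.
  intros Hw Hk Hh Hloc. apply Cmod_eq_0.
  destruct (Rle_lt_or_eq_dec _ _ (Cmod_ge_0 (boundary_int h x0 y0 (x0 + w) (y0 + k)))) as [Hpos|E];
    [|symmetry; exact E].
  exfalso.
  set (e := Cmod (boundary_int h x0 y0 (x0 + w) (y0 + k)) / 2).
  assert (He : 0 < e) by (unfold e; lra).
  assert (Hsub : forall x y s, 0 < s -> x0 <= x -> x + s * w <= x0 + w -> y0 <= y ->
            y + s * k <= y0 + k -> rect_continuous h x y (x + s * w) (y + s * k)).
  { intros x y s Hs I1 I2 I3 I4 x' y' Hx' Hy'. apply Hh; lra. }
  (* The bound e s^2 passes from the four quarters to the whole because 4 e (s / 2)^2 = e s^2. As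
     [e] is half of the modulus of the full integral, s = 1 is contradictory. *)
  assert (HP : Cmod (boundary_int h x0 y0 (x0 + 1 * w) (y0 + 1 * k)) <= e * (1 * 1)).
  { apply (rectangle_bisection
      (fun x y s => Cmod (boundary_int h x y (x + s * w) (y + s * k)) <= e * (s * s)) x0 y0 w k Hw Hk).
    - intros x y s Hs I1 I2 I3 I4 P1 P2 P3 P4.
      assert (0 < s * w) by (apply Rmult_lt_0_compat; assumption).
      assert (0 < s * k) by (apply Rmult_lt_0_compat; assumption).
      rewrite (boundary_int_split h x y (x + s / 2 * w) (y + s / 2 * k));
        [|lra|lra|apply Hsub; assumption].
      replace (x + s / 2 * w + s / 2 * w) with (x + s * w) in * by field.
      replace (y + s / 2 * k + s / 2 * k) with (y + s * k) in * by field.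
      eapply Rle_trans; [apply Cmod_triangle|].
      eapply Rle_trans; [apply Rplus_le_compat; apply Cmod_triangle|]. lra.
    - intros u v Hu Hv.
      (* On a rectangle of scale s, [boundary_int_bound] gives 4 s (w + k) times the error e' s (w +
         k), which is exactly e s^2. *)
      set (e' := e / (4 * ((w + k) * (w + k)))).
      assert (He' : 0 < e') by (unfold e'; apply Rdiv_lt_0_compat; nra).
      destruct (Hloc u v Hu Hv e' He') as [A [B [del [Hdel Hd]]]].
      exists (del / (w + k)). split; [apply Rdiv_lt_0_compat; lra|].
      intros x y s [Hs Hs'] I1 I2 I3 I4 J1 J2.
      assert (0 < s * w) by (apply Rmult_lt_0_compat; assumption).
      assert (0 < s * k) by (apply Rmult_lt_0_compat; assumption).
      assert (Hsd : s * (w + k) < del) by (apply Rlt_div_r in Hs'; lra).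
      apply Rle_trans with (4 * ((x + s * w - x) + (y + s * k - y)) * (e' * (s * w + s * k))).
      + apply boundary_int_bound with A B; [lra|lra|apply Hsub; assumption|].
        intros x' y' Hx' Hy'.
        assert (D1 : Rabs (x' - u) <= s * w) by (apply Rabs_le; lra).
        assert (D2 : Rabs (y' - v) <= s * k) by (apply Rabs_le; lra).
        eapply Rle_trans; [apply Hd; lra|]. apply Rmult_le_compat_l; lra.
      + right. unfold e'. field. lra. }
  rewrite !Rmult_1_l, Rmult_1_r in HP. unfold e in *. lra.
Qed.

(** The horizontal sides cancel by periodicity of [cis], so the integral over a vertical side does
    not depend on x. As x tends to minus infinity the circle shrinks to [a], where continuity gives
    the value. No derivative at [a] is asked, so a difference quotient completed at [a]
    qualifies. *)
Lemma mean_value_property (q : C -> C) (a : C) (rho rho' : R) :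
  0 < rho < rho' ->
  (forall z, z <> a -> Cmod (z - a) < rho' -> exists l, cderiv q z l) ->
  ccontinuous q a ->
  is_CInt (fun t => q (a + RtoC rho * cis t)%C) 0 (2 * PI) (RtoC (2 * PI) * q a)%C.
Proof.
  intros Hrho Hq Ha.
  pose proof PI_RGT_0 as Hpi.
  assert (Hpolar0 : forall x t, polar x t <> 0)
    by (intros x t; apply Cmod_gt_0; rewrite Cmod_polar; apply exp_pos).
  assert (Hin : forall x t, x <= ln rho -> (a + polar x t)%C <> a /\ Cmod (a + polar x t - a) < rho').
  { intros x t Hx. split.
    - intros E. apply (Hpolar0 x t). replace (polar x t) with ((a + polar x t) - a)%C by ring.
      rewrite E. ring.
    - replace (a + polar x t - a)%C with (polar x t) by ring. rewrite Cmod_polar.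
      apply Rle_lt_trans with rho; [|lra]. rewrite <- (exp_ln rho) by lra.
      destruct Hx as [Hx|Hx]; [left; apply exp_increasing, Hx|right; rewrite Hx; reflexivity]. }
  set (h := fun x t => q (a + polar x t)%C).
  assert (Hcont : forall x t, x <= ln rho ->
    curve_continuous (fun s => h s t) x /\ curve_continuous (fun s => h x s) t).
  { intros x t Hx. destruct (Hin x t Hx) as [I1 I2]. destruct (Hq _ I1 I2) as [l Hl].
    split; unfold h.
    - apply (curve_continuous_comp q (fun s => a + polar s t)%C).
      + apply curve_continuous_plus; [apply curve_continuous_const|].
        eapply curve_derive_continuous, polar_derive_l.
      + eapply cderiv_continuous, Hl.
    - apply (curve_continuous_comp q (fun s => a + polar x s)%C).
      + apply curve_continuous_plus; [apply curve_continuous_const|].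
        eapply curve_derive_continuous, polar_derive_r.
      + eapply cderiv_continuous, Hl. }
  assert (Hconst : forall x, x < ln rho -> CInt (h x) 0 (2 * PI) = CInt (h (ln rho)) 0 (2 * PI)).
  { intros x Hx.
    assert (E : boundary_int h x 0 (x + (ln rho - x)) (0 + 2 * PI) = 0).
    { apply boundary_int_goursat; [lra|lra| |].
      - intros x' t Hx' _. apply Hcont. lra.
      - intros u v Hu Hv eps He.
        destruct (Hin u v ltac:(lra)) as [I1 I2]. destruct (Hq _ I1 I2) as [l Hl].
        rewrite cderiv_iff in Hl.
        (* The Lipschitz constant of [polar] for x <= ln rho, which converts tolerances in the plane
           into tolerances in (x, t). *)
        set (K := 2 * exp (ln rho)). assert (HK : 0 < K) by (pose proof (exp_pos (ln rho)); unfold K; lra).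
        destruct (Hl (eps / K)) as [d [Hd Hd']]; [apply Rdiv_lt_0_compat; lra|].
        exists (q (a + polar u v) - polar u v * l)%C, l, (d / (2 * K)).
        split; [apply Rdiv_lt_0_compat; lra|].
        intros x' y' Hx' Hy' D1 D2. unfold h.
        pose proof (polar_lipschitz u v x' y' (ln rho) ltac:(lra) ltac:(lra)) as HL. fold K in HL.
        replace (polar x' y' - polar u v)%C with ((a + polar x' y') - (a + polar u v))%C in HL by ring.
        replace (q (a + polar x' y') - (q (a + polar u v) - polar u v * l + l * polar x' y'))%C
          with (q (a + polar x' y') - q (a + polar u v)
                - ((a + polar x' y') - (a + polar u v)) * l)%C by ring.
        assert (Hs : Rabs (x' - u) + Rabs (y' - v) < d / K).
        { replace (d / K) with (d / (2 * K) + d / (2 * K)) by (field; lra). lra. }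
        apply Rlt_div_r in Hs; [|exact HK].
        eapply Rle_trans; [apply Hd'; lra|].
        replace (eps * (Rabs (x' - u) + Rabs (y' - v)))
          with (eps / K * (K * (Rabs (x' - u) + Rabs (y' - v)))) by (field; lra).
        apply Rmult_le_compat_l; [left; apply Rdiv_lt_0_compat; lra|exact HL]. }
    unfold boundary_int in E. rewrite Rplus_0_l in E.
    replace (x + (ln rho - x)) with (ln rho) in E by ring.
    assert (Eh : CInt (fun s => h s 0) x (ln rho) = CInt (fun s => h s (2 * PI)) x (ln rho)).
    { assert (Hs : forall s, h s (2 * PI) = h s 0)
        by (intros s; unfold h, polar; rewrite <- (cis_2PI 0), Rplus_0_l; reflexivity).
      unfold CInt. apply injective_projections; simpl; apply RInt_ext; intros s _; rewrite Hs; reflexivity. }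
    rewrite Eh in E.
    set (u := CInt (fun s => h (ln rho) s) 0 (2 * PI)) in E.
    set (v := CInt (fun s => h x s) 0 (2 * PI)) in E.
    change (v = u).
    assert (E' : (Ci * (u - v))%C = 0) by (rewrite <- E; ring).
    assert (Hm : Cmod (u - v) = 0).
    { replace (Cmod (u - v)) with (Cmod (Ci * (u - v))) by (rewrite Cmod_mult, Cmod_Ci; ring).
      rewrite E', Cmod_0. reflexivity. }
    apply Cmod_eq_0 in Hm. replace u with ((u - v) + v)%C by ring. rewrite Hm. ring. }
  assert (Hval : CInt (h (ln rho)) 0 (2 * PI) = (RtoC (2 * PI) * q a)%C).
  { set (J := CInt (h (ln rho)) 0 (2 * PI)) in *.
    assert (Hz : (J - RtoC (2 * PI) * q a)%C = 0).
    { apply Cmod_eq_0.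
      destruct (Rle_lt_or_eq_dec _ _ (Cmod_ge_0 (J - RtoC (2 * PI) * q a))) as [Hpos|E];
        [|symmetry; exact E].
      exfalso. set (m := Cmod (J - RtoC (2 * PI) * q a)) in *.
      (* Were the defect [m] positive, a circle on which q differs from q a by at most m / (8 PI)
         would bound the defect by 2 * 2 PI * m / (8 PI) = m / 2. *)
      destruct (Ha (m / (8 * PI))) as [d [Hd Hd']]; [apply Rdiv_lt_0_compat; lra|].
      set (x := ln (Rmin (d / 2) (rho / 2))).
      assert (Hm : 0 < Rmin (d / 2) (rho / 2)) by (apply Rmin_pos; lra).
      assert (Hx : x < ln rho).
      { apply ln_increasing; [exact Hm|]. eapply Rle_lt_trans; [apply Rmin_r|lra]. }
      assert (B : Cmod (CInt (h x) 0 (2 * PI) - RtoC (2 * PI - 0) * q a) <= 2 * ((2 * PI - 0) * (m / (8 * PI)))).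
      { apply (is_CInt_bound (fun t => h x t - q a)%C 0 (2 * PI)); [lra| |].
        - intros t _. left. apply Hd'. replace (a + polar x t - a)%C with (polar x t) by ring.
          rewrite Cmod_polar. unfold x. rewrite exp_ln by exact Hm.
          eapply Rle_lt_trans; [apply Rmin_l|lra].
        - apply is_CInt_minus; [|apply is_CInt_const].
          apply CInt_correct; [lra|]. intros t _. apply Hcont. lra. }
      rewrite (Hconst x Hx), Rminus_0_r in B. fold J in B. fold m in B.
      replace (2 * (2 * PI * (m / (8 * PI)))) with (m / 2) in B by (field; lra). lra. }
    replace J with ((J - RtoC (2 * PI) * q a) + RtoC (2 * PI) * q a)%C by ring. rewrite Hz. ring. }
  rewrite <- Hval.
  apply is_CInt_ext with (h (ln rho)); [lra| |].
  - intros t _. unfold h, polar. rewrite exp_ln by lra. reflexivity.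
  - apply CInt_correct; [lra|]. intros t _. apply Hcont. lra.
Qed.

(** * Derivative estimates and uniform limits *)

Definition holomorphic_disc (f : C -> C) (a : C) (r : R) : Prop :=
  forall z, Cmod (z - a) < r -> exists l, cderiv f z l.

Lemma Cderive_correct (f : C -> C) (z : C) : (exists l, cderiv f z l) -> cderiv f z (Cderive f z).
Proof. intros H. exact (epsilon_spec (inhabits (RtoC 0)) _ H). Qed.

Lemma Cderive_eq (f : C -> C) (z l : C) : cderiv f z l -> Cderive f z = l.
Proof. intros H. apply (cderiv_unique f z); [|exact H]. apply Cderive_correct. exists l; exact H. Qed.

Lemma holomorphic_disc_sub (f : C -> C) (a b : C) (r s : R) :
  Cmod (b - a) + s <= r -> holomorphic_disc f a r -> holomorphic_disc f b s.
Proof.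
  intros Hs Hf z Hz. apply Hf. replace (z - a)%C with ((z - b) + (b - a))%C by ring.
  eapply Rle_lt_trans; [apply Cmod_triangle|]. lra.
Qed.

Lemma cderiv_minus (f g : C -> C) (z l m : C) :
  cderiv f z l -> cderiv g z m -> cderiv (fun w => f w - g w)%C z (l - m)%C.
Proof. exact (is_derive_minus (K := C_AbsRing) (V := C_NormedModule) f g z l m). Qed.

Lemma cderiv_shift (f : C -> C) (c z l : C) :
  cderiv f (z + c)%C l -> cderiv (fun w => f (w + c)%C) z l.
Proof.
  intros H. replace l with ((1 + 0) * l)%C by ring.
  apply (cderiv_comp f (fun w => w + c)%C); [|exact H].
  apply cderiv_plus; [apply cderiv_id|apply cderiv_const].
Qed.

(** The difference quotient of [f] at [a], given the value [l] there, has the mean value property,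
    so [l] is its average over the circle of radius r. There it is at most 2 M / r; [is_CInt_bound]
    doubles this. *)
Lemma deriv_bound (f : C -> C) (a l : C) (r r' M : R) :
  0 < r < r' -> holomorphic_disc f a r' ->
  (forall z, Cmod (z - a) <= r -> Cmod (f z) <= M) ->
  cderiv f a l -> Cmod l <= 4 * M / r.
Proof.
  intros Hr Hf HM Hl.
  pose proof PI_RGT_0 as Hpi.
  set (q := fun z => if excluded_middle_informative (z = a) then l else ((f z - f a) * / (z - a))%C).
  assert (Eq : forall z, z <> a -> q z = ((f z - f a) * / (z - a))%C).
  { intros z Hz. unfold q. destruct (excluded_middle_informative (z = a)); [contradiction|reflexivity]. }
  assert (Eqa : q a = l).
  { unfold q. destruct (excluded_middle_informative (a = a)); [reflexivity|congruence]. }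
  assert (Hne : forall z, z <> a -> (z - a)%C <> 0).
  { intros z Hz E. apply Hz. replace z with ((z - a) + a)%C by ring. rewrite E. ring. }
  assert (HI : is_CInt (fun t => q (a + RtoC r * cis t)%C) 0 (2 * PI) (RtoC (2 * PI) * q a)%C).
  { apply (mean_value_property q a r r' Hr).
    - intros z Hz Hd. destruct (Hf z Hd) as [m Hm].
      pose proof (Hne z Hz) as Hz0.
      assert (Hpos : 0 < Cmod (z - a)) by (apply Cmod_gt_0; exact Hz0).
      eexists. eapply (cderiv_ext_loc (fun w => (f w - f a) * / (w - a))%C q z _ (Cmod (z - a)) Hpos).
      + intros w Hw. symmetry. apply Eq. intros E. subst w. rewrite Cmod_minus_sym in Hw. lra.
      + apply cderiv_mult.
        * apply cderiv_minus; [exact Hm|apply cderiv_const].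
        * apply (cderiv_comp Cinv (fun w => w - a)%C).
          -- apply cderiv_minus; [apply cderiv_id|apply cderiv_const].
          -- apply cderiv_inv, Hz0.
    - intros eps He. rewrite cderiv_iff in Hl. destruct (Hl (eps / 2)) as [d [Hd Hd']]; [lra|].
      exists d. split; [exact Hd|]. intros w Hw. rewrite Eqa.
      destruct (excluded_middle_informative (w = a)) as [E|E].
      + subst w. rewrite Eqa. replace (l - l)%C with (RtoC 0) by ring. rewrite Cmod_0. exact He.
      + rewrite Eq by exact E. pose proof (Hne w E) as Hw0.
        replace ((f w - f a) * / (w - a) - l)%C with ((f w - f a - (w - a) * l) * / (w - a))%C by (field; exact Hw0).
        rewrite Cmod_mult, Cmod_inv by exact Hw0.
        assert (0 < Cmod (w - a)) by (apply Cmod_gt_0; exact Hw0).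
        specialize (Hd' w Hw). apply Rle_lt_trans with (eps / 2); [|lra].
        apply Rle_div_l; assumption. }
  rewrite Eqa in HI.
  assert (Hc : forall t, Cmod (a + RtoC r * cis t - a) = r).
  { intros t. replace (a + RtoC r * cis t - a)%C with (RtoC r * cis t)%C by ring.
    rewrite Cmod_mult, Cmod_cis, Cmod_R, Rabs_right; lra. }
  assert (HB : Cmod (RtoC (2 * PI) * l) <= 2 * ((2 * PI - 0) * (2 * M / r))).
  { apply (is_CInt_bound _ 0 (2 * PI) (2 * M / r) _ ltac:(lra)) with (2 := HI).
    intros t _.
    assert (Hnz : (a + RtoC r * cis t)%C <> a).
    { intros E. specialize (Hc t). rewrite E in Hc. replace (a - a)%C with (RtoC 0) in Hc by ring.
      rewrite Cmod_0 in Hc. lra. }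
    rewrite Eq by exact Hnz. rewrite Cmod_mult, Cmod_inv by apply Hne, Hnz. rewrite Hc.
    apply Rmult_le_compat_r; [left; apply Rinv_0_lt_compat; lra|].
    eapply Rle_trans; [apply Cmod_minus_triangle|].
    assert (Cmod (f (a + RtoC r * cis t)%C) <= M) by (apply HM; rewrite Hc; lra).
    assert (Cmod (f a) <= M).
    { apply HM. replace (a - a)%C with (RtoC 0) by ring. rewrite Cmod_0. lra. }
    lra. }
  rewrite Cmod_mult, Cmod_R, Rabs_right in HB by lra.
  apply Rmult_le_reg_l with (2 * PI); [lra|]. eapply Rle_trans; [exact HB|]. right. field. lra.
Qed.

Lemma segment_mean_value (f : C -> C) (a b : C) (K : R) :
  (forall z, Cmod (z - a) <= Cmod (b - a) -> exists l, cderiv f z l /\ Cmod l <= K) ->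
  Cmod (f b - f a) <= 2 * K * Cmod (b - a).
Proof.
  intros H.
  assert (HD : forall z, Cmod (z - a) <= Cmod (b - a) ->
            cderiv f z (Cderive f z) /\ Cmod (Cderive f z) <= K).
  { intros z Hz. destruct (H z Hz) as [l [H1 H2]]. rewrite (Cderive_eq _ _ _ H1). split; assumption. }
  set (g := fun t => (a + RtoC t * (b - a))%C).
  assert (Hg : forall t, 0 <= t <= 1 -> Cmod (g t - a) <= Cmod (b - a)).
  { intros t Ht. unfold g. replace (a + RtoC t * (b - a) - a)%C with (RtoC t * (b - a))%C by ring.
    rewrite Cmod_mult, Cmod_R, Rabs_right by lra. pose proof (Cmod_ge_0 (b - a)). nra. }
  pose proof (curve_mean_value (fun t => f (g t)) (fun t => (b - a) * Cderive f (g t))%C 0 1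
    (Cmod (b - a) * K)) as M.
  rewrite Rmin_left, Rmax_right in M by lra.
  replace (g 1) with b in M by (unfold g; ring).
  replace (g 0) with a in M by (unfold g; ring).
  replace (2 * K * Cmod (b - a)) with (2 * (Cmod (b - a) * K * Rabs (1 - 0)))
    by (rewrite Rminus_0_r, Rabs_R1; ring).
  apply M.
  - intros t Ht. apply curve_derive_comp; [|apply HD, Hg, Ht].
    split; unfold g, Re, Im; simpl; auto_derive; auto; ring.
  - intros t Ht. rewrite Cmod_mult. apply Rmult_le_compat_l; [apply Cmod_ge_0|apply HD, Hg, Ht].
Qed.

Lemma Cmod_dist_triangle (a b c : C) : Cmod (a - c) <= Cmod (a - b) + Cmod (b - c).
Proof. replace (a - c)%C with ((a - b) + (b - c))%C by ring. apply Cmod_triangle. Qed.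

(** The derivative is Lipschitz at [a], and no second derivative enters: [deriv_bound] is applied to
    the increment f (u + (z - a)) - f u, which is itself of order |z - a|. The mean value inequality
    for f z - z l supplies the second factor |w - a|. *)
Lemma taylor_bound (f : C -> C) (a l w : C) (r M : R) :
  0 < r -> holomorphic_disc f a (4 * r) ->
  (forall z, Cmod (z - a) < 4 * r -> Cmod (f z) <= M) ->
  cderiv f a l -> Cmod (w - a) <= r ->
  Cmod (f w - f a - (w - a) * l) <= 64 * M / (r * r) * (Cmod (w - a) * Cmod (w - a)).
Proof.
  intros Hr Hf HM Hl Hw.
  assert (HM0 : 0 <= M).
  { eapply Rle_trans; [apply Cmod_ge_0|apply (HM a)]. replace (a - a)%C with (RtoC 0) by ring.
    rewrite Cmod_0. lra. }
  assert (Hdf : forall z m, Cmod (z - a) <= 2 * r -> cderiv f z m -> Cmod m <= 4 * M / r).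
  { intros z m Hz Hm. apply (deriv_bound f z m r (2 * r) M); [lra| | |exact Hm].
    - apply (holomorphic_disc_sub f a z (4 * r)); [lra|exact Hf].
    - intros u Hu. apply HM. eapply Rle_lt_trans; [apply (Cmod_dist_triangle u z a)|lra]. }
  assert (Hlip : forall z m, Cmod (z - a) <= Cmod (w - a) -> cderiv f z m ->
            Cmod (m - l) <= 32 * M / (r * r) * Cmod (w - a)).
  { intros z m Hz Hm.
    assert (B : Cmod (m - l) <= 4 * (2 * (4 * M / r) * Cmod (z - a)) / r).
    { apply (deriv_bound (fun u => f (u + (z - a)) - f u)%C a (m - l)%C r (2 * r)); [lra| | |].
      - intros u Hu. destruct (Hf u) as [l1 L1]; [lra|].
        destruct (Hf (u + (z - a))%C) as [l2 L2].
        { replace (u + (z - a) - a)%C with ((u - a) + (z - a))%C by ring.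
          eapply Rle_lt_trans; [apply Cmod_triangle|lra]. }
        eexists. apply cderiv_minus; [apply cderiv_shift; exact L2|exact L1].
      - intros u Hu.
        replace (Cmod (z - a)) with (Cmod (u + (z - a) - u)) by (f_equal; ring).
        apply segment_mean_value. intros v Hv.
        replace (u + (z - a) - u)%C with (z - a)%C in Hv by ring.
        assert (Hva : Cmod (v - a) <= 2 * r) by (eapply Rle_trans; [apply (Cmod_dist_triangle v u a)|lra]).
        destruct (Hf v) as [l1 L1]; [lra|]. exists l1. split; [exact L1|]. apply (Hdf v); assumption.
      - apply cderiv_minus; [|exact Hl]. apply cderiv_shift.
        replace (a + (z - a))%C with z by ring. exact Hm. }
    eapply Rle_trans; [exact B|].
    replace (4 * (2 * (4 * M / r) * Cmod (z - a)) / r) with (32 * M / (r * r) * Cmod (z - a)) by (field; lra).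
    apply Rmult_le_compat_l; [|exact Hz].
    apply Rmult_le_pos; [lra|left; apply Rinv_0_lt_compat, Rmult_lt_0_compat; exact Hr]. }
  replace (f w - f a - (w - a) * l)%C with ((f w - w * l) - (f a - a * l))%C by ring.
  replace (64 * M / (r * r) * (Cmod (w - a) * Cmod (w - a)))
    with (2 * (32 * M / (r * r) * Cmod (w - a)) * Cmod (w - a)) by (field; lra).
  apply (segment_mean_value (fun z => f z - z * l)%C). intros z Hz.
  destruct (Hf z) as [m Hm]; [lra|]. exists (m - l)%C. split; [|apply (Hlip z); assumption].
  replace (m - l)%C with (m - (1 * l + z * 0))%C by ring.
  apply cderiv_minus; [exact Hm|]. apply cderiv_mult; [apply cderiv_id|apply cderiv_const].
Qed.

Lemma C_complete (u : nat -> C) :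
  (forall eps, 0 < eps -> exists N, forall n m, (N <= n)%nat -> (N <= m)%nat -> Cmod (u n - u m) < eps) ->
  exists l, forall eps, 0 < eps -> exists N, forall n, (N <= n)%nat -> Cmod (u n - l) < eps.
Proof.
  intros H.
  destruct (Rcomplete.R_complete (fun n => Re (u n))) as [l1 L1].
  { intros eps He. destruct (H eps He) as [N HN]. exists N. intros n m Hn Hm.
    eapply Rle_lt_trans; [apply (re_le_Cmod (u n - u m))|apply HN; assumption]. }
  destruct (Rcomplete.R_complete (fun n => Im (u n))) as [l2 L2].
  { intros eps He. destruct (H eps He) as [N HN]. exists N. intros n m Hn Hm.
    eapply Rle_lt_trans; [apply (im_le_Cmod (u n - u m))|apply HN; assumption]. }
  exists (l1, l2). intros eps He.
  destruct (L1 (eps / 2)) as [N1 H1]; [lra|]. destruct (L2 (eps / 2)) as [N2 H2]; [lra|].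
  exists (max N1 N2). intros n Hn. eapply Rle_lt_trans; [apply Cmod_le_abs|].
  specialize (H1 n ltac:(lia)). specialize (H2 n ltac:(lia)).
  unfold Rdist in H1, H2. unfold Re, Im in *. simpl. unfold Rminus in *. lra.
Qed.

Lemma le_eps (a b : R) : (forall eps, 0 < eps -> a <= b + eps) -> a <= b.
Proof. intros H. destruct (Rle_lt_dec a b) as [L|L]; [exact L|]. specialize (H ((a - b) / 2)). lra. Qed.

(** The derivatives at [a] form a Cauchy sequence by [deriv_bound] for the differences. The Taylor
    remainders have a constant depending only on the common bound M + 1 and on r, so the quadratic
    estimate survives the limit. *)
Lemma weierstrass_limit (f : C -> C) (fn : nat -> C -> C) (e : nat -> R) (l : nat -> C) (a : C) (r M : R) :
  0 < r ->
  (forall eps, 0 < eps -> exists N, forall n, (N <= n)%nat -> e n < eps) ->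
  (forall n z, Cmod (z - a) < 4 * r -> Cmod (fn n z - f z) <= e n) ->
  (forall z, Cmod (z - a) < 4 * r -> Cmod (f z) <= M) ->
  (forall n, holomorphic_disc (fn n) a (4 * r)) ->
  (forall n, cderiv (fn n) a (l n)) ->
  exists L, cderiv f a L /\
    forall eps, 0 < eps -> exists N, forall n, (N <= n)%nat -> Cmod (l n - L) < eps.
Proof.
  intros Hr He Hfn HM Hhol Hl.
  destruct (C_complete l) as [L HL].
  { intros eps Heps. destruct (He (eps * r / 16)) as [N HN].
    { apply Rdiv_lt_0_compat; [|lra]. apply Rmult_lt_0_compat; assumption. }
    exists N. intros n m Hn Hm.
    apply Rle_lt_trans with (4 * (eps * r / 8) / r); [|].
    - apply (deriv_bound (fun z => fn n z - fn m z)%C a (l n - l m)%C r (2 * r)); [lra| | |].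
      + intros z Hz. destruct (Hhol n z) as [l1 H1]; [lra|]. destruct (Hhol m z) as [l2 H2]; [lra|].
        eexists. apply cderiv_minus; eassumption.
      + intros z Hz. replace (fn n z - fn m z)%C with ((fn n z - f z) - (fn m z - f z))%C by ring.
        eapply Rle_trans; [apply Cmod_minus_triangle|].
        pose proof (Hfn n z ltac:(lra)). pose proof (Hfn m z ltac:(lra)).
        pose proof (HN n Hn). pose proof (HN m Hm). lra.
      + apply cderiv_minus; apply Hl.
    - replace (4 * (eps * r / 8) / r) with (eps / 2) by (field; lra). lra. }
  exists L. split; [|exact HL].
  assert (HM0 : 0 <= M).
  { eapply Rle_trans; [apply Cmod_ge_0|apply (HM a)]. replace (a - a)%C with (RtoC 0) by ring.
    rewrite Cmod_0. lra. }
  set (K := 64 * (M + 1) / (r * r)).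
  assert (Hrr : 0 < r * r) by (apply Rmult_lt_0_compat; exact Hr).
  assert (HK : 0 < K) by (apply Rdiv_lt_0_compat; lra).
  assert (T : forall w, Cmod (w - a) <= r ->
            Cmod (f w - f a - (w - a) * L) <= K * (Cmod (w - a) * Cmod (w - a))).
  { intros w Hw. apply le_eps. intros eps Heps.
    destruct (He (Rmin 1 (eps / 4))) as [N1 H1]; [apply Rmin_pos; lra|].
    destruct (HL (eps / (4 * r))) as [N2 H2]; [apply Rdiv_lt_0_compat; lra|].
    set (n := max N1 N2). specialize (H1 n ltac:(lia)). specialize (H2 n ltac:(lia)).
    assert (A1 : e n < 1) by (eapply Rlt_le_trans; [exact H1|apply Rmin_l]).
    assert (A2 : e n < eps / 4) by (eapply Rlt_le_trans; [exact H1|apply Rmin_r]).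
    assert (B : Cmod (fn n w - fn n a - (w - a) * l n) <= K * (Cmod (w - a) * Cmod (w - a))).
    { apply taylor_bound; [exact Hr|apply Hhol| |apply Hl|exact Hw].
      intros z Hz. replace (fn n z) with ((fn n z - f z) + f z)%C by ring.
      eapply Rle_trans; [apply Cmod_triangle|]. pose proof (Hfn n z Hz). pose proof (HM z Hz). lra. }
    replace (f w - f a - (w - a) * L)%C
      with ((fn n w - fn n a - (w - a) * l n) - (fn n w - f w) + (fn n a - f a) + (w - a) * (l n - L))%C by ring.
    eapply Rle_trans; [apply Cmod_triangle|]. rewrite Cmod_mult.
    eapply Rle_trans; [apply Rplus_le_compat_r; apply Cmod_triangle|].
    eapply Rle_trans; [apply Rplus_le_compat_r, Rplus_le_compat_r; apply Cmod_minus_triangle|].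
    assert (C1 : Cmod (fn n w - f w) <= e n) by (apply Hfn; lra).
    assert (C2 : Cmod (fn n a - f a) <= e n).
    { apply Hfn. replace (a - a)%C with (RtoC 0) by ring. rewrite Cmod_0. lra. }
    assert (C3 : Cmod (w - a) * Cmod (l n - L) <= r * (eps / (4 * r))).
    { apply Rmult_le_compat; try apply Cmod_ge_0; lra. }
    replace (r * (eps / (4 * r))) with (eps / 4) in C3 by (field; lra). lra. }
  rewrite cderiv_iff. intros eps Heps.
  exists (Rmin r (eps / K)). split; [apply Rmin_pos; [exact Hr|apply Rdiv_lt_0_compat; assumption]|].
  intros w Hw.
  assert (W1 : Cmod (w - a) < r) by (eapply Rlt_le_trans; [exact Hw|apply Rmin_l]).
  assert (W2 : Cmod (w - a) < eps / K) by (eapply Rlt_le_trans; [exact Hw|apply Rmin_r]).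
  eapply Rle_trans; [apply T; lra|]. rewrite <- Rmult_assoc.
  apply Rmult_le_compat_r; [apply Cmod_ge_0|]. apply Rlt_div_r in W2; lra.
Qed.

(** * Separately holomorphic functions on the bidisc *)

Definition ccontinuous2 (F : C * C -> C) (z : C * C) : Prop :=
  forall eps, 0 < eps -> exists del, 0 < del /\ forall w1 w2,
    Cmod (w1 - fst z) < del -> Cmod (w2 - snd z) < del -> Cmod (F (w1, w2) - F z) < eps.

(** Joint continuity provides local boundedness, hence estimates in one variable that are uniform in
    the other, so Hartogs' theorem is not called upon. *)
Definition holomorphic2 (F : C * C -> C) : Prop :=
  forall z, D2 z ->
    ccontinuous2 F z /\
    (exists l, cderiv (fun w => F (w, snd z)) (fst z) l) /\
    (exists l, cderiv (fun w => F (fst z, w)) (snd z) l).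

Lemma Cmod_lt_of_ball (z w : C) (e : R) : ball z (e / 2) w -> Cmod (w - z) < e.
Proof.
  intros [H1 H2]. eapply Rle_lt_trans; [apply Cmod_le_abs|].
  change (Rabs (Re w - Re z) < e / 2) in H1. change (Rabs (Im w - Im z) < e / 2) in H2.
  change (Rabs (Re w - Re z) + Rabs (Im w - Im z) < e). lra.
Qed.

Lemma analytic_D2_holomorphic2 (F : C * C -> C) : analytic_D2 F -> holomorphic2 F.
Proof.
  intros H z Hz. destruct (H z Hz) as [H1 [H2 H3]]. split; [|split; assumption].
  intros eps He. assert (He2 : 0 < eps / 2) by lra.
  destruct (H1 _ (locally_ball (F z) (mkposreal _ He2))) as [d Hd].
  exists d. split; [apply cond_pos|]. intros w1 w2 A B.
  apply Cmod_lt_of_ball. apply Hd.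
  split; apply C_NormedModule_mixin_compat1; assumption.
Qed.

Lemma D2_near (z : C * C) (w1 w2 : C) :
  D2 z -> Cmod (w1 - fst z) < 1 - Cmod (fst z) -> Cmod (w2 - snd z) < 1 - Cmod (snd z) -> D2 (w1, w2).
Proof.
  intros _ H1 H2. split; simpl.
  - replace w1 with ((w1 - fst z) + fst z)%C by ring. eapply Rle_lt_trans; [apply Cmod_triangle|lra].
  - replace w2 with ((w2 - snd z) + snd z)%C by ring. eapply Rle_lt_trans; [apply Cmod_triangle|lra].
Qed.

(** The radius 8 r leaves room for base points within 4 r, shifts by at most r, and the discs of
    radius 4 r that [taylor_bound] consumes. *)
Lemma holomorphic2_loc_bounded (F : C * C -> C) (a b : C) :
  holomorphic2 F -> D2 (a, b) ->
  exists r M, 0 < r /\ 0 < M /\ forall z1 z2, Cmod (z1 - a) < 8 * r -> Cmod (z2 - b) < 8 * r ->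
    D2 (z1, z2) /\ Cmod (F (z1, z2)) <= M.
Proof.
  intros HF Hz. destruct (HF _ Hz) as [Hc _]. destruct (Hc 1 Rlt_0_1) as [d [Hd Hd']].
  pose proof Hz as [Z1 Z2]. simpl in *.
  set (s := Rmin d (Rmin (1 - Cmod a) (1 - Cmod b))).
  assert (S1 : s <= d) by apply Rmin_l.
  assert (S2 : s <= 1 - Cmod a) by (eapply Rle_trans; [apply Rmin_r|apply Rmin_l]).
  assert (S3 : s <= 1 - Cmod b) by (eapply Rle_trans; [apply Rmin_r|apply Rmin_r]).
  assert (S0 : 0 < s) by (repeat apply Rmin_pos; lra).
  exists (s / 8), (1 + Cmod (F (a, b))). pose proof (Cmod_ge_0 (F (a, b))).
  split; [lra|]. split; [lra|]. intros z1 z2 A B.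
  split; [apply (D2_near (a, b)); [exact Hz|simpl; lra|simpl; lra]|].
  specialize (Hd' z1 z2 ltac:(lra) ltac:(lra)).
  replace (F (z1, z2)) with ((F (z1, z2) - F (a, b)) + F (a, b))%C by ring.
  eapply Rle_trans; [apply Cmod_triangle|lra].
Qed.

Lemma d1_correct (F : C * C -> C) (z1 z2 : C) :
  holomorphic2 F -> D2 (z1, z2) -> cderiv (fun w => F (w, z2)) z1 (d1 F (z1, z2)).
Proof. intros HF Hz. apply (Cderive_correct (fun w => F (w, z2))). apply (HF _ Hz). Qed.

Lemma d2_correct (F : C * C -> C) (z1 z2 : C) :
  holomorphic2 F -> D2 (z1, z2) -> cderiv (fun w => F (z1, w)) z2 (d2 F (z1, z2)).
Proof. intros HF Hz. apply (Cderive_correct (fun w => F (z1, w))). apply (HF _ Hz). Qed.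

(** This is [taylor_bound] divided by h. What matters is uniformity in (z1, z2): it makes [d1 F] a
    uniform limit. *)
Lemma difference_quotient_bound (F : C * C -> C) (a b h z1 z2 : C) (r M : R) :
  holomorphic2 F -> 0 < r ->
  (forall z1 z2, Cmod (z1 - a) < 8 * r -> Cmod (z2 - b) < 8 * r ->
    D2 (z1, z2) /\ Cmod (F (z1, z2)) <= M) ->
  0 < Cmod h <= r -> Cmod (z1 - a) < 4 * r -> Cmod (z2 - b) < 8 * r ->
  Cmod ((F (z1 + h, z2) - F (z1, z2)) * / h - d1 F (z1, z2))%C <= 64 * M / (r * r) * Cmod h.
Proof.
  intros HF Hr HM Hh H1 H2.
  assert (Hh0 : h <> 0) by (apply Cmod_gt_0; lra).
  destruct (HM z1 z2) as [Hz _]; [lra|lra|].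
  assert (Hin : forall z, Cmod (z - z1) < 4 * r -> D2 (z, z2) /\ Cmod (F (z, z2)) <= M).
  { intros z Hz'. apply HM; [|lra]. eapply Rle_lt_trans; [apply (Cmod_dist_triangle z z1 a)|lra]. }
  pose proof (taylor_bound (fun w => F (w, z2)) z1 (d1 F (z1, z2)) (z1 + h)%C r M Hr) as T.
  replace (z1 + h - z1)%C with h in T by ring.
  replace ((F (z1 + h, z2) - F (z1, z2)) * / h - d1 F (z1, z2))%C
    with ((F (z1 + h, z2) - F (z1, z2) - h * d1 F (z1, z2)) * / h)%C by (field; exact Hh0).
  rewrite Cmod_mult, Cmod_inv by exact Hh0. apply Rle_div_l; [lra|].
  rewrite Rmult_assoc. apply T.
  - intros z Hz'. apply (HF (z, z2)). apply Hin, Hz'.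
  - intros z Hz'. apply Hin, Hz'.
  - apply d1_correct; assumption.
  - apply Hh.
Qed.

Lemma inv_INR_small (c eps : R) : 0 <= c -> 0 < eps -> exists N, forall n, (N <= n)%nat -> c * / INR (S n) < eps.
Proof.
  intros Hc He. destruct (archimed_cor1 (eps / (c + 1))) as [N [HN HN']]; [apply Rdiv_lt_0_compat; lra|].
  exists N. intros n Hn.
  assert (0 < INR N) by (apply lt_0_INR; lia).
  assert (/ INR (S n) <= / INR N) by (apply Rinv_le_contravar; [assumption|apply le_INR; lia]).
  assert (/ INR (S n) < eps / (c + 1)) by lra.
  assert (0 < / INR (S n)) by (apply Rinv_0_lt_compat, lt_0_INR; lia).
  apply Rlt_div_r in H1; [|lra]. lra.
Qed.

(** The quotients [Q n] inherit continuity and holomorphy in each variable from [F] and converge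
    uniformly to [d1 F]. The last clause keeps more than existence: the z2-derivative of [d1 F] is a
    limit of difference quotients of [d2 F], from which symmetry of the mixed derivatives is read
    off. *)
Lemma d1_regularity (F : C * C -> C) (a b : C) :
  holomorphic2 F -> D2 (a, b) ->
  ccontinuous2 (d1 F) (a, b) /\
  (exists l, cderiv (fun w => d1 F (w, b)) a l) /\
  exists (L : C) (h : nat -> R),
    (forall n, 0 < h n) /\
    (forall eps, 0 < eps -> exists N, forall n, (N <= n)%nat -> h n < eps) /\
    cderiv (fun w => d1 F (a, w)) b L /\
    (forall eps, 0 < eps -> exists N, forall n, (N <= n)%nat ->
      Cmod ((d2 F (a + RtoC (h n), b)%C - d2 F (a, b)) * / RtoC (h n) - L) < eps).
Proof.
  intros HF Hz. destruct (holomorphic2_loc_bounded F a b HF Hz) as [r [M [Hr [HM0 HM]]]].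
  set (K := 64 * M / (r * r)).
  assert (HK : 0 < K) by (unfold K; apply Rdiv_lt_0_compat; [lra|apply Rmult_lt_0_compat; lra]).
  set (h := fun n => r * / INR (S n)).
  assert (Hh : forall n, 0 < h n <= r).
  { intros n. assert (1 <= INR (S n)) by (apply (le_INR 1); lia).
    assert (0 < / INR (S n)) by (apply Rinv_0_lt_compat; lra).
    assert (/ INR (S n) <= 1) by (rewrite <- Rinv_1; apply Rinv_le_contravar; lra).
    unfold h. split; [apply Rmult_lt_0_compat; lra|nra]. }
  assert (Hhm : forall n, Cmod (RtoC (h n)) = h n)
    by (intros n; rewrite Cmod_R, Rabs_right; [reflexivity|specialize (Hh n); lra]).
  set (Q := fun n z1 z2 => ((F (z1 + RtoC (h n), z2)%C - F (z1, z2)) * / RtoC (h n))%C).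
  assert (HQ : forall n z1 z2, Cmod (z1 - a) < 4 * r -> Cmod (z2 - b) < 4 * r ->
            Cmod (Q n z1 z2 - d1 F (z1, z2)) <= K * h n).
  { intros n z1 z2 A B. rewrite <- (Hhm n). apply (difference_quotient_bound F a b _ z1 z2 r M HF Hr HM);
      [rewrite Hhm; apply Hh|lra|lra]. }
  assert (He : forall eps, 0 < eps -> exists N, forall n, (N <= n)%nat -> K * h n < eps).
  { intros eps Heps. destruct (inv_INR_small (K * r) eps) as [N HN]; [nra|exact Heps|].
    exists N. intros n Hn. unfold h. rewrite <- Rmult_assoc. apply HN, Hn. }
  assert (Ha0 : Cmod (a - a) < 4 * r) by (replace (a - a)%C with (RtoC 0) by ring; rewrite Cmod_0; lra).
  assert (Hb0 : Cmod (b - b) < 4 * r) by (replace (b - b)%C with (RtoC 0) by ring; rewrite Cmod_0; lra).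
  assert (Hshift : forall n z1, Cmod (z1 - a) < 4 * r -> Cmod (z1 + RtoC (h n) - a) < 8 * r).
  { intros n z1 H1. replace (z1 + RtoC (h n) - a)%C with ((z1 - a) + RtoC (h n))%C by ring.
    eapply Rle_lt_trans; [apply Cmod_triangle|]. rewrite Hhm. specialize (Hh n). lra. }
  assert (HB : forall z1 z2, Cmod (z1 - a) < 4 * r -> Cmod (z2 - b) < 4 * r -> Cmod (d1 F (z1, z2)) <= 4 * M / r).
  { intros z1 z2 A B. apply (deriv_bound (fun w => F (w, z2)) z1 _ r (2 * r)); [lra| | |].
    - intros z Hz'. apply (HF (z, z2)). apply HM; [|lra].
      eapply Rle_lt_trans; [apply (Cmod_dist_triangle z z1 a)|lra].
    - intros z Hz'. apply HM; [|lra].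
      eapply Rle_lt_trans; [apply (Cmod_dist_triangle z z1 a)|lra].
    - apply d1_correct; [exact HF|]. apply HM; lra. }
  split; [|split].
  - intros eps Heps. destruct (He (eps / 4)) as [n Hn]; [lra|]. specialize (Hn n (le_n n)).
    assert (Hs : 0 < h n) by apply Hh.
    (* [Q n] divides by [h n], so two variations of [F] below eps h / 8 contribute eps / 4; the two
       errors between [Q n] and [d1 F] contribute less than eps / 4 each. *)
    assert (Hse : 0 < eps * h n / 8) by (apply Rdiv_lt_0_compat; [apply Rmult_lt_0_compat|]; lra).
    assert (HcA : ccontinuous2 F (a, b)) by (apply HF; exact Hz).
    assert (HcB : ccontinuous2 F (a + RtoC (h n), b)%C).
    { apply HF. apply HM; [apply Hshift; lra|lra]. }
    destruct (HcA _ Hse) as [e1 [P1 E1]]. destruct (HcB _ Hse) as [e2 [P2 E2]]. simpl in *.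
    exists (Rmin (4 * r) (Rmin e1 e2)). split; [repeat apply Rmin_pos; lra|].
    intros w1 w2 W1 W2.
    assert (R1 : Rmin (4 * r) (Rmin e1 e2) <= 4 * r) by apply Rmin_l.
    assert (R2 : Rmin (4 * r) (Rmin e1 e2) <= e1) by (eapply Rle_trans; [apply Rmin_r|apply Rmin_l]).
    assert (R3 : Rmin (4 * r) (Rmin e1 e2) <= e2) by (eapply Rle_trans; [apply Rmin_r|apply Rmin_r]).
    replace (d1 F (w1, w2) - d1 F (a, b))%C
      with ((Q n w1 w2 - Q n a b) - (Q n w1 w2 - d1 F (w1, w2)) + (Q n a b - d1 F (a, b)))%C by ring.
    eapply Rle_lt_trans; [apply Cmod_triangle|].
    eapply Rle_lt_trans; [apply Rplus_le_compat_r, Cmod_minus_triangle|].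
    pose proof (HQ n w1 w2 ltac:(lra) ltac:(lra)). pose proof (HQ n a b Ha0 Hb0).
    specialize (E1 w1 w2 ltac:(lra) ltac:(lra)).
    specialize (E2 (w1 + RtoC (h n))%C w2).
    replace (w1 + RtoC (h n) - (a + RtoC (h n)))%C with (w1 - a)%C in E2 by ring.
    specialize (E2 ltac:(lra) ltac:(lra)).
    assert (Hh0 : RtoC (h n) <> 0) by (apply Cmod_gt_0; rewrite Hhm; exact Hs).
    assert (Cmod (Q n w1 w2 - Q n a b) <= eps / 4).
    { unfold Q.
      replace ((F (w1 + RtoC (h n), w2)%C - F (w1, w2)) * / RtoC (h n)
               - (F (a + RtoC (h n), b)%C - F (a, b)) * / RtoC (h n))%C
        with (((F (w1 + RtoC (h n), w2)%C - F (a + RtoC (h n), b)%C) - (F (w1, w2) - F (a, b))) * / RtoC (h n))%C by ring.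
      rewrite Cmod_mult, Cmod_inv, Hhm by exact Hh0.
      apply Rle_div_l; [exact Hs|]. eapply Rle_trans; [apply Cmod_minus_triangle|]. lra. }
    lra.
  - destruct (weierstrass_limit (fun w => d1 F (w, b)) (fun n w => Q n w b) (fun n => K * h n)
      (fun n => (d1 F (a + RtoC (h n), b)%C - d1 F (a, b)) * / RtoC (h n))%C a r (4 * M / r) Hr He) as [L [HL _]].
    + intros n z Hz'. apply HQ; assumption.
    + intros z Hz'. apply HB; assumption.
    + intros n z Hz'. eexists. apply cderiv_mult; [|apply cderiv_const].
      apply cderiv_minus.
      * apply (cderiv_shift (fun w => F (w, b))). apply d1_correct; [exact HF|].
        apply HM; [apply Hshift; assumption|lra].
      * apply d1_correct; [exact HF|]. apply HM; lra.
    + intros n. 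
      (* The vanishing summand is what the product rule yields for the constant factor 1 / h. *)
      replace ((d1 F (a + RtoC (h n), b)%C - d1 F (a, b)) * / RtoC (h n))%C
       with ((d1 F (a + RtoC (h n), b)%C - d1 F (a, b)) * / RtoC (h n)
             + (F (a + RtoC (h n), b)%C - F (a, b)) * 0)%C by ring.
      apply (cderiv_mult (fun w => F (w + RtoC (h n), b)%C - F (w, b))%C (fun _ => / RtoC (h n))%C);
        [|apply cderiv_const].
      apply cderiv_minus.
      * apply (cderiv_shift (fun w => F (w, b))). apply d1_correct; [exact HF|].
        apply HM; [apply Hshift; assumption|lra].
      * apply d1_correct; [exact HF|]. apply HM; lra.
    + exists L. exact HL.
  - destruct (weierstrass_limit (fun w => d1 F (a, w)) (fun n w => Q n a w) (fun n => K * h n)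
      (fun n => (d2 F (a + RtoC (h n), b)%C - d2 F (a, b)) * / RtoC (h n))%C b r (4 * M / r) Hr He) as [L [HL HL']].
    + intros n z Hz'. apply HQ; assumption.
    + intros z Hz'. apply HB; assumption.
    + intros n z Hz'. eexists. apply cderiv_mult; [|apply cderiv_const].
      apply cderiv_minus.
      * apply d2_correct; [exact HF|]. apply HM; [apply Hshift; assumption|lra].
      * apply d2_correct; [exact HF|]. apply HM; lra.
    + intros n. unfold Q.
      replace ((d2 F (a + RtoC (h n), b)%C - d2 F (a, b)) * / RtoC (h n))%C
       with ((d2 F (a + RtoC (h n), b)%C - d2 F (a, b)) * / RtoC (h n)
             + (F (a + RtoC (h n), b)%C - F (a, b)) * 0)%C by ring.
      apply (cderiv_mult (fun w => F (a + RtoC (h n), w)%C - F (a, w))%C (fun _ => / RtoC (h n))%C);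
        [|apply cderiv_const].
      apply cderiv_minus.
      * apply d2_correct; [exact HF|]. apply HM; [apply Hshift; assumption|lra].
      * apply d2_correct; [exact HF|]. apply HM; lra.
    + exists L, h. split; [intros n; apply Hh|]. split; [|split; [exact HL|exact HL']].
      intros eps Heps. destruct (inv_INR_small r eps) as [N HN]; [lra|exact Heps|].
      exists N. exact HN.
Qed.

Lemma holomorphic2_d1 (F : C * C -> C) : holomorphic2 F -> holomorphic2 (d1 F).
Proof.
  intros HF [a b] Hz. destruct (d1_regularity F a b HF Hz) as [H1 [H2 [L [h [_ [_ [H3 _]]]]]]].
  split; [exact H1|]. split; [exact H2|exists L; exact H3].
Qed.

(** Conjugating [d1] by the swap gives [d2] up to conversion, so results on one variable transfer to
    the other. *)
Definition swap_args (F : C * C -> C) : C * C -> C := fun z => F (snd z, fst z).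

Lemma holomorphic2_swap (F : C * C -> C) : holomorphic2 F -> holomorphic2 (swap_args F).
Proof.
  intros HF [a b] [Ha Hb]. destruct (HF (b, a)) as [H1 [H2 H3]]; [split; assumption|].
  split; [|split; [exact H3|exact H2]].
  intros eps He. destruct (H1 eps He) as [d [Hd Hd']]. exists d. split; [exact Hd|].
  intros w1 w2 A B. apply Hd'; assumption.
Qed.

Lemma holomorphic2_d2 (F : C * C -> C) : holomorphic2 F -> holomorphic2 (d2 F).
Proof.
  intros HF [a b] Hz.
  exact (holomorphic2_swap _ (holomorphic2_d1 _ (holomorphic2_swap _ HF)) (a, b) Hz).
Qed.

(** The same difference quotients of [d2 F] in the first variable tend to d2 (d1 F) by
    [d1_regularity] and to d1 (d2 F) because [d2 F] is holomorphic. *)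
Lemma d1_d2_comm (F : C * C -> C) (z : C * C) :
  holomorphic2 F -> D2 z -> d1 (d2 F) z = d2 (d1 F) z.
Proof.
  destruct z as [a b]. intros HF Hz.
  destruct (d1_regularity F a b HF Hz) as [_ [_ [L [h [Hh [Hh0 [HL HL']]]]]]].
  rewrite (Cderive_eq _ _ _ HL : d2 (d1 F) (a, b) = L).
  pose proof (d1_correct (d2 F) a b (holomorphic2_d2 F HF) Hz) as Hm.
  set (m := d1 (d2 F) (a, b)) in *.
  assert (E : Cmod (m - L) <= 0).
  { apply le_eps. intros eps Heps. rewrite Rplus_0_l.
    rewrite cderiv_iff in Hm. destruct (Hm (eps / 2)) as [d [Hd Hd']]; [lra|].
    destruct (Hh0 d Hd) as [N1 H1]. destruct (HL' (eps / 2)) as [N2 H2]; [lra|].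
    set (n := max N1 N2). specialize (H1 n ltac:(lia)). specialize (H2 n ltac:(lia)).
    specialize (Hh n).
    assert (Hhm : Cmod (RtoC (h n)) = h n) by (rewrite Cmod_R, Rabs_right; lra).
    assert (Hn0 : RtoC (h n) <> 0) by (apply Cmod_gt_0; lra).
    specialize (Hd' (a + RtoC (h n))%C).
    replace (a + RtoC (h n) - a)%C with (RtoC (h n)) in Hd' by ring. rewrite Hhm in Hd'.
    specialize (Hd' H1).
    set (u := (d2 F (a + RtoC (h n), b)%C - d2 F (a, b))%C) in *.
    replace (m - L)%C with ((u * / RtoC (h n) - L) - (u - RtoC (h n) * m) * / RtoC (h n))%C
      by (field; exact Hn0).
    eapply Rle_trans; [apply Cmod_minus_triangle|].
    assert (Cmod ((u - RtoC (h n) * m) * / RtoC (h n)) <= eps / 2); [|lra].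
    rewrite Cmod_mult, Cmod_inv, Hhm by exact Hn0. apply Rle_div_l; assumption. }
  assert (E0 : (m - L)%C = 0) by (apply Cmod_eq_0; pose proof (Cmod_ge_0 (m - L)); lra).
  replace m with ((m - L) + L)%C by ring. rewrite E0. ring.
Qed.

Lemma holomorphic2_pderiv (F : C * C -> C) (p q : nat) : holomorphic2 F -> holomorphic2 (pderiv F p q).
Proof.
  intros HF. unfold pderiv.
  assert (Hq : holomorphic2 (Nat.iter q d2 F))
    by (induction q; [exact HF|apply holomorphic2_d2; assumption]).
  induction p; [exact Hq|apply holomorphic2_d1; assumption].
Qed.

(** Off the bidisc the [epsilon] values of [Cderive] carry no information, so functions can be
    compared only on [D2]. *)
Lemma d2_ext (F G : C * C -> C) (z : C * C) :
  holomorphic2 F -> (forall z, D2 z -> F z = G z) -> D2 z -> d2 F z = d2 G z.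
Proof.
  destruct z as [a b]. intros HF HE Hz. symmetry. apply (Cderive_eq (fun w => G (a, w))).
  pose proof Hz as [Z1 Z2]. simpl in *.
  apply (cderiv_ext_loc (fun w => F (a, w)) _ _ _ (1 - Cmod b)); [lra| |apply d2_correct; assumption].
  intros w Hw. apply HE. apply (D2_near (a, b)); [exact Hz| |exact Hw].
  simpl. replace (a - a)%C with (RtoC 0) by ring. rewrite Cmod_0. lra.
Qed.

Lemma d1_ext (F G : C * C -> C) (z : C * C) :
  holomorphic2 F -> (forall z, D2 z -> F z = G z) -> D2 z -> d1 F z = d1 G z.
Proof.
  destruct z as [a b]. intros HF HE [Ha Hb].
  apply (d2_ext (swap_args F) (swap_args G) (b, a)); [apply holomorphic2_swap, HF| |split; assumption].
  intros [u v] [Hu Hv]. apply HE. split; assumption.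
Qed.

(** In [pderiv] the [d2] are innermost, so a new one has to pass all p copies of [d1]. *)
Lemma d2_pderiv (F : C * C -> C) (p q : nat) (z : C * C) :
  holomorphic2 F -> D2 z -> d2 (pderiv F p q) z = pderiv F p (S q) z.
Proof.
  intros HF. revert z. induction p as [|p IH]; intros z Hz; [reflexivity|].
  change (d2 (d1 (pderiv F p q)) z = d1 (pderiv F p (S q)) z).
  rewrite <- d1_d2_comm by (auto; apply holomorphic2_pderiv, HF).
  apply d1_ext; [apply holomorphic2_d2, holomorphic2_pderiv, HF|exact IH|exact Hz].
Qed.

(** * Cauchy's estimates *)

Lemma cis_INR_2PI (n : nat) : cis (INR n * (2 * PI)) = 1.
Proof.
  induction n as [|n IH]; [simpl; rewrite Rmult_0_l; apply cis_0|].
  rewrite S_INR. replace ((INR n + 1) * (2 * PI)) with (INR n * (2 * PI) + 2 * PI) by ring.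
  rewrite cis_2PI. exact IH.
Qed.

Lemma cis_opp (t : R) : (cis (- t) * cis t)%C = 1.
Proof. rewrite <- cis_plus. replace (- t + t) with 0 by ring. apply cis_0. Qed.

Lemma cis_opp_INR_2PI (n : nat) : cis (- INR n * (2 * PI)) = 1.
Proof.
  rewrite <- (cis_opp (INR n * (2 * PI))), cis_INR_2PI, Cmult_1_r. f_equal. ring.
Qed.

Lemma circle_derive (a : C) (r t : R) :
  curve_derive (fun s => a + RtoC r * cis s)%C t (RtoC r * (Ci * cis t))%C.
Proof. split; unfold cis, Re, Im; simpl; auto_derive; auto; ring. Qed.

Lemma circle_mod (a : C) (r t : R) : 0 <= r -> Cmod (a + RtoC r * cis t - a) = r.
Proof.
  intros Hr. replace (a + RtoC r * cis t - a)%C with (RtoC r * cis t)%C by ring.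
  rewrite Cmod_mult, Cmod_cis, Cmod_R, Rabs_right; lra.
Qed.

Lemma RtoC_neq_0 (x : R) : x <> 0 -> RtoC x <> 0.
Proof. intros H E. apply H. exact (f_equal fst E). Qed.

Section CauchyEstimate.
Variables (g : nat -> C -> C) (a : C) (r r' : R).
Hypothesis Hr : 0 < r < r'.
Hypothesis Hg : forall n z, Cmod (z - a) < r' -> cderiv (g n) z (g (S n) z).

(** 2 PI times the n-th Fourier coefficient of [g m] on the circle. The chain [g] of successive
    derivatives is a parameter so that partial derivatives in either variable can be inserted. *)
Let moment (m n : nat) : C :=
  CInt (fun t => g m (a + RtoC r * cis t)%C * cis (- INR n * t))%C 0 (2 * PI).

Let integrand_continuous (m n : nat) (t : R) :
  curve_continuous (fun t => g m (a + RtoC r * cis t)%C * cis (- INR n * t))%C t.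
Proof.
  apply curve_continuous_mult; [|apply cis_continuous].
  apply (curve_continuous_comp (g m) (fun s => a + RtoC r * cis s)%C).
  - eapply curve_derive_continuous, circle_derive.
  - eapply cderiv_continuous, Hg. rewrite circle_mod; lra.
Qed.

(* Integration by parts on the circle. *)
Let moment_shift (m n : nat) : (RtoC r * moment (S m) n)%C = (RtoC (INR (S n)) * moment m (S n))%C.
Proof.
  pose proof PI_RGT_0 as Hpi.
  set (u := fun t => (g m (a + RtoC r * cis t)%C * cis (- INR (S n) * t))%C).
  set (du := fun t => (Ci * (RtoC r * (g (S m) (a + RtoC r * cis t)%C * cis (- INR n * t))
                     + RtoC (- INR (S n)) * (g m (a + RtoC r * cis t)%C * cis (- INR (S n) * t))))%C).
  assert (H1 : is_CInt du 0 (2 * PI) (u (2 * PI)%R - u 0)%C).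
  { apply is_CInt_derive; [lra| |].
    - intros t _. unfold u.
      replace (du t) with (RtoC r * (Ci * cis t) * g (S m) (a + RtoC r * cis t)%C * cis (- INR (S n) * t)
         + g m (a + RtoC r * cis t)%C * (RtoC (- INR (S n)) * Ci * cis (- INR (S n) * t)))%C.
      + apply (curve_derive_mult (fun s => g m (a + RtoC r * cis s)%C) (fun s => cis (- INR (S n) * s)));
          [|apply cis_derive].
        apply (curve_derive_comp (g m) (fun s => a + RtoC r * cis s)%C); [apply circle_derive|]. apply Hg. rewrite circle_mod; lra.
      + unfold du. replace (- INR n * t) with (t + - INR (S n) * t) by (rewrite S_INR; ring).
        rewrite (cis_plus t). ring.
    - intros t _. unfold du. apply curve_continuous_mult; [apply curve_continuous_const|].
      apply curve_continuous_plus.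
      + apply curve_continuous_mult; [apply curve_continuous_const|apply integrand_continuous].
      + apply curve_continuous_mult; [apply curve_continuous_const|apply integrand_continuous]. }
  assert (E : (u (2 * PI)%R - u 0)%C = 0).
  { assert (E2 : cis (2 * PI) = cis 0) by (rewrite <- (cis_2PI 0), Rplus_0_l; reflexivity).
    unfold u. rewrite cis_opp_INR_2PI, Rmult_0_r, E2, cis_0. ring. }
  rewrite E in H1. apply is_CInt_unique in H1.
  assert (H2 : is_CInt du 0 (2 * PI)
            (Ci * (RtoC r * moment (S m) n + RtoC (- INR (S n)) * moment m (S n)))%C).
  { unfold du. apply is_CInt_scal. apply is_CInt_plus; apply is_CInt_scal;
      (apply CInt_correct; [lra|]; intros t _; apply integrand_continuous). }
  apply is_CInt_unique in H2. rewrite H1, RtoC_opp in H2.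
  set (x := (RtoC r * moment (S m) n)%C) in *. set (y := (RtoC (INR (S n)) * moment m (S n))%C) in *.
  assert (Hm : Cmod (x - y) = 0).
  { replace (Cmod (x - y)) with (Cmod (Ci * (x - y))) by (rewrite Cmod_mult, Cmod_Ci; ring).
    replace (Ci * (x - y))%C with (RtoC 0); [apply Cmod_0|]. rewrite H2. unfold x, y. ring. }
  apply Cmod_eq_0 in Hm. replace x with ((x - y) + y)%C by ring. rewrite Hm. ring.
Qed.

(** For m = 0 this trades the average of the n-th derivative for a Fourier coefficient of [g 0]; the
    induction on n raises m, hence the general form. *)
Let moment_iter (n m : nat) :
  (RtoC (r ^ n * INR (fact m)) * moment n m)%C = (RtoC (INR (fact (n + m))) * moment 0 (n + m))%C.
Proof.
  revert m. induction n as [|n IH]; intros m; [simpl; rewrite Rmult_1_l; reflexivity|].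
  replace (S n + m)%nat with (n + S m)%nat by lia. rewrite <- IH.
  replace (RtoC (r ^ S n * INR (fact m)) * moment (S n) m)%C
    with (RtoC (r ^ n * INR (fact m)) * (RtoC r * moment (S n) m))%C
    by (rewrite <- tech_pow_Rmult, !RtoC_mult; ring).
  rewrite moment_shift. replace (INR (fact (S m))) with (INR (S m) * INR (fact m))
    by (rewrite <- mult_INR; reflexivity).
  rewrite !RtoC_mult. ring.
Qed.

(** The mean value property identifies [moment n 0] with 2 PI times [g n a], and [moment_iter]
    expresses it by values of [g 0] on the circle. *)
Lemma cauchy_estimate (M : R) (n : nat) :
  (forall t, 0 <= t <= 2 * PI -> Cmod (g 0 (a + RtoC r * cis t)%C) <= M) ->
  Cmod (g n a) / INR (fact n) <= 2 * M / r ^ n.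
Proof.
  intros HM. pose proof PI_RGT_0 as Hpi.
  assert (HJ : moment n 0 = (RtoC (2 * PI) * g n a)%C).
  { apply is_CInt_unique.
    apply is_CInt_ext with (fun t => g n (a + RtoC r * cis t)%C); [lra| |].
    - intros t _. simpl. replace (-0 * t) with 0 by ring. rewrite cis_0. ring.
    - apply (mean_value_property _ a r r' Hr).
      + intros z _ Hz. exists (g (S n) z). apply Hg, Hz.
      + eapply cderiv_continuous, Hg. replace (a - a)%C with (RtoC 0) by ring. rewrite Cmod_0. lra. }
  assert (HB : Cmod (moment 0 n) <= 2 * ((2 * PI - 0) * M)).
  { apply (is_CInt_bound (fun t => g 0 (a + RtoC r * cis t)%C * cis (- INR n * t))%C 0 (2 * PI)); [lra| |].
    - intros t Ht. rewrite Cmod_mult, Cmod_cis, Rmult_1_r. apply HM, Ht.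
    - apply CInt_correct; [lra|]. intros t _. apply integrand_continuous. }
  pose proof (f_equal Cmod (moment_iter n 0)) as E. rewrite Nat.add_0_r, HJ, !Cmod_mult, !Cmod_R in E.
  simpl (fact 0) in E. simpl (INR 1) in E.
  assert (Hp : 0 < r ^ n) by (apply pow_lt; lra).
  pose proof (INR_fact_lt_0 n) as Hf.
  rewrite !Rabs_right in E by nra.
  apply Rle_div_l; [exact Hf|].
  replace (2 * M / r ^ n * INR (fact n)) with (INR (fact n) * (2 * ((2 * PI - 0) * M)) / (r ^ n * (2 * PI)))
    by (field; lra).
  apply Rle_div_r; [apply Rmult_lt_0_compat; lra|].
  replace (Cmod (g n a) * (r ^ n * (2 * PI))) with (INR (fact n) * Cmod (moment 0 n)) by lra.
  apply Rmult_le_compat_l; lra.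
Qed.

End CauchyEstimate.

(** The order follows [pderiv]: the estimate in z2 bounds the pure z2-derivative at each point of
    the circle in z1, and the estimate in z1 is then applied to that derivative. *)
Lemma cauchy_estimate2 (F : C * C -> C) (a b : C) (r s M : R) (m n : nat) :
  holomorphic2 F -> 0 < r < 1 - Cmod a -> 0 < s < 1 - Cmod b ->
  (forall t u, 0 <= t <= 2 * PI -> 0 <= u <= 2 * PI ->
     Cmod (F (a + RtoC r * cis t, b + RtoC s * cis u)%C) <= M) ->
  Cmod (pderiv F m n (a, b)) / (INR (fact m) * INR (fact n)) <= 4 * M / (r ^ m * s ^ n).
Proof.
  intros HF Hr Hs HM.
  pose proof (Cmod_ge_0 a). pose proof (Cmod_ge_0 b).
  assert (Hab : D2 (a, b)) by (split; simpl; lra).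
  assert (Hz0 : forall c : C, Cmod (c - c) = 0).
  { intros c. replace (c - c)%C with (RtoC 0) by ring. apply Cmod_0. }
  assert (Hin : forall z1 z2, Cmod (z1 - a) < 1 - Cmod a -> Cmod (z2 - b) < 1 - Cmod b -> D2 (z1, z2)).
  { intros z1 z2 A B. apply (D2_near (a, b)); assumption. }
  assert (Hps : 0 < s ^ n) by (apply pow_lt; lra).
  assert (Hpr : 0 < r ^ m) by (apply pow_lt; lra).
  pose proof (INR_fact_lt_0 n). pose proof (INR_fact_lt_0 m).
  assert (HG : forall t, 0 <= t <= 2 * PI ->
    Cmod (pderiv F 0 n (a + RtoC r * cis t, b)%C) <= INR (fact n) * (2 * M / s ^ n)).
  { intros t Ht.
    rewrite Rmult_comm. apply Rle_div_l; [assumption|].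
    apply (cauchy_estimate (fun k w => pderiv F 0 k (a + RtoC r * cis t, w)%C) b s (1 - Cmod b) Hs).
    - intros k z Hz. apply (d2_correct (pderiv F 0 k)); [apply holomorphic2_pderiv, HF|].
      apply Hin; [rewrite circle_mod; lra|exact Hz].
    - intros u Hu. apply (HM t u); assumption. }
  pose proof (cauchy_estimate (fun k w => pderiv F k n (w, b)) a r (1 - Cmod a) Hr) as HE.
  specialize (fun X => HE X _ m HG). simpl in HE.
  assert (HE' : Cmod (pderiv F m n (a, b)) / INR (fact m) <= 2 * (INR (fact n) * (2 * M / s ^ n)) / r ^ m).
  { apply HE. intros k z Hz. apply (d1_correct (pderiv F k n)); [apply holomorphic2_pderiv, HF|].
    apply Hin; [exact Hz|rewrite Hz0; lra]. }
  replace (Cmod (pderiv F m n (a, b)) / (INR (fact m) * INR (fact n)))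
    with (Cmod (pderiv F m n (a, b)) / INR (fact m) * / INR (fact n)) by (field; lra).
  replace (4 * M / (r ^ m * s ^ n)) with (2 * (INR (fact n) * (2 * M / s ^ n)) / r ^ m * / INR (fact n))
    by (field; lra).
  apply Rmult_le_compat_r; [left; apply Rinv_0_lt_compat; assumption|exact HE'].
Qed.

(** Compactness comes from [rectangle_bisection] in the two angles: boundedness passes from quarters
    to the whole and holds locally by continuity. *)
Lemma holomorphic2_torus_bounded (F : C * C -> C) (a b : C) (r s : R) :
  holomorphic2 F -> 0 < r < 1 - Cmod a -> 0 < s < 1 - Cmod b ->
  exists M, 0 <= M /\ forall t u, 0 <= t <= 2 * PI -> 0 <= u <= 2 * PI ->
    Cmod (F (a + RtoC r * cis t, b + RtoC s * cis u)%C) <= M.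
Proof.
  intros HF Hr Hs. pose proof PI_RGT_0 as Hpi.
  pose proof (Cmod_ge_0 a). pose proof (Cmod_ge_0 b).
  set (f := fun t u => Cmod (F (a + RtoC r * cis t, b + RtoC s * cis u)%C)).
  set (w := 2 * PI).
  assert (HP : exists M, forall t u, 0 <= t <= 0 + 1 * w -> 0 <= u <= 0 + 1 * w -> f t u <= M).
  { apply (rectangle_bisection
      (fun x y k => exists M, forall t u, x <= t <= x + k * w -> y <= u <= y + k * w -> f t u <= M)
      0 0 w w); [unfold w; lra|unfold w; lra| |].
    - intros x y k _ _ _ _ _ [M1 H1] [M2 H2] [M3 H3] [M4 H4].
      exists (Rmax (Rmax M1 M2) (Rmax M3 M4)). intros t u Ht Hu.
      destruct (Rle_lt_dec t (x + k / 2 * w)) as [T|T]; destruct (Rle_lt_dec u (y + k / 2 * w)) as [U|U].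
      + eapply Rle_trans; [apply H1; lra|]. eapply Rle_trans; [apply Rmax_l|apply Rmax_l].
      + eapply Rle_trans; [apply H3; lra|]. eapply Rle_trans; [apply Rmax_l|apply Rmax_r].
      + eapply Rle_trans; [apply H2; lra|]. eapply Rle_trans; [apply Rmax_r|apply Rmax_l].
      + eapply Rle_trans; [apply H4; lra|]. eapply Rle_trans; [apply Rmax_r|apply Rmax_r].
    - intros u v _ _.
      assert (Hz : D2 (a + RtoC r * cis u, b + RtoC s * cis v)%C).
      { apply (D2_near (a, b)); [split; simpl; lra| |]; simpl; rewrite circle_mod; lra. }
      destruct (HF _ Hz) as [Hc _]. destruct (Hc 1 Rlt_0_1) as [d [Hd Hd']]. simpl in Hd'.
      pose proof (curve_derive_continuous _ _ _ (circle_derive a r u)) as C1.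
      pose proof (curve_derive_continuous _ _ _ (circle_derive b s v)) as C2.
      rewrite curve_continuous_iff in C1, C2.
      destruct (C1 d Hd) as [e1 [P1 E1]]. destruct (C2 d Hd) as [e2 [P2 E2]].
      exists (Rmin e1 e2 / w). split; [apply Rdiv_lt_0_compat; [apply Rmin_pos; assumption|unfold w; lra]|].
      intros x y k [Hk Hk'] _ _ _ _ Hu Hv.
      apply Rlt_div_r in Hk'; [|unfold w; lra].
      pose proof (Rmin_l e1 e2). pose proof (Rmin_r e1 e2).
      exists (1 + f u v). intros t1 u1 Ht1 Hu1. unfold f.
      assert (A1 : Rabs (t1 - u) < e1) by (apply Rabs_lt_between; lra).
      assert (A2 : Rabs (u1 - v) < e2) by (apply Rabs_lt_between; lra).
      specialize (Hd' _ _ (E1 t1 A1) (E2 u1 A2)).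
      set (p := F (a + RtoC r * cis t1, b + RtoC s * cis u1)%C) in *.
      set (q := F (a + RtoC r * cis u, b + RtoC s * cis v)%C) in *.
      replace p with ((p - q) + q)%C by ring. eapply Rle_trans; [apply Cmod_triangle|lra]. }
  destruct HP as [M HM]. exists M. split.
  - eapply Rle_trans; [|apply (HM 0 0); unfold w; lra]. apply Cmod_ge_0.
  - intros t u Ht Hu. apply (HM t u); unfold w in *; lra.
Qed.

(** * Coefficients and main polynomials *)

Fixpoint csum (f : nat -> C) (n : nat) : C :=
  match n with O => RtoC 0 | S m => (csum f m + f m)%C end.

Lemma Csum_seq (f : nat -> C) (n : nat) : Csum (map f (seq 0 n)) = csum f n.
Proof.
  assert (Happ : forall l x, Csum (l ++ x :: nil) = (Csum l + x)%C).
  { induction l as [|y l IH]; intros x.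
    - unfold Csum; simpl; ring.
    - change (y + Csum (l ++ x :: nil) = y + Csum l + x)%C. rewrite IH. ring. }
  induction n as [|n IH]; [reflexivity|].
  rewrite seq_S, map_app. simpl map. rewrite Happ, IH. reflexivity.
Qed.

Lemma sum_n_csum (f : nat -> C) (n : nat) :
  sum_n (G := C_AbelianMonoid) f n = csum f (S n).
Proof.
  induction n as [|n IH]; [rewrite sum_O; simpl; ring|].
  rewrite sum_Sn, IH. reflexivity.
Qed.

Lemma csum_ext (f g : nat -> C) (n : nat) :
  (forall k, (k < n)%nat -> f k = g k) -> csum f n = csum g n.
Proof.
  induction n as [|n IH]; intros H; [reflexivity|]. simpl. rewrite IH, H by (auto; intros; apply H; lia).
  reflexivity.
Qed.

Lemma csum_mult (c : C) (f : nat -> C) (n : nat) : csum (fun k => c * f k)%C n = (c * csum f n)%C.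
Proof. induction n as [|n IH]; simpl; [ring|rewrite IH; ring]. Qed.

Lemma csum_bound (f : nat -> C) (M : R) (n : nat) :
  (forall k, (k < n)%nat -> Cmod (f k) <= M) -> Cmod (csum f n) <= INR n * M.
Proof.
  induction n as [|n IH]; intros H; [simpl; rewrite Cmod_0; lra|].
  simpl csum. rewrite S_INR. eapply Rle_trans; [apply Cmod_triangle|].
  specialize (H n (Nat.lt_succ_diag_r n)) as Hn.
  specialize (IH (fun k Hk => H k (Nat.lt_lt_succ_r _ _ Hk))). lra.
Qed.

Lemma csum_tail_bound (f : nat -> C) (D th : R) (n d : nat) :
  0 <= th < 1 -> 0 <= D -> (forall k, Cmod (f k) <= D * th ^ k) ->
  Cmod (csum f (n + d) - csum f n) <= D * th ^ n / (1 - th).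
Proof.
  intros Hth HD H.
  (* Keeping the term - th^(n + d) makes the bound telescope, so that the induction on d closes. *)
  assert (T : Cmod (csum f (n + d) - csum f n) <= D * (th ^ n - th ^ (n + d)) / (1 - th)).
  { induction d as [|d IH].
    - rewrite Nat.add_0_r. replace (csum f n - csum f n)%C with (RtoC 0) by ring. rewrite Cmod_0.
      right. field. lra.
    - rewrite Nat.add_succ_r. simpl csum.
      replace (csum f (n + d) + f (n + d)%nat - csum f n)%C
        with ((csum f (n + d) - csum f n) + f (n + d)%nat)%C by ring.
      eapply Rle_trans; [apply Cmod_triangle|]. specialize (H (n + d)%nat).
      replace (D * (th ^ n - th ^ S (n + d)) / (1 - th))
        with (D * (th ^ n - th ^ (n + d)) / (1 - th) + D * th ^ (n + d)) by (simpl; field; lra).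
      lra. }
  eapply Rle_trans; [exact T|]. unfold Rdiv. apply Rmult_le_compat_r.
  - left. apply Rinv_0_lt_compat. lra.
  - apply Rmult_le_compat_l; [exact HD|]. assert (0 <= th ^ (n + d)) by (apply pow_le; lra). lra.
Qed.

Lemma cis_orthogonal (k j : nat) :
  is_CInt (fun t => cis (INR k * t) * cis (- INR j * t))%C 0 (2 * PI)
    (if Nat.eqb k j then RtoC (2 * PI) else 0).
Proof.
  pose proof PI_RGT_0 as Hpi.
  set (a := INR k + - INR j).
  apply is_CInt_ext with (fun t => cis (a * t)); [lra| |].
  { intros t _. rewrite <- cis_plus. f_equal. unfold a. ring. }
  destruct (Nat.eqb_spec k j) as [->|Hne].
  - apply is_CInt_ext with (fun _ => RtoC 1); [lra| |].
    + intros t _. unfold a. replace ((INR j + - INR j) * t) with 0 by ring. symmetry; apply cis_0.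
    + replace (RtoC (2 * PI)) with (RtoC (2 * PI - 0) * 1)%C by (rewrite Rminus_0_r; ring).
      apply is_CInt_const.
  - assert (Ha : a <> 0) by (unfold a; intros E; apply Hne, INR_eq; lra).
    pose proof (RtoC_neq_0 a Ha) as Ha'.
    assert (HCi : Ci <> 0) by (intros E; apply (f_equal Cmod) in E; rewrite Cmod_Ci, Cmod_0 in E; lra).
    assert (E : cis (a * (2 * PI)) = 1).
    { unfold a. rewrite Rmult_plus_distr_r, cis_plus, cis_INR_2PI, cis_opp_INR_2PI. ring. }
    replace (RtoC 0) with (/ (RtoC a * Ci) * (cis (a * (2 * PI)) - cis (a * 0)))%C
      by (rewrite E, Rmult_0_r, cis_0; field; split; assumption).
    apply is_CInt_ext with (fun t => / (RtoC a * Ci) * (RtoC a * Ci * cis (a * t)))%C; [lra| |].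
    { intros t _. field. split; assumption. }
    apply is_CInt_scal. apply (is_CInt_derive (fun t => cis (a * t))); [lra| |]; intros t _.
    + apply cis_derive.
    + apply curve_continuous_mult; [apply curve_continuous_const|apply cis_continuous].
Qed.

(** Integration against exp(-ijt) isolates c j by orthogonality. *)
Lemma trigonometric_coefficient_bound (c : nat -> C) (n j : nat) (B : R) :
  (forall t, Cmod (csum (fun k => c k * cis (INR k * t))%C n) <= B) ->
  (j < n)%nat -> Cmod (c j) <= 2 * B.
Proof.
  intros HB Hj. pose proof PI_RGT_0 as Hpi.
  assert (HI : forall m, is_CInt (fun t => csum (fun k => c k * cis (INR k * t))%C m * cis (- INR j * t))%C
            0 (2 * PI) (if Nat.ltb j m then RtoC (2 * PI) * c j else 0)%C).
  { induction m as [|m IH].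
    - simpl. apply is_CInt_ext with (fun _ => RtoC 0); [lra|intros; ring|].
      pose proof (is_CInt_const 0 0 (2 * PI)) as H. rewrite Cmult_0_r in H. exact H.
    - pose proof (is_CInt_plus _ _ _ _ _ _ IH (is_CInt_scal _ (c m) _ _ _ (cis_orthogonal m j))) as H.
      eapply is_CInt_ext in H; [|lra|intros t _; instantiate (1 := fun t =>
         (csum (fun k => c k * cis (INR k * t)) (S m) * cis (- INR j * t))%C); simpl; ring].
      replace (if Nat.ltb j (S m) then RtoC (2 * PI) * c j else 0)%C with
        ((if Nat.ltb j m then RtoC (2 * PI) * c j else 0)
          + c m * (if Nat.eqb m j then RtoC (2 * PI) else 0))%C; [exact H|].
      destruct (Nat.ltb_spec j m), (Nat.eqb_spec m j), (Nat.ltb_spec j (S m)); try lia; subst; ring. }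
  specialize (HI n). rewrite (proj2 (Nat.ltb_lt j n) Hj) in HI.
  assert (H : Cmod (RtoC (2 * PI) * c j) <= 2 * ((2 * PI - 0) * B)).
  { apply (is_CInt_bound _ 0 (2 * PI) B _ ltac:(lra)) with (2 := HI).
    intros t _. rewrite Cmod_mult, Cmod_cis, Rmult_1_r. apply HB. }
  rewrite Cmod_mult, Cmod_R, Rabs_right in H by lra.
  apply Rmult_le_reg_l with (2 * PI); lra.
Qed.

Lemma pow_n_polar (r t : R) (n : nat) :
  pow_n (K := C_Ring) (RtoC r * cis t)%C n = (RtoC (r ^ n) * cis (INR n * t))%C.
Proof.
  induction n as [|n IH].
  - simpl INR. rewrite Rmult_0_l, cis_0. change (RtoC 1 = RtoC 1 * 1)%C. ring.
  - change ((RtoC r * cis t) * pow_n (K := C_Ring) (RtoC r * cis t)%C n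
      = RtoC (r * r ^ n) * cis (INR (S n) * t))%C.
    rewrite IH, S_INR, Rmult_plus_distr_r, Rmult_1_l, cis_plus, RtoC_mult. ring.
Qed.

(** Each of the k + 1 terms of 1 + th + ... + th^k is at least th^k. This absorbs the number of
    monomials of degree k. *)
Lemma geometric_domination (th : R) (k : nat) :
  0 <= th < 1 -> INR (S k) * th ^ k <= / (1 - th).
Proof.
  intros Hth.
  assert (H : INR (S k) * th ^ k <= (1 - th ^ S k) / (1 - th)).
  { induction k as [|k IH]; [simpl; right; field; lra|].
    rewrite S_INR.
    replace ((1 - th ^ S (S k)) / (1 - th)) with ((1 - th ^ S k) / (1 - th) + th ^ S k) by (simpl; field; lra).
    assert (INR (S k) * th ^ S k <= INR (S k) * th ^ k).
    { apply Rmult_le_compat_l; [apply pos_INR|]. simpl. assert (0 <= th ^ k) by (apply pow_le; lra). nra. }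
    lra. }
  eapply Rle_trans; [exact H|]. unfold Rdiv. rewrite <- (Rmult_1_l (/ (1 - th))) at 2.
  apply Rmult_le_compat_r; [left; apply Rinv_0_lt_compat; lra|].
  assert (0 <= th ^ S k) by (apply pow_le; lra). lra.
Qed.

Lemma pow_small (th e : R) : 0 <= th < 1 -> 0 < e -> exists N, forall n, (N <= n)%nat -> th ^ n < e.
Proof.
  intros Hth He. destruct (pow_lt_1_zero th) with (y := e) as [N HN]; [rewrite Rabs_right; lra|exact He|].
  exists N. intros n Hn. specialize (HN n Hn). rewrite Rabs_right in HN; [exact HN|].
  apply Rle_ge, pow_le; lra.
Qed.

(** The torus is parametrised by the angles (t + u, u), so that p_k becomes [P k t] times exp(iku).
    Coefficients are extracted from trigonometric polynomials, hence from partial sums; the decay in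
    q makes these approach the series uniformly. *)
Lemma main_polynomial_coefficient (F : C * C -> C) (a b : C) (r s B q : R) (k0 m n : nat) :
  0 <= r -> 0 <= s -> 0 <= B -> 0 <= q < 1 ->
  (forall m n, Cmod (bcoef F (a, b) m n) * r ^ m * s ^ n <= B * q ^ (m + n)) ->
  main_polynomial F (a, b) k0 r s -> (m + n)%nat <> k0 ->
  Cmod (bcoef F (a, b) m n) * r ^ m * s ^ n <= 2 * main_max F (a, b) k0 r s.
Proof.
  intros Hr Hs HB Hq Hb HP Hmn.
  (* Of q^k = th^k th^k one factor pays for the k + 1 monomials of p_k, and the other remains as
     geometric decay. *)
  set (th := sqrt q).
  assert (Hth : 0 <= th < 1) by (split; [apply sqrt_pos|unfold th; rewrite <- sqrt_1; apply sqrt_lt_1; lra]).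
  assert (Hthq : th * th = q) by (apply sqrt_sqrt; lra).
  set (mm := main_max F (a, b) k0 r s) in *.
  set (e := fun k j => (bcoef F (a, b) j (k - j) * RtoC (r ^ j * s ^ (k - j)))%C).
  assert (He : forall k j, Cmod (e k j) = Cmod (bcoef F (a, b) j (k - j)) * r ^ j * s ^ (k - j)).
  { intros k j. unfold e. rewrite Cmod_mult, Cmod_R, Rabs_right; [ring|].
    apply Rle_ge, Rmult_le_pos; apply pow_le; assumption. }
  set (P := fun k t => csum (fun j => e k j * cis (INR j * t))%C (S k)).
  assert (Hpk : forall k t u,
    pk F (a, b) k (RtoC r * cis (t + u))%C (RtoC s * cis u)%C = (P k t * cis (INR k * u))%C).
  { intros k t u. unfold pk. rewrite Csum_seq. unfold P. rewrite (Cmult_comm _ (cis (INR k * u))), <- csum_mult.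
    apply csum_ext. intros j Hj. rewrite !pow_n_polar.
    rewrite (Rmult_plus_distr_l (INR j) t u), cis_plus.
    replace (INR k * u) with (INR j * u + INR (k - j) * u) by (rewrite minus_INR by lia; ring).
    rewrite cis_plus. unfold e. rewrite RtoC_mult. ring. }
  set (D := B * / (1 - th)).
  assert (HD : 0 <= D) by (apply Rmult_le_pos; [exact HB|left; apply Rinv_0_lt_compat; lra]).
  assert (HPk : forall k t, Cmod (P k t) <= D * th ^ k).
  { intros k t. eapply Rle_trans; [apply (csum_bound _ (B * q ^ k))|].
    - intros j Hj. rewrite Cmod_mult, Cmod_cis, Rmult_1_r, He.
      replace (q ^ k) with (q ^ (j + (k - j))) by (f_equal; lia). apply Hb.
    - rewrite <- Hthq, Rpow_mult_distr. unfold D.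
      pose proof (geometric_domination th k Hth). assert (0 <= th ^ k) by (apply pow_le; lra).
      assert (INR (S k) * th ^ k * (B * th ^ k) <= / (1 - th) * (B * th ^ k))
        by (apply Rmult_le_compat_r; [apply Rmult_le_pos; assumption|assumption]).
      lra. }
  (* [N] must not depend on u, since coefficient extraction needs one polynomial bounded at all
     angles. The hypothesis gives only pointwise convergence; the uniform rate is the geometric tail
     from [HPk]. *)
  assert (Hsum : forall t eps, 0 < eps -> exists N, forall n, (N <= n)%nat -> forall u,
    Cmod (csum (fun k => (if Nat.eqb k k0 then RtoC 0 else P k t) * cis (INR k * u))%C n) <= / 2 * mm + eps).
  { intros t eps Heps.
    destruct (pow_small th (eps / 2 * (1 - th) / (D + 1)) Hth) as [N HN].
    { apply Rdiv_lt_0_compat; [apply Rmult_lt_0_compat; lra|lra]. }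
    exists N. intros n' Hn' u.
    set (f := fun k => ((if Nat.eqb k k0 then RtoC 0 else P k t) * cis (INR k * u))%C).
    destruct (HP (a + RtoC r * cis (t + u), b + RtoC s * cis u)%C) as [S [HS HSm]].
    { split; simpl; apply circle_mod; assumption. }
    simpl fst in HS. simpl snd in HS.
    replace (a + RtoC r * cis (t + u) - a)%C with (RtoC r * cis (t + u))%C in HS by ring.
    replace (b + RtoC s * cis u - b)%C with (RtoC s * cis u)%C in HS by ring.
    assert (He4 : 0 < eps / 4) by lra.
    destruct (HS _ (locally_ball S (mkposreal _ He4))) as [N2 HN2].
    specialize (HN2 (n' + N2)%nat ltac:(lia)).
    apply (fun H => Cmod_lt_of_ball S _ (eps / 2) (eq_ind (eps / 4) (fun x => ball S x _) H (eps / 2 / 2) ltac:(field))) in HN2.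
    rewrite sum_n_csum in HN2.
    rewrite (csum_ext _ f) in HN2.
    2: { intros k _. unfold f. destruct (Nat.eqb k k0); [ring|apply Hpk]. }
    assert (Hf : forall k, Cmod (f k) <= D * th ^ k).
    { intros k. unfold f. rewrite Cmod_mult, Cmod_cis, Rmult_1_r.
      destruct (Nat.eqb k k0); [|apply HPk]. rewrite Cmod_0.
      apply Rmult_le_pos; [exact HD|apply pow_le; lra]. }
    pose proof (csum_tail_bound f D th n' (Datatypes.S N2) Hth HD Hf) as HT.
    rewrite Nat.add_succ_r in HT.
    set (x := csum f (Datatypes.S (n' + N2))) in *.
    assert (Htail : D * th ^ n' / (1 - th) <= eps / 2).
    { apply Rle_div_l; [lra|]. specialize (HN n' Hn'). apply Rlt_div_r in HN; [|lra].
      assert (0 <= th ^ n') by (apply pow_le; lra). nra. }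
    replace (csum f n') with (S + (x - S) - (x - csum f n'))%C by ring.
    eapply Rle_trans; [apply Cmod_minus_triangle|].
    eapply Rle_trans; [apply Rplus_le_compat_r, Cmod_triangle|]. fold mm in HSm. lra. }
  assert (HPk' : forall t, Cmod (P (m + n)%nat t) <= mm).
  { intros t. apply le_eps. intros eps Heps.
    destruct (Hsum t (eps / 2)) as [N HN]; [lra|].
    (* N + S (m + n) terms suffice for [HN] and include degree m + n, whose coefficient is [P]
       itself because m + n differs from k0. The 2 cancels the 1/2 of the hypothesis. *)
    pose proof (trigonometric_coefficient_bound (fun k => if Nat.eqb k k0 then RtoC 0 else P k t)
      (N + S (m + n)) (m + n) (/ 2 * mm + eps / 2)) as T.
    simpl in T. rewrite (proj2 (Nat.eqb_neq _ _) Hmn) in T.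
    apply Rle_trans with (2 * (/ 2 * mm + eps / 2)); [|lra].
    apply T; [|lia]. intros u. apply HN. lia. }
  pose proof (trigonometric_coefficient_bound (e (m + n)%nat) (S (m + n)) m mm HPk' ltac:(lia)) as T.
  rewrite He in T. replace (m + n - m)%nat with n in T by lia. exact T.
Qed.

(** The starting value 0 of the fold does no harm because all terms are nonnegative. *)
Lemma main_max_attained (F : C * C -> C) (z : C * C) (k : nat) (r s : R) :
  0 <= r -> 0 <= s ->
  exists j, (j <= k)%nat /\ main_max F z k r s <= Cmod (bcoef F z j (k - j)) * r ^ j * s ^ (k - j).
Proof.
  intros Hr Hs. unfold main_max.
  set (f := fun j => Cmod (bcoef F z j (k - j)) * r ^ j * s ^ (k - j)).
  assert (Hf : forall j, 0 <= f j).
  { intros j. unfold f. repeat apply Rmult_le_pos; try apply pow_le; try assumption. apply Cmod_ge_0. }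
  assert (H : forall l, l <> nil -> exists j, In j l /\ fold_right Rmax 0 (map f l) <= f j).
  { induction l as [|x l IH]; intros Hl; [congruence|]. simpl.
    destruct l as [|y l].
    - exists x. split; [left; reflexivity|]. simpl. apply Rmax_lub; [lra|apply Hf].
    - destruct IH as [j [Hj Hle]]; [discriminate|].
      destruct (Rle_lt_dec (f j) (f x)) as [L|L].
      + exists x. split; [left; reflexivity|]. apply Rmax_lub; [lra|]. eapply Rle_trans; [exact Hle|exact L].
      + exists j. split; [right; exact Hj|]. apply Rmax_lub; [lra|exact Hle]. }
  destruct (H (seq 0 (S k))) as [j [Hj Hle]]; [simpl; discriminate|].
  exists j. split; [apply in_seq in Hj; lia|exact Hle].
Qed.

(** * Growth on a polydisc *)

Definition lsum {A : Type} (f : A -> R) (l : list A) : R := fold_right (fun x s => f x + s) 0 l.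

Lemma lsum_ge {A : Type} (f : A -> R) (l : list A) (x : A) :
  (forall y, 0 <= f y) -> In x l -> f x <= lsum f l.
Proof.
  intros Hf. assert (H0 : forall l, 0 <= lsum f l).
  { induction l0 as [|y l0 IH]; simpl; [lra|]. specialize (Hf y). lra. }
  induction l as [|y l IH]; simpl; [tauto|]. intros [->|Hx].
  - specialize (H0 l). lra.
  - specialize (IH Hx). specialize (Hf y). lra.
Qed.

Lemma lsum_le {A : Type} (f : A -> R) (l : list A) (M : R) :
  (forall y, In y l -> f y <= M) -> lsum f l <= INR (length l) * M.
Proof.
  induction l as [|y l IH]; intros H; [simpl; lra|].
  change (f y + lsum f l <= INR (S (length l)) * M). rewrite S_INR.
  specialize (IH (fun z Hz => H z (or_intror Hz))). specialize (H y (or_introl eq_refl)). lra.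
Qed.

Lemma list_max_exists {A : Type} (f : A -> R) (l : list A) :
  l <> nil -> exists x, In x l /\ forall y, In y l -> f y <= f x.
Proof.
  intros Hl. induction l as [|x l IH]; [congruence|]. destruct l as [|y l].
  - exists x. split; [left; reflexivity|]. intros y [->|[]]. lra.
  - destruct IH as [z [Hz Hz']]; [discriminate|].
    destruct (Rle_lt_dec (f z) (f x)).
    + exists x. split; [left; reflexivity|]. intros w [->|Hw]; [lra|].
      specialize (Hz' w Hw). lra.
    + exists z. split; [right; exact Hz|]. intros w [->|Hw]; [lra|]. apply Hz', Hw.
Qed.

Lemma lsum_derive {A : Type} (f df : A -> R -> R) (l : list A) (t : R) :
  (forall k, In k l -> is_derive (f k) t (df k t)) ->
  is_derive (fun s => lsum (fun k => f k s) l) t (lsum (fun k => df k t) l).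
Proof.
  induction l as [|k l IH]; intros H; [exact (is_derive_const 0 t)|].
  exact (is_derive_plus (f k) (fun s => lsum (fun k => f k s) l) t _ _
    (H k (or_introl eq_refl)) (IH (fun k' Hk => H k' (or_intror Hk)))).
Qed.

Lemma Cmod_sqr (z : C) : Cmod z * Cmod z = Re z * Re z + Im z * Im z.
Proof. pose proof (Cmod2_alt z) as H. simpl in H. lra. Qed.

Lemma lsum_ext {A : Type} (f g : A -> R) (l : list A) : (forall x, f x = g x) -> lsum f l = lsum g l.
Proof. intros H. induction l as [|x l IH]; simpl; [reflexivity|rewrite H, IH; reflexivity]. Qed.

Lemma Re_conj_mult_le (z w : C) : Re z * Re w + Im z * Im w <= Cmod z * Cmod w.
Proof.
  rewrite <- (Cmod_conj z), <- Cmod_mult. eapply Rle_trans; [|apply re_le_Cmod].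
  eapply Rle_trans; [|apply Rle_abs]. right. unfold Cconj, Re, Im; simpl. ring.
Qed.

(** Unlike a maximum of moduli, the sum G of their squares is differentiable. Since |f k| |f k'| <=
    G, each summand of its derivative is at most 2 K G, whence the rate c; then G(t) exp(-ct) does
    not increase. *)
Lemma gronwall_curves {A : Type} (f df : A -> R -> C) (l : list A) (K : R) :
  0 <= K ->
  (forall k t, In k l -> 0 <= t <= 1 -> curve_derive (f k) t (df k t)) ->
  (forall k t, In k l -> 0 <= t <= 1 ->
     exists k', In k' l /\ Cmod (df k t) <= K * Cmod (f k' t)) ->
  lsum (fun k => Cmod (f k 1) * Cmod (f k 1)) l
  <= exp (2 * K * INR (length l)) * lsum (fun k => Cmod (f k 0) * Cmod (f k 0)) l.
Proof.
  intros HK Hd Hb. set (c := 2 * K * INR (length l)).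
  set (G := fun t => lsum (fun k => Cmod (f k t) * Cmod (f k t)) l).
  set (dg := fun k t => 2 * (Re (f k t) * Re (df k t) + Im (f k t) * Im (df k t))).
  assert (HG : forall t, 0 <= t <= 1 -> is_derive G t (lsum (fun k => dg k t) l)).
  { intros t Ht. unfold G.
    apply (is_derive_ext (fun s => lsum (fun k => Re (f k s) * Re (f k s) + Im (f k s) * Im (f k s)) l)).
    - intros s. apply lsum_ext. intros k. symmetry. apply Cmod_sqr.
    - apply (lsum_derive (fun k s => Re (f k s) * Re (f k s) + Im (f k s) * Im (f k s)) dg).
      intros k Hk. destruct (Hd k t Hk Ht) as [D1 D2].
      replace (dg k t) with ((Re (df k t) * Re (f k t) + Re (f k t) * Re (df k t))
        + (Im (df k t) * Im (f k t) + Im (f k t) * Im (df k t))) by (unfold dg; ring).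
      exact (is_derive_plus _ _ t _ _ (is_derive_mult _ _ t _ _ D1 D1 Rmult_comm)
        (is_derive_mult _ _ t _ _ D2 D2 Rmult_comm)). }
  assert (HG' : forall t, 0 <= t <= 1 -> lsum (fun k => dg k t) l <= c * G t).
  { intros t Ht. unfold c. replace (2 * K * INR (length l) * G t) with (INR (length l) * (2 * K * G t)) by ring.
    apply lsum_le. intros k Hk. destruct (Hb k t Hk Ht) as [k' [Hk' Hle]].
    assert (Hpos : forall y, 0 <= Cmod (f y t) * Cmod (f y t))
      by (intros y; apply Rmult_le_pos; apply Cmod_ge_0).
    pose proof (lsum_ge (fun k => Cmod (f k t) * Cmod (f k t)) l k Hpos Hk) as G1.
    pose proof (lsum_ge (fun k => Cmod (f k t) * Cmod (f k t)) l k' Hpos Hk') as G2.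
    cbv beta in G1, G2. fold (G t) in G1, G2.
    unfold dg. pose proof (Re_conj_mult_le (f k t) (df k t)) as H1.
    pose proof (Cmod_ge_0 (f k t)) as P1.
    assert (H2 : Cmod (f k t) * Cmod (df k t) <= Cmod (f k t) * (K * Cmod (f k' t)))
      by (apply Rmult_le_compat_l; assumption).
    assert (H3 : Cmod (f k t) * Cmod (f k' t) <= G t).
    { pose proof (Rle_0_sqr (Cmod (f k t) - Cmod (f k' t))) as H. unfold Rsqr in H. lra. }
    assert (H4 : K * (Cmod (f k t) * Cmod (f k' t)) <= K * G t) by (apply Rmult_le_compat_l; assumption).
    lra. }
  assert (HH : forall t, 0 <= t <= 1 -> is_derive (fun s => G s * exp (- c * s)) t
            ((lsum (fun k => dg k t) l - c * G t) * exp (- c * t))).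
  { intros t Ht.
    replace ((lsum (fun k => dg k t) l - c * G t) * exp (- c * t))
      with (lsum (fun k => dg k t) l * exp (- c * t) + G t * (- c * exp (- c * t))) by ring.
    apply (is_derive_mult G (fun s => exp (- c * s)) t); [apply HG, Ht| |exact Rmult_comm].
    auto_derive; [exact I|ring]. }
  destruct (MVT_gen (fun s => G s * exp (- c * s)) 0 1
    (fun t => (lsum (fun k => dg k t) l - c * G t) * exp (- c * t))) as [x [Hx E]].
  { rewrite Rmin_left, Rmax_right by lra. intros t Ht. apply HH. lra. }
  { rewrite Rmin_left, Rmax_right by lra. intros t Ht. apply continuity_pt_filterlim.
    exact (ex_derive_continuous (K := R_AbsRing) (V := R_NormedModule)
      (fun s => G s * exp (- c * s)) t (ex_intro _ _ (HH t Ht))). }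
  rewrite Rmin_left, Rmax_right in Hx by lra.
  specialize (HG' x Hx). pose proof (exp_pos (- c * x)) as Hexp.
  rewrite Rmult_0_r, exp_0, Rmult_1_r, !Rmult_1_r in E.
  assert (HE : G 1 * exp (- c) <= G 0) by nra.
  fold (G 1) (G 0). replace (G 1) with (exp c * (G 1 * exp (- c))).
  - apply Rmult_le_compat_l; [left; apply exp_pos|exact HE].
  - rewrite exp_Ropp. field. apply Rgt_not_eq, exp_pos.
Qed.

Definition indices_upto (p : nat) : list (nat * nat) :=
  filter (fun k => Nat.leb (fst k + snd k) p) (list_prod (seq 0 (S p)) (seq 0 (S p))).

Lemma in_indices_upto (p i j : nat) : In (i, j) (indices_upto p) <-> (i + j <= p)%nat.
Proof.
  unfold indices_upto. rewrite filter_In, in_prod_iff, !in_seq, Nat.leb_le. simpl. lia.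
Qed.

(* Freezing the weights at the centre makes the sum of squares differentiable along the path;
   the path moves first in [z1], then in [z2]. *)
Lemma polydisc_growth (F : C * C -> C) (a b h1 h2 : C) (w1 w2 K : R) (p : nat) :
  holomorphic2 F -> 0 < w1 -> 0 < w2 -> 0 <= K ->
  (forall t, 0 <= t <= 1 -> D2 (a + RtoC t * h1, b)%C /\ D2 (a + h1, b + RtoC t * h2)%C) ->
  (forall t i j, 0 <= t <= 1 -> (i + j <= p)%nat -> exists i' j', (i' + j' <= p)%nat /\
     Cmod h1 * (Cmod (pderiv F (S i) j (a + RtoC t * h1, b)%C) / (w1 ^ i * w2 ^ j))
     <= K * (Cmod (pderiv F i' j' (a + RtoC t * h1, b)%C) / (w1 ^ i' * w2 ^ j'))) ->
  (forall t i j, 0 <= t <= 1 -> (i + j <= p)%nat -> exists i' j', (i' + j' <= p)%nat /\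
     Cmod h2 * (Cmod (pderiv F i (S j) (a + h1, b + RtoC t * h2)%C) / (w1 ^ i * w2 ^ j))
     <= K * (Cmod (pderiv F i' j' (a + h1, b + RtoC t * h2)%C) / (w1 ^ i' * w2 ^ j'))) ->
  exists i j, (i + j <= p)%nat /\
    Cmod (F (a + h1, b + h2)%C)
    <= (1 + exp (4 * K * INR (length (indices_upto p))) * INR (length (indices_upto p)))
       * (Cmod (pderiv F i j (a, b)) / (w1 ^ i * w2 ^ j)).
Proof.
  intros HF Hw1 Hw2 HK HD Hs1 Hs2.
  set (l := indices_upto p).
  set (W := fun k : nat * nat => w1 ^ fst k * w2 ^ snd k).
  assert (HW : forall k, 0 < W k) by (intros k; apply Rmult_lt_0_compat; apply pow_lt; assumption).
  assert (HWm : forall (z : C) k, Cmod (z * RtoC (/ W k)) = Cmod z / W k).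
  { intros z k. rewrite Cmod_mult, Cmod_R, Rabs_right; [reflexivity|].
    apply Rle_ge, Rlt_le, Rinv_0_lt_compat, HW. }
  set (g := fun (z : C * C) (k : nat * nat) => (pderiv F (fst k) (snd k) z * RtoC (/ W k))%C).
  set (G := fun z => lsum (fun k => Cmod (g z k) * Cmod (g z k)) l).
  set (c := 2 * K * INR (length l)).
  assert (Hseg : forall (u v : C) t, curve_derive (fun s => u + RtoC s * v)%C t v).
  { intros u v t. split; unfold Re, Im; simpl; auto_derive; auto; ring. }
  assert (G1 : G (a + h1, b)%C <= exp c * G (a, b)).
  { pose proof (gronwall_curves (fun k t => g (a + RtoC t * h1, b)%C k)
      (fun k t => h1 * pderiv F (S (fst k)) (snd k) (a + RtoC t * h1, b) * RtoC (/ W k))%C l K HK) as H.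
    cbv beta in H. rewrite Cmult_1_l, Cmult_0_l, Cplus_0_r in H. apply H.
    - intros [i j] t Hk Ht. unfold g. simpl fst; simpl snd.
      replace (h1 * pderiv F (S i) j (a + RtoC t * h1, b) * RtoC (/ W (i, j)))%C
        with (h1 * pderiv F (S i) j (a + RtoC t * h1, b) * RtoC (/ W (i, j))
          + pderiv F i j (a + RtoC t * h1, b) * 0)%C by ring.
      apply (curve_derive_mult (fun s => pderiv F i j (a + RtoC s * h1, b)%C) (fun _ => RtoC (/ W (i, j))));
        [|apply curve_derive_const].
      apply (curve_derive_comp (fun w => pderiv F i j (w, b)) (fun s => a + RtoC s * h1)%C); [apply Hseg|].
      apply (d1_correct (pderiv F i j)); [apply holomorphic2_pderiv, HF|apply HD, Ht].
    - intros [i j] t Hk Ht. apply in_indices_upto in Hk.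
      destruct (Hs1 t i j Ht Hk) as [i' [j' [Hij Hle]]].
      exists (i', j'). split; [apply in_indices_upto, Hij|].
      unfold g. rewrite !HWm, Cmod_mult. unfold W. simpl fst; simpl snd.
      unfold Rdiv in *. rewrite Rmult_assoc. exact Hle. }
  assert (G2 : G (a + h1, b + h2)%C <= exp c * G (a + h1, b)%C).
  { pose proof (gronwall_curves (fun k t => g (a + h1, b + RtoC t * h2)%C k)
      (fun k t => h2 * pderiv F (fst k) (S (snd k)) (a + h1, b + RtoC t * h2) * RtoC (/ W k))%C l K HK) as H.
    cbv beta in H. rewrite Cmult_1_l, Cmult_0_l, Cplus_0_r in H. apply H.
    - intros [i j] t Hk Ht. unfold g. simpl fst; simpl snd.
      replace (h2 * pderiv F i (S j) (a + h1, b + RtoC t * h2) * RtoC (/ W (i, j)))%C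
        with (h2 * pderiv F i (S j) (a + h1, b + RtoC t * h2) * RtoC (/ W (i, j))
          + pderiv F i j (a + h1, b + RtoC t * h2) * 0)%C by ring.
      apply (curve_derive_mult (fun s => pderiv F i j (a + h1, b + RtoC s * h2)%C) (fun _ => RtoC (/ W (i, j))));
        [|apply curve_derive_const].
      apply (curve_derive_comp (fun w => pderiv F i j (a + h1, w)%C) (fun s => b + RtoC s * h2)%C); [apply Hseg|].
      (* [pderiv F i (S j)] is not by definition a [d2] of [pderiv F i j]: here the mixed
         derivatives have to commute. *)
      rewrite <- (d2_pderiv F i j _ HF (proj2 (HD t Ht))).
      apply (d2_correct (pderiv F i j)); [apply holomorphic2_pderiv, HF|apply HD, Ht].
    - intros [i j] t Hk Ht. apply in_indices_upto in Hk.
      destruct (Hs2 t i j Ht Hk) as [i' [j' [Hij Hle]]].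
      exists (i', j'). split; [apply in_indices_upto, Hij|].
      unfold g. rewrite !HWm, Cmod_mult. unfold W. simpl fst; simpl snd.
      unfold Rdiv in *. rewrite Rmult_assoc. exact Hle. }
  assert (Hpos : forall z y, 0 <= Cmod (g z y) * Cmod (g z y))
    by (intros z y; apply Rmult_le_pos; apply Cmod_ge_0).
  assert (H00 : In (0%nat, 0%nat) l) by (apply in_indices_upto; lia).
  destruct (list_max_exists (fun k => Cmod (g (a, b) k) * Cmod (g (a, b) k)) l) as [[i j] [Hk Hmax]].
  { intros E. rewrite E in H00. exact H00. }
  pose proof (lsum_le _ l _ Hmax) as HG0.
  exists i, j. split; [apply in_indices_upto, Hk|].
  pose proof (lsum_ge _ l (0%nat, 0%nat) (Hpos (a + h1, b + h2)%C) H00) as H0. cbv beta in H0.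
  fold (G (a, b)) in HG0. fold (G (a + h1, b + h2)%C) in H0.
  assert (E0 : Cmod (g (a + h1, b + h2)%C (0%nat, 0%nat)) = Cmod (F (a + h1, b + h2)%C)).
  { unfold g. rewrite HWm. unfold W. simpl. change (pderiv F 0 0) with F. field. }
  assert (Ek : Cmod (g (a, b) (i, j)) = Cmod (pderiv F i j (a, b)) / (w1 ^ i * w2 ^ j)) by (unfold g; apply HWm).
  rewrite E0 in H0. rewrite Ek in HG0.
  set (x := Cmod (F (a + h1, b + h2)%C)) in *. set (y := Cmod (pderiv F i j (a, b)) / (w1 ^ i * w2 ^ j)) in *.
  assert (Hx : 0 <= x) by apply Cmod_ge_0.
  assert (Hy : 0 <= y) by (rewrite <- Ek; apply Cmod_ge_0).
  (* Each leg of the path contributes one factor exp c. The squares are compared with Q, and 1 + Q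
     stands in for its square root. *)
  replace (4 * K * INR (length l)) with (c + c) by (unfold c; ring). rewrite exp_plus.
  set (Q := exp c * exp c * INR (length l)).
  assert (HQ : 0 <= Q).
  { unfold Q. pose proof (exp_pos c). apply Rmult_le_pos; [nra|apply pos_INR]. }
  assert (Hxy : x * x <= Q * (y * y)).
  { pose proof (exp_pos c) as He.
    apply Rle_trans with (exp c * G (a + h1, b)%C); [lra|].
    apply Rle_trans with (exp c * (exp c * G (a, b))); [apply Rmult_le_compat_l; lra|].
    apply Rle_trans with (exp c * (exp c * (INR (length l) * (y * y)))); [|unfold Q; lra].
    apply Rmult_le_compat_l; [lra|]. apply Rmult_le_compat_l; lra. }
  apply Rsqr_incr_0_var; [|apply Rmult_le_pos; lra]. unfold Rsqr.
  eapply Rle_trans; [exact Hxy|].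
  replace ((1 + Q) * y * ((1 + Q) * y)) with ((1 + Q) * (1 + Q) * (y * y)) by ring.
  apply Rmult_le_compat_r; [apply Rmult_le_pos; assumption|]. nra.
Qed.

(** * Bounded index *)

Lemma L_term_bcoef (l1 l2 : C * C -> R) (F : C * C -> C) (z : C * C) (m n : nat) :
  0 < l1 z -> 0 < l2 z -> L_term l1 l2 F z m n = Cmod (bcoef F z m n) / (l1 z ^ m * l2 z ^ n).
Proof.
  intros H1 H2. unfold L_term, bcoef.
  pose proof (INR_fact_lt_0 m). pose proof (INR_fact_lt_0 n).
  pose proof (pow_lt _ m H1). pose proof (pow_lt _ n H2).
  assert (Hf : 0 < INR (fact m) * INR (fact n)) by (apply Rmult_lt_0_compat; assumption).
  rewrite Cmod_div by (apply RtoC_neq_0, Rgt_not_eq, Hf).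
  rewrite Cmod_R, Rabs_right by lra. field. lra.
Qed.

Lemma L_term_pos (l1 l2 : C * C -> R) (F : C * C -> C) (z : C * C) (m n : nat) :
  0 < l1 z -> 0 < l2 z -> 0 <= L_term l1 l2 F z m n.
Proof.
  intros H1 H2. rewrite L_term_bcoef by assumption.
  apply Rmult_le_pos; [apply Cmod_ge_0|]. left. apply Rinv_0_lt_compat.
  apply Rmult_lt_0_compat; apply pow_lt; assumption.
Qed.

(** As r_j < beta, Cauchy's estimate on the larger torus of radii beta / l_j gives the coefficients
    on the smaller one the decay q = max r_j / beta. The bound [M] serves only this convergence and
    disappears. Order p + 1 is never the main degree, and eta < r_j < beta turns the comparison into
    one between [L_term]s. *)
Lemma main_polynomial_hayman (l1 l2 : C * C -> R) (F : C * C -> C) (a b : C) (beta eta r1 r2 : R) (k0 p : nat) :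
  holomorphic2 F -> 1 < beta -> 0 < eta ->
  0 < l1 (a, b) -> 0 < l2 (a, b) ->
  beta / l1 (a, b) < 1 - Cmod a -> beta / l2 (a, b) < 1 - Cmod b ->
  eta < r1 < beta -> eta < r2 < beta -> (k0 <= p)%nat ->
  main_polynomial F (a, b) k0 (r1 / l1 (a, b)) (r2 / l2 (a, b)) ->
  forall m n, (m + n = S p)%nat -> exists i j, (i + j <= p)%nat /\
    L_term l1 l2 F (a, b) m n <= 2 * beta ^ p / eta ^ S p * L_term l1 l2 F (a, b) i j.
Proof.
  intros HF Hbeta Heta Hl1 Hl2 HD1 HD2 Hr1 Hr2 Hk HP m n Hmn.
  set (w1 := l1 (a, b)) in *. set (w2 := l2 (a, b)) in *.
  assert (Hb1 : 0 < beta / w1) by (apply Rdiv_lt_0_compat; lra).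
  assert (Hb2 : 0 < beta / w2) by (apply Rdiv_lt_0_compat; lra).
  destruct (holomorphic2_torus_bounded F a b (beta / w1) (beta / w2) HF) as [M [HM0 HM]]; [lra|lra|].
  set (q := Rmax r1 r2 / beta).
  assert (Hq : 0 <= q < 1).
  { assert (0 < Rmax r1 r2) by (eapply Rlt_le_trans; [|apply Rmax_l]; lra).
    assert (Rmax r1 r2 < beta) by (apply Rmax_lub_lt; lra).
    unfold q. split; [left; apply Rdiv_lt_0_compat; lra|]. apply Rlt_div_l; lra. }
  assert (Hq1 : r1 / beta <= q)
    by (unfold q; apply Rmult_le_compat_r; [left; apply Rinv_0_lt_compat; lra|apply Rmax_l]).
  assert (Hq2 : r2 / beta <= q)
    by (unfold q; apply Rmult_le_compat_r; [left; apply Rinv_0_lt_compat; lra|apply Rmax_r]).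
  assert (Hs1 : 0 <= r1 / w1) by (left; apply Rdiv_lt_0_compat; lra).
  assert (Hs2 : 0 <= r2 / w2) by (left; apply Rdiv_lt_0_compat; lra).
  assert (Hcoef : forall m n, Cmod (bcoef F (a, b) m n) * (r1 / w1) ^ m * (r2 / w2) ^ n <= 4 * M * q ^ (m + n)).
  { intros m' n'.
    pose proof (cauchy_estimate2 F a b (beta / w1) (beta / w2) M m' n' HF ltac:(lra) ltac:(lra) HM) as HC.
    pose proof (INR_fact_lt_0 m'). pose proof (INR_fact_lt_0 n').
    assert (Hf : 0 < INR (fact m') * INR (fact n')) by (apply Rmult_lt_0_compat; assumption).
    assert (Eb : Cmod (bcoef F (a, b) m' n') = Cmod (pderiv F m' n' (a, b)) / (INR (fact m') * INR (fact n'))).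
    { unfold bcoef. rewrite Cmod_div by (apply RtoC_neq_0, Rgt_not_eq, Hf).
      rewrite Cmod_R, Rabs_right by lra. reflexivity. }
    rewrite <- Eb in HC.
    pose proof (pow_lt _ m' Hb1) as P1. pose proof (pow_lt _ n' Hb2) as P2.
    apply Rle_trans with (4 * M / ((beta / w1) ^ m' * (beta / w2) ^ n') * (r1 / w1) ^ m' * (r2 / w2) ^ n').
    - apply Rmult_le_compat_r; [apply pow_le, Hs2|]. apply Rmult_le_compat_r; [apply pow_le, Hs1|]. exact HC.
    - replace (r1 / w1) with (r1 / beta * (beta / w1)) by (field; lra).
      replace (r2 / w2) with (r2 / beta * (beta / w2)) by (field; lra).
      rewrite !Rpow_mult_distr, pow_add.
      set (u := (beta / w1) ^ m') in *. set (v := (beta / w2) ^ n') in *.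
      replace (4 * M / (u * v) * ((r1 / beta) ^ m' * u) * ((r2 / beta) ^ n' * v))
        with (4 * M * ((r1 / beta) ^ m' * (r2 / beta) ^ n')) by (field; split; apply Rgt_not_eq; assumption).
      apply Rmult_le_compat_l; [lra|].
      assert (0 <= r1 / beta) by (left; apply Rdiv_lt_0_compat; lra).
      assert (0 <= r2 / beta) by (left; apply Rdiv_lt_0_compat; lra).
      apply Rmult_le_compat; try (apply pow_le; assumption); apply pow_incr; split; assumption. }
  pose proof (main_polynomial_coefficient F a b (r1 / w1) (r2 / w2) (4 * M) q k0 m n Hs1 Hs2
    ltac:(lra) Hq Hcoef HP ltac:(lia)) as H1.
  destruct (main_max_attained F (a, b) k0 (r1 / w1) (r2 / w2) Hs1 Hs2) as [i [Hi H2]].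
  exists i, (k0 - i)%nat. split; [lia|].
  rewrite !L_term_bcoef by assumption. fold w1 w2.
  set (x := Cmod (bcoef F (a, b) m n)) in *.
  set (j := (k0 - i)%nat) in *. set (y := Cmod (bcoef F (a, b) i j)) in *.
  assert (Hx : 0 <= x) by apply Cmod_ge_0. assert (Hy : 0 <= y) by apply Cmod_ge_0.
  assert (H3 : x * (r1 / w1) ^ m * (r2 / w2) ^ n <= 2 * (y * (r1 / w1) ^ i * (r2 / w2) ^ j)) by lra.
  assert (Epow : forall u m n, u * (r1 / w1) ^ m * (r2 / w2) ^ n = u / (w1 ^ m * w2 ^ n) * (r1 ^ m * r2 ^ n)).
  { intros u m' n'. unfold Rdiv. rewrite !Rpow_mult_distr, !pow_inv.
    field. split; apply pow_nonzero; lra. }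
  rewrite !Epow in H3.
  set (X := x / (w1 ^ m * w2 ^ n)) in *. set (Y := y / (w1 ^ i * w2 ^ j)) in *.
  assert (HX : 0 <= X).
  { apply Rmult_le_pos; [exact Hx|]. left; apply Rinv_0_lt_compat, Rmult_lt_0_compat; apply pow_lt; assumption. }
  assert (HY : 0 <= Y).
  { apply Rmult_le_pos; [exact Hy|]. left; apply Rinv_0_lt_compat, Rmult_lt_0_compat; apply pow_lt; assumption. }
  assert (A1 : eta ^ S p <= r1 ^ m * r2 ^ n).
  { rewrite <- Hmn, pow_add. apply Rmult_le_compat; try (apply pow_le; lra); apply pow_incr; lra. }
  assert (A2 : r1 ^ i * r2 ^ j <= beta ^ p).
  { apply Rle_trans with (beta ^ (i + j)).
    - rewrite pow_add. apply Rmult_le_compat; try (apply pow_le; lra); apply pow_incr; lra.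
    (* Here i + j = k0 <= p, and beta > 1 allows the exponent to be raised to p. *)
    - apply Rle_pow; [lra|unfold j; lia]. }
  assert (He : 0 < eta ^ S p) by (apply pow_lt; exact Heta).
  assert (A3 : X * eta ^ S p <= X * (r1 ^ m * r2 ^ n)) by (apply Rmult_le_compat_l; assumption).
  assert (A4 : Y * (r1 ^ i * r2 ^ j) <= Y * beta ^ p) by (apply Rmult_le_compat_l; assumption).
  replace (2 * beta ^ p / eta ^ S p * Y) with (2 * (Y * beta ^ p) / eta ^ S p) by (field; lra).
  apply (Rle_div_r X _ _ He). lra.
Qed.

Lemma weight_change (x v1 v2 w1 w2 La : R) (m n : nat) :
  0 <= x -> 0 < v1 -> 0 < v2 -> 0 < w1 -> 0 < w2 -> 0 <= La -> v1 <= La * w1 -> v2 <= La * w2 ->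
  x / (w1 ^ m * w2 ^ n) <= La ^ (m + n) * (x / (v1 ^ m * v2 ^ n)).
Proof.
  intros Hx Hv1 Hv2 Hw1 Hw2 HLa H1 H2.
  pose proof (pow_lt _ m Hv1). pose proof (pow_lt _ n Hv2).
  pose proof (pow_lt _ m Hw1). pose proof (pow_lt _ n Hw2).
  assert (Hle : v1 ^ m * v2 ^ n <= La ^ (m + n) * (w1 ^ m * w2 ^ n)).
  { replace (La ^ (m + n) * (w1 ^ m * w2 ^ n)) with ((La * w1) ^ m * (La * w2) ^ n)
      by (rewrite !Rpow_mult_distr, pow_add; ring).
    apply Rmult_le_compat; try lra; apply pow_incr; lra. }
  assert (0 < v1 ^ m * v2 ^ n) by (apply Rmult_lt_0_compat; assumption).
  assert (0 < w1 ^ m * w2 ^ n) by (apply Rmult_lt_0_compat; assumption).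
  set (v := v1 ^ m * v2 ^ n) in *. set (w := w1 ^ m * w2 ^ n) in *.
  replace (La ^ (m + n) * (x / v)) with (x * (La ^ (m + n) * w) / v / w) by (field; lra).
  apply Rmult_le_compat_r; [left; apply Rinv_0_lt_compat; assumption|].
  apply Rle_div_r; [assumption|]. apply Rmult_le_compat_l; assumption.
Qed.

Lemma INR_fact_le (m n : nat) : (m <= n)%nat -> INR (fact m) <= INR (fact n).
Proof. intros H. apply le_INR, fact_le, H. Qed.

Lemma INR_fact_ge_1 (n : nat) : 1 <= INR (fact n).
Proof. apply (INR_fact_le 0). lia. Qed.

(** Weights at the moving point [z] are exchanged for frozen ones: La^(p+1) is paid on the left and
    La^p on the right. The factorials of order p + 1 cost (p+1)!^2, those on the right are at least
    1. *)
Lemma derivative_transfer (l1 l2 : C * C -> R) (F : C * C -> C) (z : C * C) (w1 w2 La C0 : R) (p m n i j : nat) :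
  0 < l1 z -> 0 < l2 z -> 0 < w1 -> 0 < w2 -> 1 <= La -> 0 <= C0 ->
  l1 z <= La * w1 -> l2 z <= La * w2 -> w1 <= La * l1 z -> w2 <= La * l2 z ->
  (m + n = S p)%nat -> (i + j <= p)%nat ->
  L_term l1 l2 F z m n <= C0 * L_term l1 l2 F z i j ->
  Cmod (pderiv F m n z) / (w1 ^ m * w2 ^ n)
  <= La ^ S p * (INR (fact (S p)) * INR (fact (S p))) * C0 * La ^ p
     * (Cmod (pderiv F i j z) / (w1 ^ i * w2 ^ j)).
Proof.
  intros Hv1 Hv2 Hw1 Hw2 HLa HC0 A1 A2 B1 B2 Hmn Hij HL.
  set (v1 := l1 z) in *. set (v2 := l2 z) in *.
  set (x := Cmod (pderiv F m n z)). set (y := Cmod (pderiv F i j z)).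
  assert (Hx : 0 <= x) by apply Cmod_ge_0. assert (Hy : 0 <= y) by apply Cmod_ge_0.
  unfold L_term in HL. fold v1 v2 x y in HL.
  pose proof (weight_change x v1 v2 w1 w2 La m n Hx Hv1 Hv2 Hw1 Hw2 ltac:(lra) A1 A2) as T1.
  pose proof (weight_change y w1 w2 v1 v2 La i j Hy Hw1 Hw2 Hv1 Hv2 ltac:(lra) B1 B2) as T2.
  rewrite Hmn in T1.
  assert (Hwpos : 0 < w1 ^ i * w2 ^ j) by (apply Rmult_lt_0_compat; apply pow_lt; assumption).
  set (Y := y / (w1 ^ i * w2 ^ j)) in *.
  assert (HY : 0 <= Y) by (apply Rmult_le_pos; [exact Hy|left; apply Rinv_0_lt_compat; exact Hwpos]).
  assert (T3 : La ^ (i + j) * Y <= La ^ p * Y)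
    by (apply Rmult_le_compat_r; [exact HY|apply Rle_pow; [exact HLa|exact Hij]]).
  pose proof (INR_fact_ge_1 m) as Fm. pose proof (INR_fact_ge_1 n) as Fn.
  pose proof (INR_fact_ge_1 i) as Fi. pose proof (INR_fact_ge_1 j) as Fj.
  pose proof (INR_fact_le m (S p) ltac:(lia)) as Fm'. pose proof (INR_fact_le n (S p) ltac:(lia)) as Fn'.
  set (fm := INR (fact m)) in *. set (fn := INR (fact n)) in *.
  set (fi := INR (fact i)) in *. set (fj := INR (fact j)) in *. set (fp := INR (fact (S p))) in *.
  assert (Pv : 0 < v1 ^ m * v2 ^ n) by (apply Rmult_lt_0_compat; apply pow_lt; assumption).
  assert (Pv' : 0 < v1 ^ i * v2 ^ j) by (apply Rmult_lt_0_compat; apply pow_lt; assumption).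
  assert (E1 : x / (v1 ^ m * v2 ^ n) = fm * fn * (x / (fm * fn * v1 ^ m * v2 ^ n))).
  { field. repeat split; try (apply pow_nonzero; lra); lra. }
  assert (E2 : y / (fi * fj * v1 ^ i * v2 ^ j) <= y / (v1 ^ i * v2 ^ j)).
  { replace (y / (fi * fj * v1 ^ i * v2 ^ j)) with (y / (v1 ^ i * v2 ^ j) * / (fi * fj))
      by (field; repeat split; try (apply pow_nonzero; lra); lra).
    rewrite <- (Rmult_1_r (y / (v1 ^ i * v2 ^ j))) at 2. apply Rmult_le_compat_l.
    - apply Rmult_le_pos; [exact Hy|left; apply Rinv_0_lt_compat; exact Pv'].
    - rewrite <- Rinv_1. apply Rinv_le_contravar; nra. }
  set (U := x / (fm * fn * v1 ^ m * v2 ^ n)) in *. set (V := y / (fi * fj * v1 ^ i * v2 ^ j)) in *.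
  assert (HV : V <= La ^ p * Y) by lra.
  assert (HU : U <= C0 * (La ^ p * Y)) by (eapply Rle_trans; [exact HL|apply Rmult_le_compat_l; assumption]).
  assert (HLp : 0 <= La ^ p) by (apply pow_le; lra).
  assert (HLp' : 0 <= La ^ S p) by (apply pow_le; lra).
  assert (Hff : fm * fn <= fp * fp) by (apply Rmult_le_compat; lra).
  assert (Hff0 : 0 <= fm * fn) by (apply Rmult_le_pos; lra).
  assert (HR : 0 <= C0 * (La ^ p * Y)) by (apply Rmult_le_pos; [exact HC0|apply Rmult_le_pos; assumption]).
  eapply Rle_trans; [exact T1|]. rewrite E1.
  replace (La ^ S p * (fp * fp) * C0 * La ^ p * Y) with (La ^ S p * (fp * fp * (C0 * (La ^ p * Y)))) by ring.
  apply Rmult_le_compat_l; [exact HLp'|].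
  apply Rle_trans with (fm * fn * (C0 * (La ^ p * Y))).
  - apply Rmult_le_compat_l; assumption.
  - apply Rmult_le_compat_r; assumption.
Qed.

(** One constant serves both directions; it is at least 1 so that its powers grow with the
    exponent. *)
Lemma lambda_bounds_ratio (beta : R) (l1 l2 lj : C * C -> R) :
  0 <= beta -> (forall z, D2 z -> 0 < lj z) -> lambda_bounds beta l1 l2 lj ->
  exists La, 1 <= La /\ forall z0 z, D2 z0 -> D2 z -> polydisc z0 (beta / l1 z0) (beta / l2 z0) z ->
    lj z <= La * lj z0 /\ lj z0 <= La * lj z.
Proof.
  intros Hb Hpos HL. destruct (HL beta beta ltac:(lra) ltac:(lra)) as [[c [Hc H1]] [M H2]].
  exists (Rmax 1 (Rmax M (/ c))). split; [apply Rmax_l|].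
  intros z0 z Hz0 Hz Hp. specialize (H1 z0 z Hz0 Hz Hp). specialize (H2 z0 z Hz0 Hz Hp).
  pose proof (Hpos z0 Hz0) as P0. pose proof (Hpos z Hz) as P1.
  assert (R1 : M <= Rmax 1 (Rmax M (/ c))) by (eapply Rle_trans; [apply Rmax_l|apply Rmax_r]).
  assert (R2 : / c <= Rmax 1 (Rmax M (/ c))) by (eapply Rle_trans; [apply Rmax_r|apply Rmax_r]).
  apply Rle_div_l in H2; [|exact P0]. apply Rle_div_r in H1; [|exact P0].
  split.
  - eapply Rle_trans; [exact H2|]. apply Rmult_le_compat_r; lra.
  - apply Rle_trans with (/ c * lj z).
    + replace (lj z0) with (/ c * (c * lj z0)) by (field; lra).
      apply Rmult_le_compat_l; [left; apply Rinv_0_lt_compat; exact Hc|exact H1].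
    + apply Rmult_le_compat_r; lra.
Qed.

Theorem theorem9 (beta : R) (l1 l2 : C * C -> R) (F : C * C -> C) :
  1 < beta ->
  Q2 beta l1 l2 ->
  analytic_D2 F ->
  (exists p : nat, forall d : R, 0 < d <= beta ->
     exists eta : R, 0 < eta < d /\
       forall z0 : C * C, D2 z0 ->
         exists (r1 r2 : R) (k0 : nat),
           eta < r1 < d /\ eta < r2 < d /\ (k0 <= p)%nat /\
           main_polynomial F z0 k0 (r1 / l1 z0) (r2 / l2 z0)) ->
  bounded_L_index l1 l2 F.
Proof.
  intros Hbeta [HL [HQ1 HQ2]] HFa [p Hp].
  pose proof (analytic_D2_holomorphic2 F HFa) as HF.
  destruct (Hp beta ltac:(lra)) as [eta [Heta Hmain]].
  (* The inequality l_j > beta / (1 - |z_j|) says that the closed polydisc of radii beta / l_j(z)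
     stays inside the bidisc. *)
  assert (Hl : forall z, D2 z -> 0 < l1 z /\ 0 < l2 z /\
            beta / l1 z < 1 - Cmod (fst z) /\ beta / l2 z < 1 - Cmod (snd z)).
  { intros z Hz. pose proof Hz as [Z1 Z2]. destruct (HL z Hz) as [_ [_ [_ [_ [G1 G2]]]]].
    assert (P1 : 0 < beta / (1 - Cmod (fst z))) by (apply Rdiv_lt_0_compat; lra).
    assert (P2 : 0 < beta / (1 - Cmod (snd z))) by (apply Rdiv_lt_0_compat; lra).
    apply Rlt_div_l in G1; [|lra]. apply Rlt_div_l in G2; [|lra].
    assert (Q1 : 0 < l1 z) by nra. assert (Q2 : 0 < l2 z) by nra.
    split; [exact Q1|]. split; [exact Q2|]. split; apply Rlt_div_l; lra. }
  destruct (lambda_bounds_ratio beta l1 l2 l1) as [La1 [HLa1 HR1]];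
    [lra|intros z Hz; apply Hl, Hz|exact HQ1|].
  destruct (lambda_bounds_ratio beta l1 l2 l2) as [La2 [HLa2 HR2]];
    [lra|intros z Hz; apply Hl, Hz|exact HQ2|].
  set (La := Rmax La1 La2).
  assert (HLa : 1 <= La) by (eapply Rle_trans; [exact HLa1|apply Rmax_l]).
  assert (HR : forall z0 z, D2 z0 -> D2 z -> polydisc z0 (beta / l1 z0) (beta / l2 z0) z ->
            l1 z <= La * l1 z0 /\ l2 z <= La * l2 z0 /\ l1 z0 <= La * l1 z /\ l2 z0 <= La * l2 z).
  { intros z0 z Hz0 Hz Hpd. destruct (HR1 z0 z Hz0 Hz Hpd) as [A1 A2]. destruct (HR2 z0 z Hz0 Hz Hpd) as [B1 B2].
    destruct (Hl z Hz) as [P1 [P2 _]]. destruct (Hl z0 Hz0) as [P3 [P4 _]].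
    pose proof (Rmax_l La1 La2). pose proof (Rmax_r La1 La2). fold La in H, H0.
    repeat split; (eapply Rle_trans; [eassumption|]); apply Rmult_le_compat_r; lra. }
  set (C0 := 2 * beta ^ p / eta ^ S p).
  assert (HC0 : 0 <= C0).
  { left. apply Rdiv_lt_0_compat; [|apply pow_lt; lra]. apply Rmult_lt_0_compat; [lra|apply pow_lt; lra]. }
  assert (HH : forall z, D2 z -> forall m n, (m + n = S p)%nat -> exists i j, (i + j <= p)%nat /\
            L_term l1 l2 F z m n <= C0 * L_term l1 l2 F z i j).
  { intros [a b] Hz. destruct (Hl _ Hz) as [P1 [P2 [P3 P4]]].
    destruct (Hmain _ Hz) as [r1 [r2 [k0 [Hr1 [Hr2 [Hk HP]]]]]].
    exact (main_polynomial_hayman l1 l2 F a b beta eta r1 r2 k0 p HF Hbeta ltac:(lra) P1 P2 P3 P4 Hr1 Hr2 Hk HP). }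
  set (C1 := La ^ S p * (INR (fact (S p)) * INR (fact (S p))) * C0 * La ^ p).
  (* Orders up to p are bounded by themselves with constant 1; only order p + 1 needs [C1]. *)
  set (C2 := Rmax 1 C1).
  assert (HC2 : 1 <= C2) by apply Rmax_l.
  (* A leg of length beta / l_j(z0) times the extra weight l_j(z0) of a derivative one order higher
     leaves beta. *)
  set (K := beta * C2).
  assert (HK : 0 <= K) by (apply Rmult_le_pos; lra).
  assert (Hstep : forall z0 z, D2 z0 -> D2 z -> polydisc z0 (beta / l1 z0) (beta / l2 z0) z ->
    forall m n, (m + n <= S p)%nat -> exists i j, (i + j <= p)%nat /\
      Cmod (pderiv F m n z) / (l1 z0 ^ m * l2 z0 ^ n)
      <= C2 * (Cmod (pderiv F i j z) / (l1 z0 ^ i * l2 z0 ^ j))).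
  { intros z0 z Hz0 Hz Hpd m n Hmn.
    destruct (Hl z Hz) as [P1 [P2 _]]. destruct (Hl z0 Hz0) as [P3 [P4 _]].
    assert (Hpos : forall i j, 0 <= Cmod (pderiv F i j z) / (l1 z0 ^ i * l2 z0 ^ j)).
    { intros i j. apply Rmult_le_pos; [apply Cmod_ge_0|]. left.
      apply Rinv_0_lt_compat, Rmult_lt_0_compat; apply pow_lt; assumption. }
    destruct (Nat.eq_dec (m + n) (S p)) as [E|E].
    - destruct (HH z Hz m n E) as [i [j [Hij HLt]]]. exists i, j. split; [exact Hij|].
      destruct (HR z0 z Hz0 Hz Hpd) as [R1 [R2 [R3 R4]]].
      apply Rle_trans with (C1 * (Cmod (pderiv F i j z) / (l1 z0 ^ i * l2 z0 ^ j))).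
      + apply (derivative_transfer l1 l2 F z (l1 z0) (l2 z0) La C0 p m n i j); assumption.
      + apply Rmult_le_compat_r; [apply Hpos|apply Rmax_r].
    - exists m, n. split; [lia|]. specialize (Hpos m n). nra. }
  set (N := INR (length (indices_upto p))).
  set (E := 1 + exp (4 * K * N) * N).
  set (ff := INR (fact p) * INR (fact p)).
  assert (HE : 0 < E).
  { unfold E. pose proof (exp_pos (4 * K * N)). assert (0 <= N) by apply pos_INR. nra. }
  assert (Hff : 0 < ff) by (apply Rmult_lt_0_compat; apply INR_fact_lt_0).
  assert (Hbound : forall z0, D2 z0 -> exists i j, (i + j <= p)%nat /\
            forall m n, L_term l1 l2 F z0 m n <= 4 * E * ff * (/ beta) ^ (m + n) * L_term l1 l2 F z0 i j).
  { intros [a b] Hz0. pose proof (Hstep (a, b)) as Hst. destruct (Hl _ Hz0) as [P1 [P2 [P3 P4]]].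
    set (w1 := l1 (a, b)) in *. set (w2 := l2 (a, b)) in *. simpl in P3, P4.
    assert (Hb1 : 0 < beta / w1) by (apply Rdiv_lt_0_compat; lra).
    assert (Hb2 : 0 < beta / w2) by (apply Rdiv_lt_0_compat; lra).
    assert (Hw : forall i j, 0 < w1 ^ i * w2 ^ j)
      by (intros i j; apply Rmult_lt_0_compat; apply pow_lt; assumption).
    (* The index is fixed at the centre, before any point of the torus is considered:
       [polydisc_growth] may return a different index for each point, and all of them are dominated
       by this one. *)
    destruct (list_max_exists (fun k => Cmod (pderiv F (fst k) (snd k) (a, b)) / (w1 ^ fst k * w2 ^ snd k))
      (indices_upto p)) as [[i j] [Hk Hmax]].
    { intros E0. assert (H0 : In (0%nat, 0%nat) (indices_upto p)) by (apply in_indices_upto; lia).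
      rewrite E0 in H0. exact H0. }
    apply in_indices_upto in Hk. exists i, j. split; [exact Hk|].
    simpl fst in Hmax. simpl snd in Hmax.
    set (T := Cmod (pderiv F i j (a, b)) / (w1 ^ i * w2 ^ j)) in *.
    assert (HT0 : 0 <= T).
    { apply Rmult_le_pos; [apply Cmod_ge_0|]. left. apply Rinv_0_lt_compat, Hw. }
    assert (HT : T <= ff * L_term l1 l2 F (a, b) i j).
    { unfold L_term. fold w1 w2.
      pose proof (INR_fact_ge_1 i). pose proof (INR_fact_ge_1 j).
      pose proof (INR_fact_le i p ltac:(lia)). pose proof (INR_fact_le j p ltac:(lia)).
      replace (Cmod (pderiv F i j (a, b)) / (INR (fact i) * INR (fact j) * w1 ^ i * w2 ^ j))
        with (T / (INR (fact i) * INR (fact j)))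
        by (unfold T; field; repeat split; try (apply pow_nonzero; lra); lra).
      assert (Hf : 0 < INR (fact i) * INR (fact j)) by (apply Rmult_lt_0_compat; lra).
      assert (Hfle : INR (fact i) * INR (fact j) <= ff) by (apply Rmult_le_compat; lra).
      replace (ff * (T / (INR (fact i) * INR (fact j)))) with (T * ff / (INR (fact i) * INR (fact j))) by (field; lra).
      apply (Rle_div_r T _ _ Hf). apply Rmult_le_compat_l; assumption. }
    assert (HM : forall t u, 0 <= t <= 2 * PI -> 0 <= u <= 2 * PI ->
      Cmod (F (a + RtoC (beta / w1) * cis t, b + RtoC (beta / w2) * cis u)%C) <= E * T).
    { intros t u _ _.
      set (h1 := (RtoC (beta / w1) * cis t)%C). set (h2 := (RtoC (beta / w2) * cis u)%C).
      assert (Hh1 : Cmod h1 = beta / w1) by (unfold h1; rewrite Cmod_mult, Cmod_cis, Cmod_R, Rabs_right; lra).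
      assert (Hh2 : Cmod h2 = beta / w2) by (unfold h2; rewrite Cmod_mult, Cmod_cis, Cmod_R, Rabs_right; lra).
      assert (Hsc : forall s h, 0 <= s <= 1 -> Cmod (RtoC s * h) <= Cmod h).
      { intros s h Hs. rewrite Cmod_mult, Cmod_R, Rabs_right by lra. pose proof (Cmod_ge_0 h). nra. }
      assert (Hpd : forall k1 k2, Cmod k1 <= beta / w1 -> Cmod k2 <= beta / w2 ->
                polydisc (a, b) (beta / w1) (beta / w2) (a + k1, b + k2)%C /\ D2 (a + k1, b + k2)%C).
      { intros k1 k2 A B. split.
        - split; simpl.
          + replace (a + k1 - a)%C with k1 by ring. exact A.
          + replace (b + k2 - b)%C with k2 by ring. exact B.
        - apply (D2_near (a, b)); [exact Hz0| |]; simpl.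
          + replace (a + k1 - a)%C with k1 by ring. lra.
          + replace (b + k2 - b)%C with k2 by ring. lra. }
      assert (Hpath1 : forall s, 0 <= s <= 1 ->
                polydisc (a, b) (beta / w1) (beta / w2) (a + RtoC s * h1, b)%C /\ D2 (a + RtoC s * h1, b)%C).
      { intros s Hs. pose proof (Hpd (RtoC s * h1)%C (RtoC 0)) as H0.
        rewrite Cplus_0_r, Cmod_0 in H0. apply H0; [|lra]. rewrite <- Hh1. apply Hsc, Hs. }
      assert (Hpath2 : forall s, 0 <= s <= 1 ->
                polydisc (a, b) (beta / w1) (beta / w2) (a + h1, b + RtoC s * h2)%C /\ D2 (a + h1, b + RtoC s * h2)%C).
      { intros s Hs. apply Hpd; [lra|]. rewrite <- Hh2. apply Hsc, Hs. }
      destruct (polydisc_growth F a b h1 h2 w1 w2 K p HF P1 P2 HK) as [i' [j' [Hij' Hle]]].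
      - intros s Hs. split; [apply Hpath1, Hs|apply Hpath2, Hs].
      - intros s i0 j0 Hs Hij. destruct (Hpath1 s Hs) as [Q1 Q2].
        destruct (Hst _ Hz0 Q2 Q1 (S i0) j0 ltac:(lia)) as [i' [j' [Hij' Hle]]].
        exists i', j'. split; [exact Hij'|]. rewrite Hh1.
        set (x := Cmod (pderiv F (S i0) j0 (a + RtoC s * h1, b)%C)) in *.
        replace (beta / w1 * (x / (w1 ^ i0 * w2 ^ j0))) with (beta * (x / (w1 ^ S i0 * w2 ^ j0)))
          by (simpl; field; repeat split; try (apply pow_nonzero; lra); lra).
        unfold K. rewrite (Rmult_assoc beta). apply Rmult_le_compat_l; [lra|exact Hle].
      - intros s i0 j0 Hs Hij. destruct (Hpath2 s Hs) as [Q1 Q2].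
        destruct (Hst _ Hz0 Q2 Q1 i0 (S j0) ltac:(lia)) as [i' [j' [Hij' Hle]]].
        exists i', j'. split; [exact Hij'|]. rewrite Hh2.
        set (x := Cmod (pderiv F i0 (S j0) (a + h1, b + RtoC s * h2)%C)) in *.
        replace (beta / w2 * (x / (w1 ^ i0 * w2 ^ j0))) with (beta * (x / (w1 ^ i0 * w2 ^ S j0)))
          by (simpl; field; repeat split; try (apply pow_nonzero; lra); lra).
        unfold K. rewrite (Rmult_assoc beta). apply Rmult_le_compat_l; [lra|exact Hle].
      - eapply Rle_trans; [exact Hle|]. fold N. fold E. apply Rmult_le_compat_l; [lra|].
        apply (Hmax (i', j')). apply in_indices_upto, Hij'. }
    intros m n.
    pose proof (cauchy_estimate2 F a b (beta / w1) (beta / w2) (E * T) m n HF ltac:(lra) ltac:(lra) HM) as HC.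
    pose proof (INR_fact_lt_0 m). pose proof (INR_fact_lt_0 n).
    pose proof (pow_lt _ m P1) as W1. pose proof (pow_lt _ n P2) as W2.
    assert (Hbp : 0 <= (/ beta) ^ (m + n)) by (apply pow_le; left; apply Rinv_0_lt_compat; lra).
    apply Rle_trans with (4 * (E * T) * (/ beta) ^ (m + n)).
    - unfold L_term. fold w1 w2.
      replace (Cmod (pderiv F m n (a, b)) / (INR (fact m) * INR (fact n) * w1 ^ m * w2 ^ n))
        with (Cmod (pderiv F m n (a, b)) / (INR (fact m) * INR (fact n)) * / (w1 ^ m * w2 ^ n))
        by (field; repeat split; apply Rgt_not_eq; assumption).
      replace (4 * (E * T) * (/ beta) ^ (m + n))
        with (4 * (E * T) / ((beta / w1) ^ m * (beta / w2) ^ n) * / (w1 ^ m * w2 ^ n)).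
      + apply Rmult_le_compat_r; [left; apply Rinv_0_lt_compat, Hw|exact HC].
      + unfold Rdiv. rewrite !Rpow_mult_distr, !pow_inv, pow_add.
        field. repeat split; try (apply pow_nonzero; lra); apply Rgt_not_eq; assumption.
    - replace (4 * E * ff * (/ beta) ^ (m + n) * L_term l1 l2 F (a, b) i j)
        with (4 * (E * (ff * L_term l1 l2 F (a, b) i j)) * (/ beta) ^ (m + n)) by ring.
      apply Rmult_le_compat_r; [exact Hbp|]. apply Rmult_le_compat_l; [lra|].
      apply Rmult_le_compat_l; lra. }
  assert (Hc : 0 < 4 * E * ff) by (apply Rmult_lt_0_compat; lra).
  destruct (pow_small (/ beta) (/ (4 * E * ff))) as [N0 HN0].
  { split; [left; apply Rinv_0_lt_compat; lra|]. rewrite <- Rinv_1. apply Rinv_lt_contravar; lra. }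
  { apply Rinv_0_lt_compat, Hc. }
  exists (max p N0). intros z Hz m n.
  destruct (le_lt_dec (m + n) (max p N0)) as [Hle|Hlt].
  - exists m, n. split; [exact Hle|apply Rle_refl].
  - destruct (Hbound z Hz) as [i [j [Hij HB]]]. exists i, j. split; [lia|].
    eapply Rle_trans; [apply HB|]. destruct (Hl z Hz) as [P1 [P2 _]].
    pose proof (L_term_pos l1 l2 F z i j P1 P2) as HLp.
    specialize (HN0 (m + n)%nat ltac:(lia)).
    assert (Hs : 4 * E * ff * (/ beta) ^ (m + n) <= 1).
    { apply Rle_trans with (4 * E * ff * / (4 * E * ff)); [apply Rmult_le_compat_l; lra|].
      right. apply Rinv_r, Rgt_not_eq, Hc. }
    rewrite <- (Rmult_1_l (L_term l1 l2 F z i j)) at 2. apply Rmult_le_compat_r; assumption.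
Qed.
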